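(* Let $\mathcal F$ be a family of pairs $(f,g)$ of non-negative measurable functions on $\mathbb R^n$ and let $1\le\mathfrak p_-<\mathfrak p_+\le\infty$. Assume that there exist exponents $p_0,q_0\in(0,\infty)$ such that $p_0\in[\mathfrak p_-,\mathfrak p_+]$ and for all weights $v$ with $v^{p_0}\in A_{p_0/\mathfrak p_-}\cap RH_{(\mathfrak p_+/p_0)'}$, $$\|fv\|_{L^{q_0}}\le\Phi\big([v^{p_0}]_{A_{p_0/\mathfrak p_-}\cap RH_{(\mathfrak p_+/p_0)'}}\big)\|gv\|_{L^{p_0}},\qquad(f,g)\in\mathcal F,$$ where $\Phi:[1,\infty)\to[1,\infty)$ is an increasing function. Then for all exponents $p\in(\mathfrak p_-,\mathfrak p_+)$ and $q\in(0,\infty)$ satisfying $\frac1p-\frac1q=\frac1{p_0}-\frac1{q_0}$, and all weights $w$ with $w^p\in A_{p/\mathfrak p_-}\cap RH_{(\mathfrak p_+/p)'}$, $$\|fw\|_{L^q}\le2^{\max\{\frac{\tau_p}p,\frac{\tau_p'}{p_0}\}}\,\Phi\big(C_0\,[w^p]_{A_{p/\mathfrak p_-}\cap RH_{(\mathfrak p_+/p)'}}^{\gamma(p,p_0)}\big)\|gw\|_{L^p},\qquad(f,g)\in\mathcal F,$$ where $C_0$ depends only on $n,p,p_0,\mathfrak p_-,\mathfrak p_+$, and $$\gamma(p,p_0):=\begin{cases}\max\big\{1,\frac{\tau_{p_0}-1}{\tau_p-1}\big\},&p_0<\mathfrak p_+,\\ \frac{p_0}{\tau_p-1}\big(\frac1{\mathfrak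 p_-}-\frac1{\mathfrak p_+}\big),&p_0=\mathfrak p_+.\end{cases}$$
   Context: A weight on $\mathbb R^n$ is a measurable function $w$ with $0<w<\infty$ a.e. $L^p$ (quasi-)norms are with respect to Lebesgue measure on $\mathbb R^n$. $s'$ denotes the conjugate exponent (with $1'=\infty$, $\infty'=1$, $\infty/p=\infty$). $\fint_Q$ is the average over $Q$; suprema are over all cubes $Q\subset\mathbb R^n$. $[w]_{A_p}=\sup_Q(\fint_Qw)(\fint_Qw^{1-p'})^{p-1}$ for $1<p<\infty$; $[w]_{A_1}=\sup_Q(\fint_Qw)\,\mathrm{ess\,sup}_Qw^{-1}$. For $1<s\le\infty$, $[w]_{RH_s}=\sup_Q(\fint_Qw^s)^{1/s}(\fint_Qw)^{-1}$ (with $\mathrm{ess\,sup}_Qw$ in place of $(\fint_Qw^s)^{1/s}$ if $s=\infty$). $A_p$, $RH_s$ are the classes of weights with finite constants; $RH_1:=\bigcup_{1<s\le\infty}RH_s=A_\infty=\bigcup_{p\ge1}A_p$. For finite $p\in[\mathfrak p_-,\mathfrak p_+]$: $\tau_p:=\big(\frac{\mathfrak p_+}p\big)'\big(\frac p{\mathfrak p_-}-1\big)+1$ (for $p<\mathfrak p_+$), $\tau_p'$ is its conjugate exponent, and $[w^p]_{A_{p/\mathfrak p_-}\cap RH_{(\mathfrak p_+/p)'}}:=[w^{p(\mathfrak p_+/p)'}]_{A_{\tau_p}}$ if $p<\mathfrak p_+$, and $:=\max\{[w^p]_{A_{p/\mathfrak p_-}},[w^p]_{RH_{(\mathfrak p_+/p)'}}\}$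 if $p=\mathfrak p_+$. *)

(* Defs.v *)
From HB Require Import structures.
From mathcomp Require Import all_boot all_order all_algebra.
From mathcomp Require Import all_classical all_reals all_analysis.
From mathcomp Require Import measurable_realfun ess_sup_inf.

Set Implicit Arguments.
Unset Strict Implicit.
Unset Printing Implicit Defensive.

Import Order.TTheory GRing.Theory Num.Theory.
Import numFieldNormedType.Exports.

Local Open Scope classical_set_scope.
Local Open Scope ring_scope.
Local Open Scope ereal_scope.

Lemma sigma_finite_prod d1 d2 (T1 : measurableType d1) (T2 : measurableType d2)
    (R : realType) (m1 : {sigma_finite_measure set T1 -> \bar R})
    (m2 : {sigma_finite_measure set T2 -> \bar R}) :
  sigma_finite setT (m1 \x m2).
Proof.
have /sigma_finiteP[F [TF ndF Foo]] := sigma_finiteT m1.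
have /sigma_finiteP[G [TG ndG Goo]] := sigma_finiteT m2.
exists (fun n => F n `*` G n).
  rewrite -setXTT TF TG predeqE => -[x y]; split.
    move=> [/= [n _ Fnx] [k _ Gky]]; exists (maxn n k) => //; split.
    - by move: x Fnx; exact/subsetPset/ndF/leq_maxl.
    - by move: y Gky; exact/subsetPset/ndG/leq_maxr.
  by move=> [n _ []/= ? ?]; split; exists n.
move=> k; have [? ?] := Foo k; have [? ?] := Goo k.
split; first exact: measurableX.
by rewrite product_measure1E// lte_mul_pinfty// ge0_fin_numE.
Qed.

Section borel_lebesgue.
Context {R : realType}.
Local Notation B := (measurableTypeR R).

Definition cons_tup n (x : B * n.-tuple B) : n.+1.-tuple B :=
  [the n.+1.-tuple B of x.1 :: x.2].

Lemma measurable_cons_tup n : measurable_fun setT (@cons_tup n).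
Proof. by apply: measurable_cons. Qed.

Section step.
Context n (m : {sigma_finite_measure set (n.-tuple B) -> \bar R}).

Definition leb_step : set (n.+1.-tuple B) -> \bar R :=
  pushforward ((@lebesgue_measure R) \x m) (@cons_tup n).

Let leb_step0 : leb_step set0 = 0.
Proof. by rewrite /leb_step /pushforward preimage_set0 measure0. Qed.

Let leb_step_ge0 A : 0 <= leb_step A.
Proof. by rewrite /leb_step /pushforward; exact: measure_ge0. Qed.

Let leb_step_sigma_additive : semi_sigma_additive leb_step.
Proof.
move=> F mF tF mUF; rewrite /leb_step /pushforward preimage_bigcup.
apply: measure_semi_sigma_additive.
- by move=> i; rewrite -[X in measurable X]setTI; exact: measurable_cons_tup.
- apply/trivIsetP => /= i j _ _ ij; rewrite -preimage_setI.
  by move/trivIsetP : tF => /(_ _ _ _ _ ij) ->//; rewrite preimage_set0.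
- rewrite -preimage_bigcup -[X in measurable X]setTI.
  exact: measurable_cons_tup.
Qed.

HB.instance Definition _ := isMeasure.Build _ _ _ leb_step
  leb_step0 leb_step_ge0 leb_step_sigma_additive.

Let leb_step_sigma_finite : sigma_finite setT leb_step.
Proof.
have [F TF Foo] := sigma_finite_prod (@lebesgue_measure R) m.
pose unc (x : n.+1.-tuple B) : B * n.-tuple B :=
  (tnth x ord0, [tuple of behead x]).
have munc : measurable_fun setT unc.
  by apply: measurable_fun_pair; [exact: measurable_tnth|
                                  exact: measurable_behead].
have uncK : cancel (@cons_tup n) unc.
  by move=> [a t]; congr pair; apply/val_inj.
exists (fun i => unc @^-1` F i).
  by rewrite -preimage_bigcup -TF preimage_setT.
move=> i; have [mFi Fioo] := Foo i; split.
  by rewrite -[X in measurable X]setTI; exact: munc.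
rewrite /leb_step /pushforward -comp_preimage.
suff -> : unc \o @cons_tup n = id by [].
by apply/funext => x; exact: uncK.
Qed.

HB.instance Definition _ := Measure_isSigmaFinite.Build _ _ _ leb_step
  leb_step_sigma_finite.

End step.

(* The n-fold product of the Lebesgue measure of the line, on Borel sets. *)
Fixpoint borel_leb n : {sigma_finite_measure set (n.-tuple B) -> \bar R} :=
  match n with
  | 0 => \d_([tuple] : 0.-tuple B)
  | n'.+1 => leb_step (borel_leb n')
  end.

End borel_lebesgue.

(* R^n carries the sigma-algebra of Lebesgue measurable sets (and not only the
   Borel one): the Caratheodory sets of the outer measure of [borel_leb]. *)
Definition Rn (R : realType) (n : nat) :=
  caratheodory_type (mu_ext (@borel_leb R n)).
HB.instance Definition _ R n := Measurable.on (Rn R n).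

Definition leb (R : realType) (n : nat) : set (Rn R n) -> \bar R :=
  completed_measure_extension (mu := @borel_leb R n).
HB.instance Definition _ R n := Measure.on (@leb R n).

Section weights.
Context {R : realType} (n : nat).
Local Notation E := (Rn R n).
Local Notation mu := (@leb R n).
Implicit Types (f g w : E -> \bar R) (Q : set E) (p r : R) (s : \bar R).

(* Closed cubes with sides parallel to the axes. *)
Definition cube (a : E) (l : R) : set E :=
  [set x | forall i : 'I_n, (tnth a i <= tnth x i <= tnth a i + l)%R].

Definition cubes : set (set E) :=
  [set Q | exists a l, (0 < l)%R /\ Q = cube a l].

Definition is_weight w :=
  measurable_fun setT w /\ {ae mu, forall x, 0 < w x < +oo}.

Definition wpow w r : E -> \bar R := fun x => w x `^ r.

Definition avg Q f : \bar R := (\int[mu]_(x in Q) f x) / mu Q.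

(* [ess_sup] of the library, relative to Q. *)
Definition ess_sup_on Q f : \bar R :=
  ereal_inf [set y | {ae mu, forall x, Q x -> f x <= y}].

Definition conjr r : R := fine (hoelder_conjugate r%:E).

Definition A_const p w : \bar R :=
  if p == 1%R then
    ereal_sup [set avg Q w * ess_sup_on Q (fun x => (w x)^-1) | Q in cubes]
  else
    ereal_sup [set avg Q w * avg Q (wpow w (1 - conjr p)) `^ (p - 1)
              | Q in cubes].

Definition smean s Q w : \bar R :=
  if s is r%:E then avg Q (wpow w r) `^ r^-1 else ess_sup_on Q w.

(* The library has [+oo^-1 = 0] and [+oo * 0 = 0], so that the plain quotient
   would be 0 on a cube over which w is not integrable; it counts as +oo. *)
Definition RH_ratio s Q w : \bar R :=
  if avg Q w == +oo then +oo else smean s Q w / avg Q w.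

Definition RH_const s w : \bar R := ereal_sup [set RH_ratio s Q w | Q in cubes].

Definition A_class p w := is_weight w /\ A_const p w < +oo.

Definition RH_class s w :=
  is_weight w /\
  if s == 1 then exists2 t, 1 < t & RH_const t w < +oo else RH_const s w < +oo.

End weights.

Section cube_volume.
Context {R : realType}.
Local Notation B := (measurableTypeR R).

Lemma measurable_cube n (a : n.-tuple B) l :
  measurable (cube a l : set (n.-tuple B)).
Proof.
have -> : cube a l = \bigcap_(i in [set: 'I_n])
    ((fun x : n.-tuple B => tnth x i) @^-1` `[tnth a i, (tnth a i + l)%R]).
  apply/seteqP; split => x /= h i; first by move=> _; rewrite /= in_itv /= h.
  by have := h i I; rewrite /= in_itv.
apply: fin_bigcap_measurable => // i _; rewrite -[X in measurable X]setTI.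
by apply: measurable_tnth => //; exact: measurable_itv.
Qed.

Lemma borel_leb_cube n (a : n.-tuple B) l : (0 <= l)%R ->
  @borel_leb R n (cube a l) = (l ^+ n)%:E.
Proof.
move=> l0; elim: n a => [|n IH] a.
  rewrite /= diracE mem_set ?expr0//.
  by move=> i; case: i.
rewrite /= /leb_step /pushforward.
pose a' := [tuple of behead a].
have -> : @cons_tup R n @^-1` cube a l =
    `[tnth a ord0, (tnth a ord0 + l)%R] `*` cube a' l.
  have E0 (y : B) t : tnth (cons_tup (y, t)) ord0 = y by rewrite /tnth /=.
  have E1 (y : B) t (i : 'I_n) : tnth (cons_tup (y, t)) (lift ord0 i) = tnth t i.
    by rewrite !(tnth_nth y) /=.
  have E2 (i : 'I_n) : tnth a' i = tnth a (lift ord0 i).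
    by rewrite (tnth_nth 0%R) [RHS](tnth_nth 0%R) /= nth_behead.
  apply/seteqP; split=> -[y t] /=.
    move=> h; split => /=; first by have := h ord0; rewrite E0 in_itv.
    by move=> i; have := h (lift ord0 i); rewrite E1 E2.
  move=> [/=]; rewrite in_itv /= => h1 h2 i.
  case: (unliftP ord0 i) => [j ->|->]; first by rewrite E1 -E2.
  by rewrite E0.
rewrite product_measure1E; [|exact: measurable_itv|exact: measurable_cube].
rewrite IH /= [X in X * _](_ : _ = l%:E) -?EFinM ?exprS//.
have := @lebesgue_measure_itv R `[tnth a ord0, (tnth a ord0 + l)%R].
move=> /= ->; rewrite lte_fin; case: ifPn => [_|].
  by rewrite -EFinD addrAC subrr add0r.
rewrite ltrDl -leNgt => l0'.
by have -> : l = 0%R by apply/le_anti/andP; rewrite l0 l0'.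
Qed.

Lemma leb_cube n (a : Rn R n) l : (0 <= l)%R -> leb (cube a l) = (l ^+ n)%:E.
Proof.
move=> l0; rewrite -(@borel_leb_cube n a)// /leb /completed_measure_extension.
by rewrite measurable_mu_extE//; exact: measurable_cube.
Qed.
End cube_volume.

Section limited_range.
Context {R : realType}.
Implicit Types (pm p : R) (pp : \bar R).

(* The exponent (pp/p)', infinite for p = pp. *)
Definition rhexp pp p : \bar R := hoelder_conjugate (pp / p%:E).

Definition tau pm pp p : R := (fine (rhexp pp p) * (p / pm - 1) + 1)%R.

Definition ARH_class n pm pp p (u : Rn R n -> \bar R) :=
  A_class (p / pm)%R u /\ RH_class (rhexp pp p) u.

(* [ARH_const pm pp p w] is the constant of w^p. *)
Definition ARH_const n pm pp p (w : Rn R n -> \bar R) : \bar R :=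
  if p%:E < pp then A_const (tau pm pp p) (wpow w (p * fine (rhexp pp p)))
  else maxe (A_const (p / pm)%R (wpow w p)) (RH_const (rhexp pp p) (wpow w p)).

Definition gamma pm pp p (p0 : R) : R :=
  if p0%:E < pp then
    Num.max 1%R ((tau pm pp p0 - 1) / (tau pm pp p - 1))%R
  else (p0 / (tau pm pp p - 1) * (pm^-1 - fine pp^-1%E))%R.

End limited_range.

(* Main.v *)
Require Import Defs.
From HB Require Import structures.
From mathcomp Require Import all_boot all_order all_algebra.
From mathcomp Require Import all_classical all_reals all_analysis.
From mathcomp Require Import measurable_realfun ess_sup_inf.
From mathcomp Require Import ring lra.

(* Put 1/x = 1/p - 1/pp and 1/y = 1/pm - 1/p, so that tau = 1 + x/y.  Then
   [w^p]_{A cap RH} is the x-th power of the best constant c in the two-sided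
   condition (avg_Q w^x)^(1/x) (avg_Q w^(-y))^(1/y) <= c, which is symmetric
   under (w, x, y) |-> (1/w, y, x).

   The exponents p0, x0, y0 of the hypothesis are reached by a weight built from
   w and a Rubio de Francia majorant U.  With beta = 1/p - 1/p0 = 1/q - 1/q0 and
   H = w^x U^tau, where U is an A_1-type majorant of ((g w)^p / w^x)^(1/tau) in
   L^tau(w^x), the weight v = w H^(-beta) handles p < p0: Hoelder bounds
   ||f w||_q by ||f v||_q0 (int H)^beta, while ||g v||_p0 is controlled because
   (g w)^p <= H.  For p > p0 the same construction is applied to 1/w, with
   truncations of f w in the role of g w.  Sharpness of the constant comes from
   Buckley's bound ||M||_{L^tau(W)} <= C [W]_{A_tau}^(1/(tau - 1)), by Lerner's
   argument, run on Doob maximal functions of finitely many shifted dyadic grids.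

   When pp = +oo the class also requires a reverse Hoelder exponent larger
   than 1; it is obtained by running the iteration with an additional small
   multiple of h |-> M(h^u)^(1/u). *)

Set Implicit Arguments.
Unset Strict Implicit.
Unset Printing Implicit Defensive.
Import Order.TTheory GRing.Theory Num.Theory.
Import numFieldNormedType.Exports.
Local Open Scope classical_set_scope.
Local Open Scope ring_scope.
Local Open Scope ereal_scope.

(** * Powers and integrals *)

(** The exponent gamma is a count of the powers of A = [w^p]. For p < p0 < pp, Buckley's bound gives
    U an A_1 constant of order A^(y/x), as 1/(tau - 1) = y/x. In v, U has the power -kappa with
    kappa = tau beta and w the power x/x0, so the x0-th power of the two-sided constant of v carries
    A to the power 1 + kappa x0 y/x, which is (tau_p0 - 1)/(tau_p - 1). For p0 = pp one has x =
    1/beta, w cancels from v, and only the A_1 constant of U counts. For p > p0 the weight 1/w has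
    constant A^(y/x) and Buckley power x/y, so U has an A_1 constant of order A, and the total power
    is 1.

    The powers of 2 come from the Neumann series, whose norm is at most twice that of its first
    term: int H <= 2^tau int (g w)^p, raised to the power beta <= 1/p; in the dual case tau becomes
    tau' and |beta| <= 1/p0. There the integral of (f w)^q stands on both sides and is divided out,
    hence the truncations.

    All maximal operators are cut to finitely many scales, so that the integrals divided out are
    finite, and limits are taken afterwards. *)

Section powers.
Context {R : realType}.
Implicit Types (a b t : R) (u v : \bar R).

Lemma ler_powRl a b t : (0 <= t)%R -> (0 <= a)%R -> (a <= b)%R ->
  (a `^ t <= b `^ t)%R.
Proof.
by move=> t0 a0 ab; apply: ge0_ler_powR; rewrite ?nnegrE// (le_trans a0).
Qed.

Lemma lee_poweR u v t : (0 <= t)%R -> 0 <= u -> u <= v -> u `^ t <= v `^ t.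
Proof.
move=> t0 u0 uv; apply: gt0_ler_poweR => //; rewrite in_itv /= leey andbT//.
exact: le_trans uv.
Qed.

Lemma powR_conjK a t : (0 <= a)%R -> t != 0%R -> ((a `^ t) `^ t^-1 = a)%R.
Proof. by move=> a0 t0; rewrite -powRrM mulfV// powRr1. Qed.

Lemma poweR_conjK u t : 0 <= u -> t != 0%R -> (u `^ t) `^ t^-1 = u.
Proof. by move=> a0 t0; rewrite -poweRrM mulfV// poweRe1. Qed.

Lemma poweR_conjVK u t : 0 <= u -> t != 0%R -> (u `^ t^-1) `^ t = u.
Proof. by move=> a0 t0; rewrite -poweRrM mulVf// poweRe1. Qed.

Lemma poweR_powRM a u t : (0 <= a)%R -> 0 <= u -> t != 0%R ->
  ((a `^ t)%:E * u) `^ t^-1 = a%:E * u `^ t^-1.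
Proof.
move=> a0 u0 t0; rewrite poweRM// ?lee_fin ?powR_ge0// poweR_EFin.
by rewrite powR_conjK.
Qed.

Lemma poweR_inv_le u a t : (0 < t)%R -> 0 <= u -> u `^ t^-1 <= a%:E ->
  u <= (a `^ t)%:E.
Proof.
move=> t0 u0 /(lee_poweR (ltW t0) (poweR_ge0 _ _)).
by rewrite -poweRrM mulVf ?gt_eqF// poweRe1.
Qed.

Lemma ge0_lty_EFin u : 0 <= u -> u < +oo -> exists2 a, (0 <= a)%R & u = a%:E.
Proof. by case: u => [a| |]// a0 _; exists a. Qed.

Lemma powR_split a t : (0 <= a)%R -> (a `^ t * a `^ (1 - t) = a)%R.
Proof.
have e : (t + (1 - t) = 1)%R by rewrite addrCA subrr addr0.
by move=> a0; rewrite -powRD e ?powRr1// oner_eq0.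
Qed.

(* Weighted AM-GM, normalised at the point (a, b). *)
Lemma young_powR a b (u v : R) t : (0 < t < 1)%R -> (0 < a)%R -> (0 < b)%R ->
  (0 <= u)%R -> (0 <= v)%R ->
  (u `^ t * v `^ (1 - t) <=
   a `^ t * b `^ (1 - t) * (t / a * u + (1 - t) / b * v))%R.
Proof.
move=> /andP[t0 t1] a0 b0 u0 v0; have t10 : (0 < 1 - t)%R by rewrite subr_gt0.
have ua : (0 <= u / a)%R by rewrite divr_ge0// ltW.
have vb : (0 <= v / b)%R by rewrite divr_ge0// ltW.
have := @conjugate_powR R ((u / a) `^ t)%R ((v / b) `^ (1 - t))%R t^-1%R
  (1 - t)^-1%R (powR_ge0 _ _) (powR_ge0 _ _).
rewrite !invr_gt0 !invrK addrCA subrr addr0 => /(_ t0 t10 erefl).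
rewrite !powR_conjK ?gt_eqF// => H.
have -> : (u `^ t = a `^ t * (u / a) `^ t)%R.
  by rewrite -powRM ?(ltW a0)// mulrC divfK// gt_eqF.
have -> : (v `^ (1 - t) = b `^ (1 - t) * (v / b) `^ (1 - t))%R.
  by rewrite -powRM ?(ltW b0)// mulrC divfK// gt_eqF.
rewrite mulrACA ler_wpM2l ?mulr_ge0 ?powR_ge0//.
by apply: (le_trans H); rewrite le_eqVlt; apply/orP; left; apply/eqP; ring.
Qed.

Lemma young_poweR a b u v t : (0 < t < 1)%R -> (0 < a)%R -> (0 < b)%R ->
  0 <= u -> 0 <= v ->
  u `^ t * v `^ (1 - t) <=
   (a `^ t * b `^ (1 - t))%:E * ((t / a)%:E * u + ((1 - t) / b)%:E * v).
Proof.
move=> t01 a0 b0; have /andP[t0 t1] := t01.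
have t10 : (0 < 1 - t)%R by rewrite subr_gt0.
have c0 : (0 < a `^ t * b `^ (1 - t))%R by rewrite mulr_gt0 ?powR_gt0.
have ta : (0 < t / a)%R by rewrite divr_gt0.
have tb : (0 < (1 - t) / b)%R by rewrite divr_gt0.
have yy c : (0 < c)%R -> c%:E * +oo = +oo :> \bar R.
  by move=> ?; rewrite gt0_muley// lte_fin.
move: u v => [u| |] [v| |]// u0 v0.
- by have := young_powR t01 a0 b0 u0 v0; rewrite -lee_fin !EFinM EFinD !EFinM.
- by rewrite (yy _ tb) addey// (yy _ c0) leey.
- by rewrite (yy _ ta) addye// (yy _ c0) leey.
- by rewrite (yy _ ta) (yy _ tb) addye// (yy _ c0) leey.
Qed.
End powers.

Section integrals.
Context d (T : measurableType d) {R : realType} (mu : {measure set T -> \bar R}).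
Implicit Types (D : set T).

(** In this form Hölder's inequality admits infinite integrals and the endpoints t = 0 and t = 1;
    the latter occurs in [pmean_mono]. *)
Lemma hoelder_interp D (f g : T -> \bar R) (t : R) : measurable D ->
  measurable_fun setT f -> measurable_fun setT g ->
  (forall x, 0 <= f x) -> (forall x, 0 <= g x) -> (0 <= t <= 1)%R ->
  \int[mu]_(x in D) (f x `^ t * g x `^ (1 - t)) <=
  (\int[mu]_(x in D) f x) `^ t * (\int[mu]_(x in D) g x) `^ (1 - t).
Proof.
move=> mD mf mg f0 g0 /andP[].
rewrite le_eqVlt => /predU1P[<- _|t0].
  rewrite poweRe0 mul1e subr0 poweRe1 ?integral_ge0//.
  by under eq_integral do rewrite poweRe0 mul1e poweRe1//.
rewrite le_eqVlt => /predU1P[->|t1].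
  rewrite subrr poweRe0 mule1 poweRe1 ?integral_ge0//.
  by under eq_integral do rewrite poweRe0 mule1 poweRe1//.
have t10 : (0 < 1 - t)%R by rewrite subr_gt0.
have mfD := measurable_funTS mf : measurable_fun D f.
have mgD := measurable_funTS mg : measurable_fun D g.
have mpf s : measurable_fun D (fun x => f x `^ s).
  exact: (measurableT_comp (measurable_poweR s) mfD).
have mpg s : measurable_fun D (fun x => g x `^ s).
  exact: (measurableT_comp (measurable_poweR s) mgD).
have ae0 (h : T -> \bar R) : measurable_fun setT h -> (forall x, 0 <= h x) ->
    \int[mu]_(x in D) h x = 0 -> {ae mu, forall x, D x -> h x = 0}.
  move=> mh h0 ih; apply/(@ae_eq_integral_abs _ _ _ mu D mD h) => //.
    exact: measurable_funTS.
  by under eq_integral do rewrite gee0_abs//.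
have z0 h : measurable_fun D h -> {ae mu, forall x, D x -> h x = 0} ->
    \int[mu]_(x in D) h x = 0.
  move=> mh h0; rewrite (ae_eq_integral (cst 0)) ?integral0//.
have mfg : measurable_fun D (fun x => f x `^ t * g x `^ (1 - t)).
  exact: emeasurable_funM.
(* The right-hand side is 0 here even if the other integral is infinite, so the integrand on the
   left has to vanish almost everywhere. *)
have [If0|If0] := eqVneq (\int[mu]_(x in D) f x) 0.
  rewrite z0 ?mule_ge0 ?poweR_ge0//; move: (ae0 f mf f0 If0).
  apply: filterS => x fx Dx; rewrite fx// poweR0r ?mul0e// gt_eqF//.
have [Ig0|Ig0] := eqVneq (\int[mu]_(x in D) g x) 0.
  rewrite z0 ?mule_ge0 ?poweR_ge0//; move: (ae0 g mg g0 Ig0).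
  apply: filterS => x fx Dx; rewrite fx// poweR0r ?mule0// gt_eqF//.
have Ifp : 0 < \int[mu]_(x in D) f x by rewrite lt0e If0 integral_ge0.
have Igp : 0 < \int[mu]_(x in D) g x by rewrite lt0e Ig0 integral_ge0.
case Fe : (\int[mu]_(x in D) f x) Ifp => [a| |]//; rewrite ?lte_fin => a0;
  last first.
  rewrite poweRyr ?gt_eqF// gt0_mulye ?leey// poweR_gt0//.
case Ge : (\int[mu]_(x in D) g x) Igp => [b| |]//; rewrite ?lte_fin => b0;
  last first.
  by rewrite poweRyr ?gt_eqF// gt0_muley ?leey// poweR_gt0// lte_fin.
have ta : (0 <= t / a)%R by rewrite divr_ge0// ltW.
have tb : (0 <= (1 - t) / b)%R by rewrite divr_ge0// ltW.
(* Young's inequality is normalised at the two integrals a and b, so that its last factor integrates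
   to t + (1 - t) = 1. *)
apply: (@le_trans _ _ (\int[mu]_(x in D) ((a `^ t * b `^ (1 - t))%:E *
    ((t / a)%:E * f x + ((1 - t) / b)%:E * g x)))).
  apply: ge0_le_integral => //.
  - by move=> x _; rewrite mule_ge0 ?poweR_ge0.
  - apply: emeasurable_funM => //; apply: emeasurable_funD => //;
    exact: emeasurable_funM.
  - by move=> x _; apply: young_poweR => //; rewrite t0.
rewrite ge0_integralZl_EFin//; last 3 first.
- by move=> x _; rewrite adde_ge0// mule_ge0.
- by apply: emeasurable_funD => //; exact: emeasurable_funM.
- by rewrite mulr_ge0 ?powR_ge0.
rewrite ge0_integralD//; last 4 first.
- by move=> x _; rewrite mule_ge0.
- exact: emeasurable_funM.
- by move=> x _; rewrite mule_ge0.
- exact: emeasurable_funM.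
rewrite !ge0_integralZl_EFin// Fe Ge -[_ * a%:E]EFinM -[_ * b%:E]EFinM.
rewrite !divfK ?gt_eqF// -EFinD.
have -> : (t + (1 - t) = 1)%R by rewrite addrCA subrr addr0.
rewrite mule1.
exact: lexx.
Qed.
End integrals.

Section real_integrands.
Context d (T : measurableType d) {R : realType} (mu : {measure set T -> \bar R}).
Implicit Types (D : set T) (f g : T -> R).

Lemma mfun_pow D f (r : R) : measurable_fun D f ->
  measurable_fun D (fun x => f x `^ r)%R.
Proof. exact: (measurableT_comp (measurable_powR r)). Qed.

Lemma mfun_EFin D f : measurable_fun D f -> measurable_fun D (fun x => (f x)%:E).
Proof. by move=> mf; apply/measurable_EFinP. Qed.

Lemma mfun_max D f g : measurable_fun D f -> measurable_fun D g ->
  measurable_fun D (fun x => Num.max (f x) (g x)).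
Proof. by move=> mf mg; exact: measurable_maxr. Qed.

Lemma le_int D f g : measurable D -> measurable_fun setT f ->
  measurable_fun setT g ->
  (forall x, D x -> 0 <= f x)%R -> (forall x, D x -> f x <= g x)%R ->
  \int[mu]_(x in D) (f x)%:E <= \int[mu]_(x in D) (g x)%:E.
Proof.
move=> mD mf mg f0 fg; apply: ge0_le_integral => //.
- by apply: mfun_EFin; exact: measurable_funTS.
- by apply: mfun_EFin; exact: measurable_funTS.
Qed.

Lemma int_add D f g : measurable D -> measurable_fun setT f ->
  measurable_fun setT g ->
  (forall x, D x -> 0 <= f x)%R -> (forall x, D x -> 0 <= g x)%R ->
  \int[mu]_(x in D) (f x + g x)%:E =
  \int[mu]_(x in D) (f x)%:E + \int[mu]_(x in D) (g x)%:E.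
Proof.
move=> mD mf mg f0 g0; rewrite -ge0_integralD//.
- by apply: mfun_EFin; exact: measurable_funTS.
- by apply: mfun_EFin; exact: measurable_funTS.
Qed.

Lemma int_scale D f (k : R) : measurable D -> measurable_fun setT f ->
  (forall x, D x -> 0 <= f x)%R -> (0 <= k)%R ->
  \int[mu]_(x in D) (k * f x)%:E = k%:E * \int[mu]_(x in D) (f x)%:E.
Proof.
move=> mD mf f0 k0; rewrite -ge0_integralZl_EFin//.
by apply: mfun_EFin; exact: measurable_funTS.
Qed.

Lemma int_ge0 D f : (forall x, D x -> 0 <= f x)%R ->
  0 <= \int[mu]_(x in D) (f x)%:E.
Proof. by move=> f0; apply: integral_ge0 => x Dx; rewrite lee_fin f0. Qed.

Lemma hoelder_int D f g (t : R) : measurable D ->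
  measurable_fun setT f -> measurable_fun setT g ->
  (forall x, 0 <= f x)%R -> (forall x, 0 <= g x)%R -> (0 <= t <= 1)%R ->
  \int[mu]_(x in D) (f x `^ t * g x `^ (1 - t))%:E <=
  (\int[mu]_(x in D) (f x)%:E) `^ t * (\int[mu]_(x in D) (g x)%:E) `^ (1 - t).
Proof.
move=> mD mf mg f0 g0 t01.
have := @hoelder_interp _ _ _ mu D (EFin \o f) (EFin \o g) t mD
  (mfun_EFin mf) (mfun_EFin mg).
by apply => // x; rewrite lee_fin.
Qed.

End real_integrands.

Ltac mfun := repeat (match goal with
  | |- measurable_fun _ (fun x => (@?f x * @?g x)%R) =>
      apply: (@measurable_funM _ _ _ _ f g)
  | |- measurable_fun _ (fun x => (@?f x + @?g x)%R) =>
      apply: (@measurable_funD _ _ _ _ f g)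
  | |- measurable_fun _ (fun x => Num.max (@?f x) (@?g x)) =>
      apply: (@mfun_max _ _ _ _ f g)
  | |- measurable_fun _ (fun x => (@?f x `^ ?r)%R) =>
      apply: (@mfun_pow _ _ _ _ f r)
  | |- measurable_fun _ (fun x => (@?f x)%:E) =>
      apply: (@mfun_EFin _ _ _ _ f)
  | |- measurable_fun _ (fun _ => ?c) => exact: measurable_cst
  | |- measurable_fun _ _ => solve [trivial]
  end).

(** * Countable partitions *)

Section partition.
Context d (T : measurableType d) {R : realType} (mu : {measure set T -> \bar R}).
Context (I : countType) (phi : T -> I).
Hypothesis mphi : forall i, measurable (phi @^-1` [set i]).

(** A preimage is the union of the cells whose value lies in the set, a countable union because [I]
    is countable. *)
Lemma partition_measurable (h : T -> R) :
  (forall x z, phi x = phi z -> h x = h z) -> measurable_fun setT h.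
Proof.
move=> hphi _ Y mY; rewrite setTI.
have -> : h @^-1` Y = \bigcup_(i : I)
    (if `[< exists2 x, phi x = i & Y (h x) >] then phi @^-1` [set i] else set0).
  apply/seteqP; split=> [x Yx|x [i _]]/=.
    by exists (phi x) => //; case: asboolP => // -[]; exists x.
  by case: asboolP => // -[z <- Yz] /hphi ->.
apply: countable_bigcupT_measurable; first exact: countableP.
by move=> i; case: ifP.
Qed.

(** This takes the place of conditional expectations: inequalities are proved on one cell at a time
    and then summed, and no integral has to be finite. *)
Lemma partition_le (f g : T -> \bar R) :
  measurable_fun setT f -> measurable_fun setT g ->
  (forall x, 0 <= f x) -> (forall x, 0 <= g x) ->
  (forall x, \int[mu]_(z in phi @^-1` [set phi x]) f z <=
             \int[mu]_(z in phi @^-1` [set phi x]) g z) ->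
  \int[mu]_x f x <= \int[mu]_x g x.
Proof.
move=> mf mg f0 g0 fg.
(* Cells are enumerated through the codes of [I]; a code that is not in use gives the empty set. *)
pose F n : set T := if pickle_inv n is Some i then phi @^-1` [set i] else set0.
have mF n : measurable (F n) by rewrite /F; case: pickle_inv.
have FT : \bigcup_n F n = [set: T].
  apply/seteqP; split => // x _; exists (pickle (phi x)) => //.
  by rewrite /F pickleK_inv.
have tF : trivIset setT F.
  move=> i j _ _ [x []]; rewrite /F.
  have := @pickle_invK I i; have := @pickle_invK I j.
  by case: pickle_inv => // a; case: pickle_inv => // b /= <- <- <- <-.
rewrite -FT !ge0_integral_bigcup//; [|by rewrite FT..].
apply: lee_nneseries => [n _ _|n _]; first exact: integral_ge0.
rewrite /F; case: pickle_inv => [i|]; last by rewrite !integral_set0.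
have [[x <-]|nx] := pselect (exists x, phi x = i); first exact: fg.
suff -> : phi @^-1` [set i] = set0 by rewrite !integral_set0.
by apply/seteqP; split => // x /= ix; apply: nx; exists x.
Qed.

End partition.

(** * The Doob maximal inequality *)

Definition cell (T I : Type) (phi : T -> I) x : set T := phi @^-1` [set phi x].

(* Locked, as unification would otherwise unfold it to a product. *)
HB.lock Definition wavg d (T : measurableType d) (R : realType)
    (mu : {measure set T -> \bar R}) (I : Type) (s f : T -> R) (phi : T -> I)
    (x : T) : R :=
  (fine (\int[mu]_(z in cell phi x) (f z * s z)%:E) /
   fine (\int[mu]_(z in cell phi x) (s z)%:E))%R.

Section maximal_defs.
Context d (T : measurableType d) {R : realType} (mu : {measure set T -> \bar R}).
Context (I : Type).
Implicit Types (s f : T -> R) (phi : T -> I).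

Fixpoint runmax (a : nat -> T -> R) (N : nat) (x : T) : R :=
  if N is N'.+1 then Num.max (runmax a N' x) (a N x) else a 0%N x.

Lemma runmax_ge a N k x : (k <= N)%N -> (a k x <= runmax a N x)%R.
Proof.
elim: N => [|N IH]; first by rewrite leqn0 => /eqP ->.
by rewrite leq_eqVlt ltnS le_max => /predU1P[->|/IH->//]; rewrite lexx orbT.
Qed.

Lemma runmax_le a N x (c : R) : (forall k, (k <= N)%N -> (a k x <= c)%R) ->
  (runmax a N x <= c)%R.
Proof.
elim: N => [|N IH] ac /=; first exact: ac.
by rewrite ge_max ac// andbT; apply: IH => k kN; apply: ac; exact: leqW.
Qed.

Lemma runmax_ge0 a N x : (forall k, 0 <= a k x)%R -> (0 <= runmax a N x)%R.
Proof. by move=> a0; rewrite (le_trans (a0 0%N))// runmax_ge. Qed.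

Lemma measurable_runmax a N : (forall k, measurable_fun setT (a k)) ->
  measurable_fun setT (runmax a N).
Proof. by move=> ma; elim: N => [|N IH] /=; [exact: ma|exact: (mfun_max IH (ma N.+1))]. Qed.

Lemma wavg_ge0 s f phi x : (forall z, 0 <= s z)%R -> (forall z, 0 <= f z)%R ->
  (0 <= wavg mu s f phi x)%R.
Proof.
move=> s0 f0; rewrite wavg.unlock; apply: divr_ge0; apply: fine_ge0; apply: int_ge0 => // z _.
exact: mulr_ge0.
Qed.

Lemma wavg_cell s f phi x z : phi x = phi z -> wavg mu s f phi x = wavg mu s f phi z.
Proof. by rewrite wavg.unlock /cell => ->. Qed.

End maximal_defs.

Section doob.
Context d (T : measurableType d) {R : realType} (mu : {measure set T -> \bar R}).
Context (I : countType) (idx : nat -> T -> I).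
Hypothesis midx : forall k i, measurable (idx k @^-1` [set i]).
Hypothesis nest : forall k x z, idx k.+1 x = idx k.+1 z -> idx k x = idx k z.
Variables (s f : T -> R) (p : R).
Hypothesis ms : measurable_fun setT s.
Hypothesis s0 : forall x, (0 < s x)%R.
Hypothesis sfin : forall k x, 0 < \int[mu]_(z in cell (idx k) x) (s z)%:E < +oo.
Hypothesis mf : measurable_fun setT f.
Hypothesis f0 : forall x, (0 <= f x)%R.
Hypothesis p1 : (1 < p)%R.
Hypothesis fp : \int[mu]_z (f z `^ p * s z)%:E < +oo.

Local Notation E k := (wavg mu s f (idx k)).
Local Notation y := (runmax (fun k => E k)).
Let p0 : (0 < p)%R. Proof. exact: lt_trans p1. Qed.
Let pn0 : p != 0%R. Proof. by rewrite gt_eqF. Qed.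
Let s0' x : (0 <= s x)%R. Proof. exact: ltW. Qed.
Let mcell k x : measurable (cell (idx k) x). Proof. exact: midx. Qed.

Let E0 k x : (0 <= E k x)%R. Proof. exact: wavg_ge0. Qed.
Let mE k : measurable_fun setT (E k).
Proof. by apply: (partition_measurable (midx k)) => x z; exact: wavg_cell. Qed.
Let y0 N x : (0 <= y N x)%R. Proof. exact: runmax_ge0. Qed.
Let my N : measurable_fun setT (y N). Proof. exact: measurable_runmax. Qed.

Let fs_hoelder C : measurable C ->
  \int[mu]_(z in C) (f z * s z)%:E <=
  (\int[mu]_(z in C) (f z `^ p * s z)%:E) `^ p^-1 *
  (\int[mu]_(z in C) (s z)%:E) `^ (1 - p^-1).
Proof.
move=> mC; have := @hoelder_int _ _ _ mu C (fun z => f z `^ p * s z)%R s p^-1 mC.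
have mfs : measurable_fun setT (fun z => f z `^ p * s z)%R by mfun.
move=> /(_ mfs ms) h; apply: le_trans (h _ _ _) => //.
- apply: le_int => //; mfun => //.
  + by move=> z _; exact: mulr_ge0.
  + move=> z _; rewrite powRM ?powR_ge0// powR_conjK// -mulrA.
    by rewrite powR_split.
- by move=> z; rewrite mulr_ge0 ?powR_ge0.
- by rewrite invr_ge0 ltW//= invf_le1// ltW.
Qed.

Let fp_cell C : measurable C -> \int[mu]_(z in C) (f z `^ p * s z)%:E < +oo.
Proof.
move=> mC; apply: le_lt_trans fp; apply: ge0_subset_integral => //.
- by mfun.
- by move=> z _; rewrite lee_fin mulr_ge0 ?powR_ge0.
Qed.

Lemma wavg_int_fin k x : \int[mu]_(z in cell (idx k) x) (f z * s z)%:E \is a fin_num.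
Proof.
rewrite ge0_fin_numE; last by apply: int_ge0 => z _; exact: mulr_ge0.
apply: le_lt_trans (fs_hoelder (mcell k x)) _.
have /andP[_ sf] := sfin k x.
rewrite lte_mul_pinfty ?poweR_ge0//; last exact: poweR_lty.
by apply: fin_num_poweR; rewrite ge0_fin_numE ?fp_cell// int_ge0// => z _;
  rewrite mulr_ge0 ?powR_ge0.
Qed.

Let s_fin k x : \int[mu]_(z in cell (idx k) x) (s z)%:E \is a fin_num.
Proof.
by have /andP[? ?] := sfin k x; rewrite ge0_fin_numE// ltW.
Qed.

Let s_pos k x : (0 < fine (\int[mu]_(z in cell (idx k) x) (s z)%:E))%R.
Proof. by rewrite fine_gt0// sfin. Qed.

Let E_cell k x : (E k x)%:E * \int[mu]_(z in cell (idx k) x) (s z)%:E =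
  \int[mu]_(z in cell (idx k) x) (f z * s z)%:E.
Proof.
rewrite -{1}(fineK (s_fin k x)) -EFinM wavg.unlock divfK ?gt_eqF//.
exact: fineK (wavg_int_fin k x).
Qed.

(** [E k] is the conditional expectation of [f] under s dmu: on a cell of level k the factor [h] is
    a constant and comes out of both integrals. *)
Lemma wavg_condexp k (h : T -> R) : (forall x, 0 <= h x)%R ->
  (forall x z, idx k x = idx k z -> h x = h z) ->
  \int[mu]_x (h x * E k x * s x)%:E = \int[mu]_x (h x * f x * s x)%:E.
Proof.
move=> h0 hidx; have mh := partition_measurable (midx k) hidx.
have key x : \int[mu]_(z in cell (idx k) x) (h z * E k z * s z)%:E =
    \int[mu]_(z in cell (idx k) x) (h z * f z * s z)%:E.
  transitivity (\int[mu]_(z in cell (idx k) x) (h x * E k x * s z)%:E).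
    apply: eq_integral => z; rewrite inE /cell /= => zx.
    by rewrite (hidx _ _ zx) (wavg_cell _ _ _ zx).
  rewrite (@int_scale _ _ _ _ _ s (h x * E k x)%R) ?(mulr_ge0 (h0 x) (E0 k x))//.
  rewrite EFinM -muleA E_cell -int_scale//; last 2 first.
  - by mfun.
  - by move=> z _; rewrite mulr_ge0.
  apply: eq_integral => z; rewrite inE /cell /= => zx.
  by rewrite (hidx _ _ zx) mulrA.
apply/eqP; rewrite eq_le; apply/andP; split; apply: (partition_le (midx k)).
all: try by mfun.
all: try by move=> x; rewrite lee_fin !mulr_ge0.
all: by move=> x; have /eqP := key x; rewrite eq_le => /andP[].
Qed.

(** Jensen's inequality on each cell, deduced from Hölder's. *)
Let E_pow k : \int[mu]_x (E k x `^ p * s x)%:E <= \int[mu]_x (f x `^ p * s x)%:E.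
Proof.
apply: (partition_le (midx k)).
- by mfun.
- by mfun.
- by move=> x; rewrite lee_fin mulr_ge0 ?powR_ge0.
- by move=> x; rewrite lee_fin mulr_ge0 ?powR_ge0.
move=> x; rewrite -/(cell (idx k) x).
have -> : \int[mu]_(z in cell (idx k) x) (E k z `^ p * s z)%:E =
    (E k x `^ p)%:E * \int[mu]_(z in cell (idx k) x) (s z)%:E.
  have <- := int_scale mu (mcell k x) ms (fun z _ => s0' z) (powR_ge0 (E k x) p).
  apply: eq_integral => z; rewrite inE /cell /= => zx.
  by rewrite (wavg_cell _ _ _ zx).
have := fs_hoelder (mcell k x); rewrite -E_cell.
set A := \int[mu]_(z in cell _ x) (f z `^ p * s z)%:E.
have Af : A \is a fin_num.
  rewrite ge0_fin_numE ?fp_cell//; apply: int_ge0 => z _.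
  by rewrite mulr_ge0 ?powR_ge0.
have A0 : (0 <= fine A)%R.
  by apply: fine_ge0; apply: int_ge0 => z _; rewrite mulr_ge0 ?powR_ge0.
rewrite -(fineK Af) -(fineK (s_fin k x)); move: (s_pos k x).
set S := fine (\int[mu]_(z in _) _) => S0.
rewrite -!EFinM !lee_fin => h.
have SS : (S `^ (1 - p^-1) = S / S `^ p^-1)%R.
  by rewrite powRB ?powRr1 ?ltW// (gt_eqF S0) implybT.
have S'0 : (0 < S `^ p^-1)%R by rewrite powR_gt0.
have {h} : (E k x * S `^ p^-1 <= fine A `^ p^-1)%R.
  rewrite -(ler_pM2r S0) -[X in (X <= _)%R]mulrAC -ler_pdivlMr//.
  by rewrite -mulrA -SS.
move=> /(ler_powRl (ltW p0)) -/(_ (mulr_ge0 (E0 _ _) (powR_ge0 _ _))).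
by rewrite powRM ?powR_ge0// -!powRrM mulVf// (powRr1 A0) (powRr1 (ltW S0)).
Qed.

Let y_cell N x z : idx N x = idx N z -> y N x = y N z.
Proof.
elim: N => [|N IH] /= xz; first exact: wavg_cell.
by rewrite (wavg_cell _ _ _ xz) IH//; exact: nest.
Qed.

Let y_fin N : \int[mu]_x (y N x `^ p * s x)%:E < +oo.
Proof.
elim: N => [|N IH]; first exact: le_lt_trans (E_pow 0) fp.
apply: (@le_lt_trans _ _ (\int[mu]_x (y N x `^ p * s x + E N.+1 x `^ p * s x)%:E)).
  apply: le_int => //; [by mfun; exact: (my N.+1)|by mfun| |].
  - by move=> x _; rewrite mulr_ge0 ?powR_ge0.
  - move=> x _; rewrite -mulrDl ler_wpM2r//= maxEle.
    by case: ifP => _; rewrite ?lerDl ?lerDr ?powR_ge0.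
rewrite int_add//; [|by mfun|by mfun| |].
- exact: (lte_add_pinfty IH (le_lt_trans (E_pow N.+1) fp)).
- by move=> x _; rewrite mulr_ge0 ?powR_ge0.
- by move=> x _; rewrite mulr_ge0 ?powR_ge0.
Qed.

Let q := (p / (p - 1))%R.
Let p10 : (0 < p - 1)%R. Proof. by rewrite subr_gt0. Qed.
Let q0 : (0 < q)%R. Proof. by rewrite divr_gt0. Qed.
Let q1 : (1 <= q)%R.
Proof. by rewrite ler_pdivlMr// mul1r lerBlDr lerDl. Qed.

(** One step of the pathwise form of Doob's inequality, with a the running maximum and e the next
    average. If a <= e it is Young's inequality for a^(p-1) e with the exponents q and p, since q/p
    = q - 1. *)
Let max_step (a e : R) : (0 <= a)%R -> (0 <= e)%R ->
  (Num.max a e `^ p + q * a `^ (p - 1) * e <=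
   a `^ p + q * Num.max a e `^ (p - 1) * e)%R.
Proof.
move=> a0 e0; rewrite maxEle; case: ifPn => [ae|_//].
have e1 : (e `^ (p - 1) * e = e `^ p)%R by rewrite mulrC mulr_powRB1.
rewrite -(mulrA q (e `^ _)%R) e1.
have h : (a `^ (p - 1) * e <= a `^ p / q + e `^ p / p)%R.
  have := @conjugate_powR R (a `^ (p - 1))%R e q p (powR_ge0 _ _) e0 q0 p0.
  rewrite -powRrM {3}/q mulrCA mulfV ?gt_eqF// mulr1; apply.
  by rewrite /q invfM invrK mulrBr mulVf// mulr1 subrK.
have qp : (q / p = q - 1)%R by rewrite /q; field; rewrite !gt_eqF.
have : (q * (a `^ (p - 1) * e) <= a `^ p + (q - 1) * e `^ p)%R.
  apply: (le_trans (ler_wpM2l (ltW q0) h)); rewrite mulrDr mulrCA mulfV ?gt_eqF//.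
  by rewrite mulr1 lerD2l mulrCA [X in (_ <= X)%R]mulrC qp.
by rewrite -mulrA; lra.
Qed.

Let yf N : \int[mu]_x (y N x `^ (p - 1) * f x * s x)%:E <=
  (\int[mu]_x (f x `^ p * s x)%:E) `^ p^-1 *
  (\int[mu]_x (y N x `^ p * s x)%:E) `^ (1 - p^-1).
Proof.
have := @hoelder_int _ _ _ mu setT (fun z => f z `^ p * s z)%R
  (fun x => y N x `^ p * s x)%R p^-1 measurableT.
have m1 : measurable_fun setT (fun z => f z `^ p * s z)%R by mfun.
have m2 : measurable_fun setT (fun z => y N z `^ p * s z)%R by mfun; exact: my.
move=> /(_ m1 m2) h; apply: le_trans (h _ _ _) => //.
- apply: le_int => //; [by mfun; exact: my|by mfun| |].
  + by move=> z _; rewrite !mulr_ge0 ?powR_ge0.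
  + move=> z _; rewrite !powRM ?powR_ge0// powR_conjK// -powRrM.
    rewrite mulrBr mulfV// mulr1 [leRHS]mulrACA powR_split//.
    by rewrite (mulrC (f z)).
- by move=> z; rewrite mulr_ge0 ?powR_ge0.
- by move=> z; rewrite mulr_ge0 ?powR_ge0.
- by rewrite invr_ge0 ltW//= invf_le1// ltW.
Qed.

Let yf_fin N : \int[mu]_x (y N x `^ (p - 1) * f x * s x)%:E < +oo.
Proof.
apply: le_lt_trans (yf N) _; rewrite lte_mul_pinfty ?poweR_ge0//.
  apply: fin_num_poweR; rewrite ge0_fin_numE// int_ge0// => z _.
  by rewrite mulr_ge0 ?powR_ge0.
exact: (poweR_lty _ (y_fin N)).
Qed.

(** [max_step] is integrated with a = y_N and e = E_(N+1); f can replace the average because the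
    running maxima are constant on cells. *)
Let y_step N : \int[mu]_x (y N x `^ p * s x)%:E <=
  q%:E * \int[mu]_x (y N x `^ (p - 1) * f x * s x)%:E.
Proof.
have r0 x : (0 <= y N x `^ (p - 1))%R by exact: powR_ge0.
elim: N {r0} => [|N IH].
  rewrite -(@wavg_condexp 0 (fun x => y 0 x `^ (p - 1))%R) => [|x|x z xz]; last 2 first.
  - exact: powR_ge0.
  - by rewrite (y_cell xz).
  rewrite -(@int_scale _ _ _ _ _ _ q)//; last 3 first.
  - by mfun.
  - by move=> x _; rewrite !mulr_ge0 ?powR_ge0.
  - exact: ltW.
  apply: le_int => //; [by mfun|by mfun| |].
  - by move=> x _; rewrite mulr_ge0 ?powR_ge0.
  - move=> x _ /=; rewrite (mulrC (_ `^ (p - 1))%R) mulr_powRB1//.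
    by rewrite ler_peMl// mulr_ge0 ?powR_ge0.
(* For M = N and M = N.+1, [y M] is constant on the cells of level N.+1, so f and its average
   [E N.+1] have the same integral against it. *)
have cN M : (M <= N.+1)%N -> (N <= M)%N ->
    \int[mu]_x (q * (y M x `^ (p - 1) * f x * s x))%:E =
    \int[mu]_x (q * y M x `^ (p - 1) * E N.+1 x * s x)%:E.
  move=> MN NM; rewrite (@wavg_condexp N.+1 (fun x => q * y M x `^ (p - 1))%R).
  - by apply: eq_integral => x _; rewrite !mulrA.
  - by move=> x; rewrite mulr_ge0 ?powR_ge0// ltW.
  move=> x z xz; congr (_ * _ `^ _)%R; apply: y_cell.
  have [->//|] := eqVneq M N.+1; rewrite neq_ltn [(N.+1 < M)%N]ltnNge MN orbF ltnS => MN'.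
  by have -> : M = N; [apply/anti_leq/andP; split|exact: nest].
have mq M : measurable_fun setT (fun x => y M x `^ (p - 1) * f x * s x)%R.
  by mfun; exact: my.
have m0 M x : (0 <= y M x `^ (p - 1) * f x * s x)%R.
  by rewrite !mulr_ge0 ?powR_ge0.
have my' M : measurable_fun setT (fun x => y M x `^ p * s x)%R.
  by mfun; exact: my.
have y0' M x : (0 <= y M x `^ p * s x)%R by rewrite mulr_ge0 ?powR_ge0.
have mq' M : measurable_fun setT (fun x => q * y M x `^ (p - 1) * E N.+1 x * s x)%R.
  by mfun; exact: my.
have q0' M x : (0 <= q * y M x `^ (p - 1) * E N.+1 x * s x)%R.
  by apply: mulr_ge0 => //; apply: mulr_ge0 => //; apply: mulr_ge0;
    [exact: ltW|exact: powR_ge0].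
have H : \int[mu]_x (y N.+1 x `^ p * s x)%:E +
    q%:E * \int[mu]_x (y N x `^ (p - 1) * f x * s x)%:E <=
    \int[mu]_x (y N x `^ p * s x)%:E +
    q%:E * \int[mu]_x (y N.+1 x `^ (p - 1) * f x * s x)%:E.
  have eS M := int_scale mu measurableT (mq M) (fun x _ => m0 M x) (ltW q0).
  have eD M M' := int_add mu measurableT (my' M) (mq' M')
    (fun x _ => y0' M x) (fun x _ => q0' M' x).
  rewrite -(eS N) -(eS N.+1) (cN N (leqnSn N) (leqnn N)).
  rewrite (cN N.+1 (leqnn _) (leqnSn N)) -(eD N.+1 N) -(eD N N.+1).
  apply: le_int => //.
  - exact: measurable_funD.
  - exact: measurable_funD.
  - by move=> x _; rewrite addr_ge0.
  - by move=> x _; rewrite -!mulrDl ler_wpM2r//; exact: max_step.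
have {}H := le_trans H (leeD2r _ IH).
(* The term q int y_N^(p-1) f s now stands on both sides; it cancels because it is finite. *)
rewrite addeC in H; move: H; rewrite leeD2lE//.
rewrite fin_numM// ge0_fin_numE ?yf_fin//; exact: int_ge0.
Qed.

(** With X and Y the integrals of f^p and y_N^p, [y_step] and Hölder's inequality give Y <= q
    X^(1/p) Y^(1 - 1/p). Stopping at a finite level N keeps Y finite, so that Y^(1 - 1/p) can be
    divided out. *)
Lemma doob_maximal N : \int[mu]_x (y N x `^ p * s x)%:E <=
  (q `^ p)%:E * \int[mu]_x (f x `^ p * s x)%:E.
Proof.
have := le_trans (y_step N) (lee_wpmul2l (_ : 0 <= q%:E) (yf N)).
rewrite lee_fin (ltW q0) => /(_ isT).
have Yf := y_fin N; have Xf := fp.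
have Y0 : 0 <= \int[mu]_x (y N x `^ p * s x)%:E.
  by apply: int_ge0 => x _; rewrite mulr_ge0 ?powR_ge0.
have X0 : 0 <= \int[mu]_x (f x `^ p * s x)%:E.
  by apply: int_ge0 => x _; rewrite mulr_ge0 ?powR_ge0.
move: Yf Y0 Xf X0; case: (\int[mu]_x (y N x `^ p * s x)%:E) => [Y| |]//.
case: (\int[mu]_x (f x `^ p * s x)%:E) => [X| |]// _ Y0 _ X0.
rewrite !poweR_EFin -!EFinM !lee_fin; move: Y0 X0; rewrite !lee_fin.
rewrite le_eqVlt => /predU1P[<- X0 _|Y0 X0]; first by rewrite mulr_ge0 ?powR_ge0.
rewrite powRB ?powRr1 ?(ltW Y0)//; last by rewrite (gt_eqF Y0) implybT.
move=> H.
have Y'0 : (0 < Y `^ p^-1)%R by rewrite powR_gt0.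
have : (Y `^ p^-1 <= q * X `^ p^-1)%R.
  rewrite -(ler_pM2l Y0) -ler_pdivlMr//.
  by apply: (le_trans H); rewrite le_eqVlt; apply/orP; left; apply/eqP; ring.
move=> /(ler_powRl (ltW p0)) -/(_ (powR_ge0 _ _)).
rewrite (powRM _ (ltW q0) (powR_ge0 _ _)) -!powRrM mulVf// (powRr1 X0).
by rewrite (powRr1 (ltW Y0)).
Qed.

End doob.

(** * Buckley bound on partitions *)

Lemma int_gt0 d (T : measurableType d) (R : realType)
    (mu : {measure set T -> \bar R}) (C : set T) (h : T -> R) :
  measurable C -> measurable_fun setT h -> (forall x, 0 < h x)%R ->
  0 < mu C -> 0 < \int[mu]_(x in C) (h x)%:E.
Proof.
move=> mC mh h0 C0; rewrite lt0e int_ge0 ?andbT; last by move=> x _; exact: ltW.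
apply/negP => /eqP I0; move: C0; rewrite ltNge => /negP; apply.
have mhC : measurable_fun C (fun x => (h x)%:E).
  by apply: measurable_funTS; exact: mfun_EFin.
have : \int[mu]_(x in C) `|(h x)%:E| = 0.
  by rewrite -[RHS]I0; apply: eq_integral => x _; rewrite gee0_abs// lee_fin ltW.
move=> /(@ae_eq_integral_abs _ _ _ mu C mC _ mhC) [N [mN N0 CN]].
rewrite -N0; apply: le_measure; rewrite ?inE//.
apply: subset_trans CN => x Cx /= /(_ Cx) [] hx.
by move: (h0 x); rewrite hx ltxx.
Qed.

Section buckley.
Context d (T : measurableType d) {R : realType} (mu : {measure set T -> \bar R}).
Context (I : countType) (idx : nat -> T -> I).
Hypothesis midx : forall k i, measurable (idx k @^-1` [set i]).
Hypothesis nest : forall k x z, idx k.+1 x = idx k.+1 z -> idx k x = idx k z.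
Hypothesis mufin : forall k x, 0 < mu (cell (idx k) x) < +oo.
Variables (w f : T -> R) (p A : R).
Hypothesis mw : measurable_fun setT w.
Hypothesis w0 : forall x, (0 < w x)%R.
Hypothesis p1 : (1 < p)%R.
Hypothesis A0 : (0 < A)%R.
Local Notation sg := (fun x => w x `^ (- (p - 1)^-1))%R.
Hypothesis Ap : forall k x,
  (\int[mu]_(z in cell (idx k) x) (w z)%:E) *
  (\int[mu]_(z in cell (idx k) x) (sg z)%:E) `^ (p - 1) <=
  A%:E * mu (cell (idx k) x) `^ p.
Hypothesis mf : measurable_fun setT f.
Hypothesis f0 : forall x, (0 <= f x)%R.
Hypothesis fp : \int[mu]_z (f z `^ p * w z)%:E < +oo.

Let p0 : (0 < p)%R. Proof. exact: lt_trans p1. Qed.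
Let p10 : (0 < p - 1)%R. Proof. by rewrite subr_gt0. Qed.
Let pn0 : p != 0%R. Proof. by rewrite gt_eqF. Qed.
Let p1n0 : (p - 1 != 0)%R. Proof. by rewrite gt_eqF. Qed.
Let mcell k x : measurable (cell (idx k) x). Proof. exact: midx. Qed.
Let q := (p / (p - 1))%R.
Let q0 : (0 < q)%R. Proof. by rewrite divr_gt0. Qed.
Let q1 : (1 < q)%R.
Proof. by rewrite ltr_pdivlMr// mul1r ltrBlDr ltrDl. Qed.
Let qq : (q / (q - 1) = p)%R.
Proof.
have -> : (q - 1 = (p - 1)^-1)%R by rewrite /q; field.
by rewrite invrK /q divfK.
Qed.
Let qp : ((p - 1) * q = p)%R. Proof. by rewrite /q mulrCA mulfV// mulr1. Qed.

Let sg0 x : (0 < sg x)%R. Proof. exact: powR_gt0. Qed.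
Let msg : measurable_fun setT sg. Proof. exact: mfun_pow. Qed.
Let g x := (f x / sg x)%R.
Let g0 x : (0 <= g x)%R. Proof. by rewrite divr_ge0// ltW. Qed.
Let gE x : g x = (f x * w x `^ ((p - 1)^-1))%R.
Proof. by rewrite /g -powRN opprK. Qed.
Let mg : measurable_fun setT g.
Proof. by rewrite (funext gE); mfun. Qed.
Let gsg x : (g x * sg x = f x)%R.
Proof. by rewrite /g divfK// gt_eqF. Qed.
Let gp x : (g x `^ p * sg x = f x `^ p * w x)%R.
Proof.
rewrite gE powRM ?powR_ge0// -mulrA -powRrM -powRD; last first.
  by rewrite (gt_eqF (w0 x)) implybT.
have -> : ((p - 1)^-1 * p + - (p - 1)^-1 = 1)%R by field.
by rewrite powRr1// ltW.
Qed.
Let gpfin : \int[mu]_z (g z `^ p * sg z)%:E < +oo.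
Proof. by under eq_integral do rewrite gp. Qed.

Let w_pos k x : 0 < \int[mu]_(z in cell (idx k) x) (w z)%:E.
Proof. by apply: int_gt0 => //; have /andP[] := mufin k x. Qed.
Let s_pos k x : 0 < \int[mu]_(z in cell (idx k) x) (sg z)%:E.
Proof. by apply: int_gt0 => //; have /andP[] := mufin k x. Qed.

Let Am_fin k x : A%:E * mu (cell (idx k) x) `^ p < +oo.
Proof.
by rewrite lte_mul_pinfty ?lee_fin ?(ltW A0)// poweR_lty//;
  have /andP[] := mufin k x.
Qed.

Let wfin k x : 0 < \int[mu]_(z in cell (idx k) x) (w z)%:E < +oo.
Proof.
rewrite w_pos ltey; apply/negP => /eqP wy.
have := le_lt_trans (Ap k x) (Am_fin k x).
by rewrite wy gt0_mulye ?ltxx// poweR_gt0.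
Qed.

Let sfin k x : 0 < \int[mu]_(z in cell (idx k) x) (sg z)%:E < +oo.
Proof.
rewrite s_pos ltey; apply/negP => /eqP sy.
have := le_lt_trans (Ap k x) (Am_fin k x).
by rewrite sy poweRyr// gt0_muley ?ltxx.
Qed.

Local Notation ys := (runmax (fun k => wavg mu sg g (idx k))).
Local Notation yf := (runmax (fun k => wavg mu (fun=> 1%R) f (idx k))).

Let mys N : measurable_fun setT (ys N).
Proof.
apply: measurable_runmax => k; apply: (partition_measurable (midx k)) => x z.
exact: wavg_cell.
Qed.

Lemma buckley_int_fin k x : \int[mu]_(z in cell (idx k) x) (f z)%:E \is a fin_num.
Proof.
have := wavg_int_fin midx msg sg0 sfin mg g0 p1 gpfin k x.
by under eq_integral do rewrite gsg.
Qed.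

Section fixN.
Variable N : nat.
(** Here G w = (ys N)^(p-1) and G^q w = (ys N)^p sg: Doob's inequality for sg at the exponent p
    feeds the one for w at the conjugate exponent q. *)
Let G x := (ys N x `^ (p - 1) * w x `^ (-1))%R.
Let mG : measurable_fun setT G. Proof. by rewrite /G; mfun; exact: mys. Qed.
Let G0 x : (0 <= G x)%R. Proof. by rewrite mulr_ge0 ?powR_ge0. Qed.
Let Gq x : (G x `^ q * w x = ys N x `^ p * sg x)%R.
Proof.
rewrite powRM ?powR_ge0// -!powRrM qp -mulrA; congr (_ * _)%R.
rewrite -{2}(powRr1 (ltW (w0 x))) -powRD; last first.
  by rewrite (gt_eqF (w0 x)) implybT.
by congr (_ `^ _)%R; rewrite /q; field.
Qed.
Let Gw x : (G x * w x = ys N x `^ (p - 1))%R.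
Proof. by rewrite /G powRN (powRr1 (ltW (w0 x))) divfK// gt_eqF. Qed.

Let ys_doob : \int[mu]_x (ys N x `^ p * sg x)%:E <=
  (q `^ p)%:E * \int[mu]_x (f x `^ p * w x)%:E.
Proof.
have -> : \int[mu]_x (f x `^ p * w x)%:E = \int[mu]_x (g x `^ p * sg x)%:E.
  by apply: eq_integral => x _; rewrite gp.
exact: (doob_maximal midx nest msg sg0 sfin mg g0 p1 gpfin).
Qed.

Let Gfin : \int[mu]_x (G x `^ q * w x)%:E < +oo.
Proof.
under eq_integral do rewrite Gq; apply: (le_lt_trans ys_doob).
by rewrite lte_mul_pinfty ?lee_fin ?powR_ge0.
Qed.

Local Notation yw := (runmax (fun k => wavg mu w G (idx k))).
Let w0' x : (0 <= w x)%R. Proof. exact: ltW. Qed.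
Let yw0 M x : (0 <= yw M x)%R.
Proof. by apply: runmax_ge0 => k; exact: wavg_ge0. Qed.

Let yw_doob : \int[mu]_x (yw N x `^ q * w x)%:E <=
  (p `^ q * q `^ p)%:E * \int[mu]_x (f x `^ p * w x)%:E.
Proof.
have := doob_maximal midx nest mw w0 wfin mG G0 q1 Gfin N; rewrite qq.
have -> : \int[mu]_x (G x `^ q * w x)%:E = \int[mu]_x (ys N x `^ p * sg x)%:E.
  by apply: eq_integral => x _; rewrite Gq.
move=> h; apply: (le_trans h); rewrite EFinM -muleA.
by apply: lee_wpmul2l => //; rewrite lee_fin powR_ge0.
Qed.

(** Lerner's pointwise bound. On a cell C, (avg_C f)^(p-1) is the product of w(C) sg(C)^(p-1) /
    mu(C)^p, which is at most A, of mu(C)/w(C), and of (F/sg(C))^(p-1) with F the integral of f over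
    C. The last factor is at most G w everywhere on C, so mu(C) times it is at most the integral of
    G w. *)
Let wavg_lerner k x : (k <= N)%N ->
  (wavg mu (fun=> 1) f (idx k) x `^ (p - 1) <= A * wavg mu w G (idx k) x)%R.
Proof.
move=> kN; rewrite wavg.unlock.
have -> : \int[mu]_(z in cell (idx k) x) (f z * 1)%:E =
    \int[mu]_(z in cell (idx k) x) (g z * sg z)%:E.
  by apply: eq_integral => z _; rewrite gsg mulr1.
have -> : \int[mu]_(z in cell (idx k) x) (1 : R)%:E = mu (cell (idx k) x).
  by rewrite integral_cst// mul1e.
have Ffin := wavg_int_fin midx msg sg0 sfin mg g0 p1 gpfin k x.
have GWfin := wavg_int_fin midx mw w0 wfin mG G0 q1 Gfin k x.
have := Ap k x; have := wfin k x; have := sfin k x; have := mufin k x.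
have lb : (wavg mu sg g (idx k) x `^ (p - 1))%:E * mu (cell (idx k) x) <=
    \int[mu]_(z in cell (idx k) x) (G z * w z)%:E.
  rewrite -integral_cst//; apply: le_int => //.
  - by mfun.
  - by move=> z _; rewrite powR_ge0.
  - move=> z; rewrite /cell /= => zx; rewrite Gw ler_powRl ?(ltW p10)//.
      by apply: wavg_ge0 => // u; exact: ltW.
    by rewrite -(wavg_cell mu sg g zx) runmax_ge.
move: lb GWfin Ffin; rewrite wavg.unlock.
have F0 : 0 <= \int[mu]_(z in cell (idx k) x) (g z * sg z)%:E.
  by apply: int_ge0 => z _; rewrite mulr_ge0// ltW.
move: F0.
case: (\int[mu]_(z in _) (g z * sg z)%:E) => [F| |]//.
case: (\int[mu]_(z in _) (G z * w z)%:E) => [H| |]//.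
case: (mu (cell (idx k) x)) => [m| |]//; rewrite ?ltxx ?andbF//.
case: (\int[mu]_(z in _) (sg z)%:E) => [b| |]//; rewrite ?ltxx ?andbF//.
case: (\int[mu]_(z in _) (w z)%:E) => [a| |]//; rewrite ?ltxx ?andbF//.
rewrite /= -!EFinM !lee_fin !lte_fin => F0 lb _ _.
move=> /andP[m0 _] /andP[b0 _] /andP[a0 _] Aab.
have pm0 : (0 < m `^ (p - 1))%R by exact: powR_gt0.
have pb0 : (0 < b `^ (p - 1))%R by exact: powR_gt0.
rewrite mulrA ler_pdivlMr// powRM ?invr_ge0 ?(ltW m0)//.
rewrite -[(m^-1)%R]powR_inv1 ?(ltW m0)// -powRrM mulN1r powRN.
rewrite mulrAC ler_pdivrMr//.
have -> : (F `^ (p - 1) = (F / b) `^ (p - 1) * b `^ (p - 1))%R.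
  by rewrite -powRM ?divr_ge0 ?(ltW b0)// divfK// gt_eqF.
have mp : (m * m `^ (p - 1) = m `^ p)%R by rewrite mulr_powRB1// ltW.
have h1 : ((F / b) `^ (p - 1) * (a * b `^ (p - 1)) <=
  (F / b) `^ (p - 1) * (A * m `^ p))%R by rewrite ler_wpM2l ?powR_ge0.
have h2 : (A * ((F / b) `^ (p - 1) * m) * m `^ (p - 1) <=
  A * H * m `^ (p - 1))%R.
  by rewrite ler_pM2r// ler_pM2l.
apply: le_trans h2; move: h1; rewrite -mp.
by rewrite [X in (X <= _)%R -> _](_ : _ = (F / b) `^ (p - 1) * b `^ (p - 1) * a)%R;
  [move=> h; apply: (le_trans h); rewrite le_eqVlt; apply/orP; left; apply/eqP;
   ring | ring].
Qed.

(** The maximum over k in [wavg_lerner] gives (yf)^(p-1) <= A yw, and the two Doob inequalities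
    contribute p^q q^p. The p-th root of A^q is A^(1/(p-1)), Buckley's power. *)
Lemma buckley_partition : \int[mu]_x (yf N x `^ p * w x)%:E <=
  (A `^ q * (p `^ q * q `^ p))%:E * \int[mu]_x (f x `^ p * w x)%:E.
Proof.
have myf : measurable_fun setT (yf N).
  apply: measurable_runmax => k; apply: (partition_measurable (midx k)) => x z.
  exact: wavg_cell.
have myw : measurable_fun setT (yw N).
  apply: measurable_runmax => k; apply: (partition_measurable (midx k)) => x z.
  exact: wavg_cell.
rewrite EFinM -muleA; apply: le_trans (lee_wpmul2l _ yw_doob); last first.
  by rewrite lee_fin powR_ge0.
rewrite -int_scale ?powR_ge0//; last 2 first.
- by mfun.
- by move=> x _; rewrite mulr_ge0 ?powR_ge0.
apply: le_int => //; [by mfun|by mfun| |].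
  by move=> x _; rewrite mulr_ge0 ?powR_ge0.
move=> x _; rewrite mulrA ler_wpM2r//.
rewrite -(powRM _ (ltW A0) (yw0 N x)) -{1}qp powRrM.
apply: ler_powRl; rewrite ?powR_ge0 ?(ltW q0)//.
have -> : (A * yw N x = ((A * yw N x) `^ (p - 1)^-1) `^ (p - 1))%R.
  by rewrite -powRrM mulVf// powRr1// mulr_ge0// ltW.
apply: ler_powRl; rewrite ?(ltW p10)//.
  by apply: runmax_ge0 => k; exact: wavg_ge0.
apply: runmax_le => k kN.
rewrite -[leLHS](@powR_conjK _ _ (p - 1))//; last exact: wavg_ge0.
apply: ler_powRl; rewrite ?powR_ge0 ?invr_ge0 ?(ltW p10)//.
apply: (le_trans (wavg_lerner x kN)); rewrite ler_pM2l//.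
exact: runmax_ge.
Qed.
End fixN.
End buckley.

(** * Shifted dyadic grids *)

Section shifted_grid.
Context {R : realType}.
Local Open Scope ring_scope.
Implicit Types (b : bool) (k : int) (t : R).

(* The adjacent dyadic grids of the line: at scale 2^-k the grid is shifted by
   (-1)^k/3, which makes the shifted grids nested as well (one-third trick). *)
Definition gcoord b k t : R := t * 2 ^ k + (if b then (-1) ^ k / 3 else 0).

Lemma exp2z_gt0 k : (0 : R) < 2 ^ k. Proof. by rewrite exprz_gt0. Qed.

(** Between consecutive scales the shift changes by an integer, as (-1)^(k+1)/3 = 2 (-1)^k/3 -
    (-1)^k; this is the reason for the nesting. *)
Lemma gcoordS b k t :
  gcoord b (k + 1) t = 2 * gcoord b k t - (if b then (-1) ^ k else 0).
Proof.
rewrite /gcoord !expfzDr ?oppr_eq0 ?oner_eq0 ?pnatr_eq0// !expr1z.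
by case: b; field.
Qed.

Lemma signz_int k : exists z : int, (-1) ^ k = z%:~R :> R.
Proof.
exists ((-1) ^ k); case: k => n /=; first by rewrite /exprz /= rmorphXn rmorphN1.
rewrite /exprz /= -!exprVn !invrN !invr1 rmorphXn rmorphN1//.
Qed.

Lemma floor_neq_sep (x y : R) : Num.floor x <> Num.floor y ->
  exists j : int, (x < j%:~R <= y) || (y < j%:~R <= x).
Proof.
move=> /eqP; rewrite neq_lt => /orP[h|h].
  by exists (Num.floor y); rewrite -floor_lt_int h floor_le.
by exists (Num.floor x); rewrite -!floor_lt_int h floor_le orbT.
Qed.

Lemma floor_sep_neq (x y : R) (j : int) : x < j%:~R <= y ->
  Num.floor x <> Num.floor y.
Proof.
move=> /andP[xj jy] xy; move: xj; rewrite -floor_lt_int xy ltNge.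
by rewrite floor_ge_int jy.
Qed.

(** An integer j that separates two points at scale k gives the integer 2 j - c that separates them
    at scale k + 1, with c the integral shift of [gcoordS]. *)
Lemma gcoord_nest b k (t u : R) :
  Num.floor (gcoord b (k + 1) t) = Num.floor (gcoord b (k + 1) u) ->
  Num.floor (gcoord b k t) = Num.floor (gcoord b k u).
Proof.
move=> h; apply: contrapT => /floor_neq_sep [j tu].
have [z ze] := signz_int k.
have key (x y : R) : x < j%:~R <= y -> Num.floor (2 * x - (if b then ((-1) ^ k : R) else 0))
    <> Num.floor (2 * y - (if b then (-1) ^ k else 0)).
  move=> /andP[xj jy]; pose c : int := if b then z else 0.
  have ce : (if b then (-1) ^ k else 0) = c%:~R :> R by rewrite /c; case: (b).
  refine (@floor_sep_neq _ _ (2 * j - c) _).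
  rewrite ce rmorphB rmorphM /= ltrD2r lerD2r.
  by rewrite ltr_pM2l ?ler_pM2l ?xj.
case/orP: tu => /key; rewrite -!gcoordS => nh; first exact: nh h.
exact: nh (esym h).
Qed.

Lemma dyadic_scale (l : R) : 0 < l ->
  exists k : int, l <= (2 ^ k)^-1 /\ (2 ^ k)^-1 <= 2 * l.
Proof.
move=> l0; have l2 : 0 < ln (2 : R) by rewrite ln_gt0// ltr1n.
pose z := ln l / ln 2; exists (- Num.ceil z).
have e (j : int) : (2 : R) ^ j = expR (j%:~R * ln 2).
  by rewrite -powR_intmul// /powR pnatr_eq0.
have lE : l = expR (z * ln 2) by rewrite /z divfK ?gt_eqF// lnK// posrE.
have -> : ((2 : R) ^ (- Num.ceil z))^-1 = 2 ^ Num.ceil z.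
  by rewrite invr_expz opprK.
rewrite e; split.
  by rewrite {1}lE ler_expR ler_pM2r// ceil_ge.
have -> : (2 : R) * l = expR ((1 + z) * ln 2).
  by rewrite [in RHS]mulrDl expRD mul1r lnK ?posrE// -lE.
rewrite ler_expR ler_pM2r//.
by have := ceilB1_lt z; rewrite rmorphB /= rmorph1 ltrBlDr addrC => /ltW.
Qed.

(** If both grids cut the interval, then in units of the mesh their cuts j -+ 1/3 and i lie in an
    interval of length at most 1/3, open on the left. Hence |j - i| < 2/3 and j = i, but then the
    cuts are exactly 1/3 apart, a contradiction. *)
Lemma gcoord_interval k (a l : R) : 0 <= l -> l * 3 <= (2 ^ k)^-1 ->
  exists b, forall t, a <= t <= a + l ->
    Num.floor (gcoord b k t) = Num.floor (gcoord b k a).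
Proof.
move=> l0 l3; have k0 := exp2z_gt0 k.
have {}l3 : l * 2 ^ k <= 3^-1.
  by rewrite -ler_pdivlMr// mulrC ler_pdivlMr.
apply: contrapT => h.
have sep b : exists j : int, gcoord b k a < j%:~R <= gcoord b k (a + l).
  have : exists2 t, a <= t <= a + l & Num.floor (gcoord b k t) <>
      Num.floor (gcoord b k a).
    apply: contrapT => hb; apply: h; exists b => t ta.
    by apply: contrapT => nt; apply: hb; exists t.
  move=> [t /andP[ta tl]] /floor_neq_sep [j].
  have at' : gcoord b k a <= gcoord b k t by rewrite lerD2r ler_pM2r.
  have tl' : gcoord b k t <= gcoord b k (a + l) by rewrite lerD2r ler_pM2r.
  case/orP => /andP[h1 h2]; exists j.
    by have := lt_le_trans h1 (le_trans h2 at'); rewrite ltxx.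
  by rewrite h1 (le_trans h2).
have [i] := sep false; have [j] := sep true; rewrite /gcoord !addr0 mulrDl.
have sgn : (-1) ^ k = 1 :> R \/ (-1) ^ k = -1 :> R.
  have [z] := signz_int k; case: k {l3 h sep k0} => n _.
    rewrite /exprz -signr_odd; case: (odd n); [right|left].
      by rewrite expr1.
    by rewrite expr0.
  rewrite /exprz -signr_odd; case: (odd _); [right|left].
    by rewrite expr1 invrN1.
  by rewrite expr0 invr1.
set A := a * 2 ^ k; set L := l * 2 ^ k in l3 *.
move=> /andP[j1 j2] /andP[i1 i2].
have ij (m : int) : - (1 : R) < m%:~R -> m%:~R < (1 : R) -> m = 0.
  move=> m1 m2; apply/eqP; rewrite eq_le -!ltzD1 add0r.
  by rewrite -(ltr_int R) m2 /= -ltrBlDr sub0r -(ltr_int R) rmorphN1.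
have : j - i = 0.
  by apply: ij; rewrite rmorphB /=; case: sgn => s; move: j1 j2; rewrite s; lra.
move=> /eqP; rewrite subr_eq0 => /eqP ji; move: j1 j2; rewrite ji.
by case: sgn => ->; lra.
Qed.
End shifted_grid.

Section dyadic_cells.
Context {R : realType} (n : nat).
Local Notation E := (Rn R n).
Local Notation B := (measurableTypeR R).
Local Notation mu := (@leb R n).

Lemma measurable_Rn_borel (A : set (n.-tuple B)) :
  measurable A -> measurable (A : set E).
Proof. by move=> mA; exact: caratheodory_measurable_mu_ext. Qed.

Lemma measurable_cube_Rn (a : E) l : measurable (cube a l : set E).
Proof. by apply: measurable_Rn_borel; exact: measurable_cube. Qed.

Definition gidx (e : n.-tuple bool) (k : int) (x : E) : n.-tuple int :=
  [tuple Num.floor (gcoord (tnth e i) k (tnth x i)) | i < n].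

Lemma gidx_eqP e k (x z : E) : gidx e k x = gidx e k z <->
  forall i, Num.floor (gcoord (tnth e i) k (tnth x i)) =
            Num.floor (gcoord (tnth e i) k (tnth z i)).
Proof.
split=> [h i|h]; last by apply: eq_from_tnth => i; rewrite !tnth_mktuple.
by move/(congr1 (fun t => tnth t i)) : h; rewrite !tnth_mktuple.
Qed.

Lemma gidx_nest e k (x z : E) :
  gidx e (k + 1) x = gidx e (k + 1) z -> gidx e k x = gidx e k z.
Proof. by move=> /gidx_eqP h; apply/gidx_eqP => i; exact: gcoord_nest. Qed.

(** Cells are half-open while [cube] is closed. Halving the side of the inner cube leaves room for
    the missing faces, at the cost of a factor 2^n in volume. *)
Lemma gidx_cell_cubes e k (x : E) : exists a : E,
  cell (gidx e k) x `<=` cube a (2 ^ k)^-1%R /\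
  cube a ((2 ^ k)^-1 / 2)%R `<=` cell (gidx e k) x.
Proof.
have k0 := @exp2z_gt0 R k.
pose s i : R := if tnth e i then ((-1) ^ k / 3)%R else 0%R.
pose m i : R := (Num.floor (gcoord (tnth e i) k (tnth x i)))%:~R%R.
pose a : n.-tuple B := [tuple ((m i - s i) / 2 ^ k)%R | i < n].
exists (a : E).
have key (z : E) i : (m i <= gcoord (tnth e i) k (tnth z i) < m i + 1)%R =
    (tnth a i <= tnth z i < tnth a i + (2 ^ k)^-1)%R.
  rewrite tnth_mktuple /gcoord -/(s i) ler_pdivrMr// lerBlDr.
  rewrite -[X in (_ / _ + X)%R]mul1r -mulrDl ltr_pdivlMr//.
  by rewrite -[in RHS]addrAC ltrBrDr.
split=> z.
  rewrite /cell /= => zx i.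
  have := key z i; move/gidx_eqP : zx => /(_ i) zi.
  have -> : (m i <= gcoord (tnth e i) k (tnth z i) < m i + 1)%R.
    rewrite /m -zi -[1%R]/(1%:~R) -rmorphD /=; exact: floor_itv.
  by move=> /esym /andP[-> /ltW].
move=> za; rewrite /cell /=; apply/gidx_eqP => i.
apply/eqP; rewrite floor_eq rmorphD /= -/(m i) key.
have := za i => /andP[-> h] /=; apply: (le_lt_trans h).
have h0 : (0 < ((2 : R) ^ k)^-1)%R by rewrite invr_gt0.
by rewrite ltrD2l; lra.
Qed.

Lemma measurable_gidx e k m : measurable (gidx e k @^-1` [set m]).
Proof.
apply: measurable_Rn_borel.
have -> : gidx e k @^-1` [set m] = \bigcap_(i in [set: 'I_n])
    ((fun x : n.-tuple B => tnth x i) @^-1`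
      ((fun t : B => gcoord (tnth e i) k t) @^-1`
        `[((tnth m i)%:~R)%R, ((tnth m i + 1)%:~R)%R[%classic)).
  apply/seteqP; split => [x /= xm i _|x h /=].
    by rewrite /= in_itv /= -floor_eq -xm tnth_mktuple.
  apply: eq_from_tnth => i; rewrite tnth_mktuple; apply/eqP; rewrite floor_eq.
  by have := h i I; rewrite /= in_itv.
apply: fin_bigcap_measurable => // i _; rewrite -[X in measurable X]setTI.
apply: measurable_tnth => //; rewrite -[X in measurable X]setTI.
have mg : measurable_fun setT (fun t : B => gcoord (tnth e i) k t).
  by rewrite /gcoord; apply: measurable_funD => //; exact: measurable_funM.
by apply: mg => //; exact: measurable_itv.
Qed.

Lemma measurable_gcell e k x : measurable (cell (gidx e k) x).
Proof. exact: measurable_gidx. Qed.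

Lemma leb_gcell e k x :
  ((((2 ^ k)^-1 / 2) ^+ n)%R)%:E <= mu (cell (gidx e k) x) <=
  (((2 ^ k)^-1 ^+ n)%R)%:E.
Proof.
have h0 : (0 < ((2 : R) ^ k)^-1)%R by rewrite invr_gt0 exp2z_gt0.
have [a [xa ax]] := gidx_cell_cubes e k x.
rewrite -(leb_cube a) ?divr_ge0 ?(ltW h0)// -(leb_cube a) ?(ltW h0)//.
have mc := measurable_cube_Rn a; have mg := measurable_gcell e k x.
by apply/andP; split; apply: le_measure; rewrite ?inE.
Qed.

Lemma leb_gcell_fin e k x : 0 < mu (cell (gidx e k) x) < +oo.
Proof.
have h0 : (0 < ((2 : R) ^ k)^-1)%R by rewrite invr_gt0 exp2z_gt0.
have /andP[h1 h2] := leb_gcell e k x; apply/andP; split.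
  by apply: lt_le_trans h1; rewrite lte_fin exprn_gt0// divr_gt0.
exact: le_lt_trans h2 (ltry _).
Qed.

(** The mesh is taken between 3 l and 6 l, which is the origin of the 6. The one-third trick is
    applied to each coordinate separately, so a grid is indexed by one boolean per coordinate. *)
Lemma cube_in_gcell (a : E) l : (0 < l)%R -> exists e k,
  ((2 ^ k)^-1 <= 6 * l)%R /\
  forall x, cube a l x -> cube a l `<=` cell (gidx e k) x.
Proof.
move=> l0; have [|k [k1 k2]] := @dyadic_scale R (l * 3)%R.
  by rewrite mulr_gt0.
have /choice[e he] (i : 'I_n) : exists b, forall t,
    (tnth a i <= t <= tnth a i + l)%R ->
    Num.floor (gcoord b k t) = Num.floor (gcoord b k (tnth a i)).
  by apply: gcoord_interval => //; exact: ltW.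
exists [tuple e i | i < n], k; split; first by apply: (le_trans k2); lra.
move=> x xQ z zQ; rewrite /cell /=; apply/gidx_eqP => i; rewrite tnth_mktuple.
by rewrite !he.
Qed.

End dyadic_cells.

(** * The maximal operator *)

Section monotone_limit.
Context d (T : measurableType d) {R : realType} (mu : {measure set T -> \bar R}).

(** The products of [Z K] with [w] increase to a limit with integral at most b, hence finite almost
    everywhere; its real part divided by w is [Y]. *)
Lemma ae_monotone_limit (Z : nat -> T -> R) (w : T -> R) (b : R) :
  (forall K, measurable_fun setT (Z K)) -> (forall K x, 0 <= Z K x)%R ->
  (forall x, nondecreasing_seq (Z ^~ x)) ->
  measurable_fun setT w -> (forall x, 0 < w x)%R ->
  (forall K, \int[mu]_x (Z K x * w x)%:E <= b%:E) ->
  exists Y : T -> R, [/\ measurable_fun setT Y, (forall x, 0 <= Y x)%R,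
    \int[mu]_x (Y x * w x)%:E <= b%:E &
    {ae mu, forall x, Z ^~ x @ \oo --> Y x}].
Proof.
move=> mZ Z0 ndZ mw w0 Zb.
pose g K x := (Z K x * w x)%:E.
have mg K : measurable_fun setT (g K) by apply: mfun_EFin; mfun.
have g0 K x : 0 <= g K x by rewrite lee_fin mulr_ge0// ltW.
have ndg x : nondecreasing_seq (g ^~ x).
  by move=> i j ij; rewrite lee_fin ler_wpM2r ?ndZ// ltW.
pose S x := limn (g ^~ x).
have cvgS x : g ^~ x @ \oo --> S x.
  by apply: ereal_nondecreasing_is_cvgn; exact: ndg.
have mS : measurable_fun setT S.
  by apply: (emeasurable_fun_cvg g) => // x _; exact: cvgS.
have S0 x : 0 <= S x.
  by apply: lime_ge; [exact: cvgS|exact: nearW].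
have Sb : \int[mu]_x S x <= b%:E.
  rewrite (monotone_convergence mu measurableT mg) => [|K x _|x _]; last 2 first.
  - exact: g0.
  - exact: ndg.
  apply: lime_le; last by apply: nearW => K; exact: Zb.
  apply: ereal_nondecreasing_is_cvgn => i j ij.
  by apply: ge0_le_integral => // x _; exact: ndg.
have aeS : {ae mu, forall x, S x \is a fin_num}.
  have : mu.-integrable setT S.
    apply/integrableP; split=> //; under eq_integral do rewrite gee0_abs//.
    exact: le_lt_trans Sb (ltry _).
  move=> /(integrable_ae measurableT).
  by apply: filterS => x; apply.
exists (fun x => fine (S x) * w x `^ (-1))%R; split.
- by apply: measurable_funM; [exact: measurableT_comp|exact: mfun_pow].
- by move=> x; rewrite mulr_ge0 ?powR_ge0// fine_ge0.
- apply: le_trans Sb; apply: ge0_le_integral => //.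
  + move=> x _; rewrite lee_fin mulr_ge0 ?mulr_ge0 ?powR_ge0 ?fine_ge0//.
    exact: ltW.
  + apply: mfun_EFin; mfun; exact: measurableT_comp.
  + move=> x _; rewrite powRN powRr1 ?(ltW (w0 x))// divfK ?gt_eqF//.
    case: (S x) (S0 x) => //= _; exact: leey.
- move: aeS; apply: filterS => x Sx.
  have wx : (w x * w x `^ (-1) = 1)%R.
    by rewrite powRN powRr1 ?(ltW (w0 x))// divff// gt_eqF.
  have : (fun K => Z K x * w x)%R @ \oo --> fine (S x).
    have h : g ^~ x @ \oo --> (fine (S x))%:E by rewrite fineK//; exact: cvgS.
    exact: (fine_cvg h).
  move=> h.
  have -> : Z ^~ x = (fun K => Z K x * w x * w x `^ (-1))%R.
    by apply/funext => K; rewrite -mulrA wx mulr1.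
  exact: (cvgM h (cvg_cst _)).
Qed.

End monotone_limit.

Section maximal.
Context {R : realType} (n : nat).
Local Notation E := (Rn R n).
Local Notation mu := (@leb R n).

Lemma leb_cube_fin (Q : set E) : cubes Q -> exists2 m : R, (0 < m)%R & mu Q = m%:E.
Proof.
move=> [a [l [l0 ->]]]; exists (l ^+ n)%R; first exact: exprn_gt0.
by rewrite leb_cube// ltW.
Qed.

Lemma measurable_cubes (Q : set E) : cubes Q -> measurable Q.
Proof. by move=> [a [l [l0 ->]]]; exact: measurable_cube_Rn. Qed.

Lemma int_avg (Q : set E) (f : E -> \bar R) : cubes Q ->
  \int[mu]_(x in Q) f x = avg Q f * mu Q.
Proof.
move=> /leb_cube_fin [m m0 me].
by rewrite /avg me inver (gt_eqF m0) -muleA -EFinM mulVf ?gt_eqF// mule1.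
Qed.

(** Doob's inequality starts from a coarsest level. Index k stands for the scale k - K, so that k <=
    2 K covers the scales from -K to K, a window that grows with [K]. *)
Definition gidx_fin (e : n.-tuple bool) (K k : nat) : E -> n.-tuple int :=
  gidx e (k%:Z - K%:Z)%R.

Lemma gidx_fin_nest e K k x z :
  gidx_fin e K k.+1 x = gidx_fin e K k.+1 z -> gidx_fin e K k x = gidx_fin e K k z.
Proof. by rewrite /gidx_fin -addn1 PoszD addrAC; exact: gidx_nest. Qed.

Definition dyadic_max (h : E -> R) e K : E -> R :=
  runmax (fun k => wavg mu (fun=> 1%R) h (gidx_fin e K k)) K.*2.

Lemma dyadic_max_ge0 h e K x : (forall z, 0 <= h z)%R ->
  (0 <= dyadic_max h e K x)%R.
Proof. by move=> h0; apply: runmax_ge0 => k; exact: wavg_ge0. Qed.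

Lemma dyadic_max_nd h e K x : (dyadic_max h e K x <= dyadic_max h e K.+1 x)%R.
Proof.
apply: runmax_le => k kK.
have -> : gidx_fin e K k = gidx_fin e K.+1 k.+1.
  by rewrite /gidx_fin -[k.+1]addn1 -[K.+1]addn1 !PoszD opprD addrACA subrr addr0.
have := @runmax_ge _ _ _ (fun k => wavg mu (fun=> 1%R) h (gidx_fin e K.+1 k))
  K.+1.*2 k.+1 x.
by apply; rewrite doubleS ltnS leqW.
Qed.

Lemma measurable_dyadic_max h e K : measurable_fun setT (dyadic_max h e K).
Proof.
apply: measurable_runmax => k.
apply: (@partition_measurable _ _ _ _ (gidx_fin e K k)) => [i|x z].
  exact: measurable_gidx.
exact: wavg_cell.
Qed.

Section weighted.
Variables (p A : R) (w : E -> R).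
Hypothesis p1 : (1 < p)%R.
Hypothesis A0 : (0 < A)%R.
Hypothesis mw : measurable_fun setT w.
Hypothesis w0 : forall x, (0 < w x)%R.
Local Notation sg := (fun x => w x `^ (- (p - 1)^-1))%R.
Hypothesis wA : forall Q, cubes Q ->
  avg Q (EFin \o w) * avg Q (EFin \o sg) `^ (p - 1) <= A%:E.
Let p10 : (0 < p - 1)%R. Proof. by rewrite subr_gt0. Qed.
Let p0 : (0 < p)%R. Proof. exact: lt_trans p1. Qed.

(** Enlarging the cell to a cube of side 2^-k multiplies the volume by at most 2^n, whence the
    factor (2^n)^p. *)
Lemma Ap_gcell e k x :
  (\int[mu]_(z in cell (gidx e k) x) (w z)%:E) *
  (\int[mu]_(z in cell (gidx e k) x) (sg z)%:E) `^ (p - 1) <=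
  (A * (2 ^+ n) `^ p)%:E * mu (cell (gidx e k) x) `^ p.
Proof.
have L0 : (0 < ((2 : R) ^ k)^-1)%R by rewrite invr_gt0 exp2z_gt0.
have [a [ca _]] := gidx_cell_cubes e k x.
have /andP[mc _] := leb_gcell e k x; move: mc L0 ca.
set L := (2 ^ k)^-1%R => mc L0 ca.
have Qc : cubes (cube a L : set E) by exists a, L.
have mL : (0 < L ^+ n)%R by rewrite exprn_gt0.
have sub (f : E -> R) : measurable_fun setT f -> (forall x, 0 < f x)%R ->
    \int[mu]_(z in cell (gidx e k) x) (f z)%:E <=
    \int[mu]_(z in cube a L) (f z)%:E.
  move=> mf f0.
  apply: (ge0_subset_integral _ (measurable_gcell e k x)
    (measurable_cube_Rn a L)); last exact: ca.
  - by apply: mfun_EFin; exact: measurable_funTS.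
  - by move=> z _; rewrite lee_fin ltW.
have ms : measurable_fun setT sg by mfun.
have i0 C (f : E -> R) : (forall x, 0 < f x)%R -> 0 <= \int[mu]_(z in C) (f z)%:E.
  by move=> f0; apply: int_ge0 => z _; exact: ltW.
have sg0 z : (0 < sg z)%R by exact: powR_gt0.
apply: (@le_trans _ _ ((\int[mu]_(z in cube a L) (w z)%:E) *
    (\int[mu]_(z in cube a L) (sg z)%:E) `^ (p - 1))).
  apply: lee_pmul; rewrite ?i0 ?poweR_ge0 ?sub//.
  by apply: lee_poweR; rewrite ?i0 ?sub// ltW.
rewrite !(int_avg _ Qc) leb_cube ?(ltW L0)//.
have av0 (f : E -> R) : (forall x, 0 < f x)%R -> 0 <= avg (cube a L : set E) (EFin \o f).
  by move=> f0; rewrite mule_ge0 ?i0// leb_cube ?(ltW L0)// inver gt_eqF// lee_fin invr_ge0 ltW.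
rewrite poweRM ?av0 ?lee_fin ?(ltW mL)// muleACA.
apply: (@le_trans _ _ (A%:E * ((L ^+ n)%:E * (L ^+ n)%:E `^ (p - 1)))).
  apply: lee_wpmul2r; last exact: wA.
  by rewrite mule_ge0 ?poweR_ge0// lee_fin ltW.
have -> : (L ^+ n)%:E * (L ^+ n)%:E `^ (p - 1) = ((L ^+ n) `^ p)%:E.
  by rewrite poweR_EFin -EFinM mulr_powRB1// ltW.
rewrite [(A * _)%:E]EFinM -muleA.
apply: lee_wpmul2l; first by rewrite lee_fin ltW.
rewrite -!poweR_EFin -poweRM ?lee_fin ?exprn_ge0//.
apply: lee_poweR; rewrite ?(ltW p0) ?lee_fin ?(ltW mL)//.
have -> : (L ^+ n = 2 ^+ n * (L / 2) ^+ n)%R.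
  by rewrite -exprMn mulrC divfK.
by rewrite EFinM lee_wpmul2l// lee_fin exprn_ge0.
Qed.

Lemma buckley_dyadic (h : E -> R) e K : measurable_fun setT h ->
  (forall x, 0 <= h x)%R -> \int[mu]_x (h x `^ p * w x)%:E < +oo ->
  \int[mu]_x (dyadic_max h e K x `^ p * w x)%:E <=
  ((A * (2 ^+ n) `^ p) `^ (p / (p - 1)) *
    (p `^ (p / (p - 1)) * (p / (p - 1)) `^ p))%:E *
  \int[mu]_x (h x `^ p * w x)%:E.
Proof.
move=> mh h0 hp; apply: (buckley_partition _ _ _ mw w0 p1) => //.
- by move=> k i; exact: measurable_gidx.
- by move=> k x z; exact: gidx_fin_nest.
- by move=> k x; exact: leb_gcell_fin.
- by rewrite mulr_gt0// powR_gt0// exprn_gt0.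
- by move=> k x; exact: Ap_gcell.
Qed.

Lemma gcell_int_fin (h : E -> R) e k x : measurable_fun setT h ->
  (forall x, 0 <= h x)%R -> \int[mu]_x (h x `^ p * w x)%:E < +oo ->
  \int[mu]_(z in cell (gidx e k) x) (h z)%:E \is a fin_num.
Proof.
move=> mh h0 hp.
have A'0 : (0 < A * (2 ^+ n) `^ p)%R by rewrite mulr_gt0// powR_gt0// exprn_gt0.
exact: (@buckley_int_fin _ _ _ mu _ (fun _ => gidx e k)
  (fun _ i => measurable_gidx e k i) (fun _ z => leb_gcell_fin e k z) w h p _
  mw w0 p1 A'0 (fun _ z => Ap_gcell e k z) mh h0 hp 0%N x).
Qed.

Lemma avg_le_dyadic (h : E -> R) (a : E) l : measurable_fun setT h ->
  (forall x, 0 <= h x)%R -> \int[mu]_x (h x `^ p * w x)%:E < +oo -> (0 < l)%R ->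
  exists e K, forall x, cube a l x ->
    avg (cube a l) (EFin \o h) <= (6 ^+ n * dyadic_max h e K x)%:E.
Proof.
move=> mh h0 hp l0; have [e [k [kl Qk]]] := cube_in_gcell a l0.
(* [K] is taken large enough for the scale k to lie in the window from -K to K. *)
have [K [k' [kK kE]]] : exists K k' : nat, (k' <= K.*2)%N /\ k = (k'%:Z - K%:Z)%R.
  case: (k) => j.
    exists j, j.*2; split => //; rewrite -addnn PoszD; ring.
  exists j.+1, 0%N; split => //; rewrite NegzE; ring.
exists e, K => x Qx; have {}Qk := Qk x Qx.
have wm : (wavg mu (fun=> 1%R) h (gidx e k) x <= dyadic_max h e K x)%R.
  have := @runmax_ge _ _ _ (fun k => wavg mu (fun=> 1%R) h (gidx_fin e K k))
    K.*2 k' x kK.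
  by rewrite /gidx_fin -kE.
apply: (@le_trans _ _ (6 ^+ n * wavg mu (fun=> 1%R) h (gidx e k) x)%:E); last first.
  by rewrite lee_fin ler_pM2l// exprn_gt0.
have hfin := gcell_int_fin e k x mh h0 hp.
have /andP[mc0 _] := leb_gcell_fin e k x.
have /andP[_ mcl] := leb_gcell e k x.
have hQ : \int[mu]_(z in cube a l) (h z)%:E <=
    \int[mu]_(z in cell (gidx e k) x) (h z)%:E.
  apply: (ge0_subset_integral _ (measurable_cube_Rn a l)
    (measurable_gcell e k x)); last exact: Qk.
  - by apply: mfun_EFin; exact: measurable_funTS.
  - by move=> z _; rewrite lee_fin.
rewrite wavg.unlock.
have -> : \int[mu]_(z in cell (gidx e k) x) (h z * 1)%:E =
    \int[mu]_(z in cell (gidx e k) x) (h z)%:E.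
  by apply: eq_integral => z _; rewrite mulr1.
have -> : \int[mu]_(z in cell (gidx e k) x) (1 : R)%:E = mu (cell (gidx e k) x).
  by rewrite integral_cst ?mul1e//; exact: measurable_gcell.
have ln0 : (0 < l ^+ n)%R by rewrite exprn_gt0.
have hQ0 : 0 <= \int[mu]_(z in cube a l) (h z)%:E by exact: int_ge0.
have L0 : (0 <= ((2 : R) ^ k)^-1)%R by rewrite invr_ge0 ltW// exp2z_gt0.
have {mcl} : mu (cell (gidx e k) x) <= ((6 ^+ n * l ^+ n)%R)%:E.
  by apply: (le_trans mcl); rewrite lee_fin -exprMn lerXn2r// nnegrE ltW// mulr_gt0.
rewrite /avg leb_cube ?(ltW l0)// inver gt_eqF// /comp.
move: hQ hQ0 hfin mc0.
case: (\int[mu]_(z in cube a l) (h z)%:E) => [F| |]//;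
  case: (\int[mu]_(z in cell _ x) (h z)%:E) => [F'| |]//.
case: (mu (cell _ x)) => [m| |]//.
rewrite -EFinM !lee_fin !lte_fin /= => FF F0 _ m0 ml.
rewrite ler_pdivrMr//.
have -> : (6 ^+ n * (F' / m) * l ^+ n = F' * (6 ^+ n * l ^+ n) / m)%R by ring.
rewrite ler_pdivlMr//.
by apply: ler_pM => //; exact: ltW.
Qed.

(** The origin of the factors: 6^n for the passage from a cube to a cell, the number of grids, 2^n
    for the A_p constant on cells, and p^q q^p with q = p/(p - 1) for the two Doob inequalities. *)
Definition maxop_const : R :=
  (((6 ^+ n) `^ p * (#|{: n.-tuple bool}|%:R * (((2 ^+ n) `^ p) `^ (p / (p - 1)) *
    (p `^ (p / (p - 1)) * (p / (p - 1)) `^ p)))) `^ p^-1)%R.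

(** [H] stands in for the maximal function. Its bound is asked on each cube almost everywhere, which
    avoids a supremum over uncountably many cubes. The grids are combined by adding the p-th powers
    of their maximal functions, and the scales are exhausted by a monotone limit. *)
Lemma maximal_majorant (h : E -> R) : measurable_fun setT h ->
  (forall x, 0 <= h x)%R -> \int[mu]_x (h x `^ p * w x)%:E < +oo ->
  exists H : E -> R, [/\ measurable_fun setT H, (forall x, 0 <= H x)%R,
    \int[mu]_x (H x `^ p * w x)%:E <=
      ((maxop_const * A `^ (p - 1)^-1) `^ p)%:E * \int[mu]_x (h x `^ p * w x)%:E &
    forall Q, cubes Q -> {ae mu, forall x, Q x -> avg Q (EFin \o h) <= (H x)%:E}].
Proof.
move=> mh h0 hp.
have w0' x : (0 <= w x)%R by exact: ltW.
set c := ((A * (2 ^+ n) `^ p) `^ (p / (p - 1)) *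
    (p `^ (p / (p - 1)) * (p / (p - 1)) `^ p))%R.
have c0 : (0 <= c)%R by rewrite !mulr_ge0 ?powR_ge0.
pose M := #|{: n.-tuple bool}|.
have hp0 : 0 <= \int[mu]_x (h x `^ p * w x)%:E.
  by apply: int_ge0 => x _; rewrite mulr_ge0 ?powR_ge0.
have [X X0 XE] := ge0_lty_EFin hp0 hp.
pose Z K x : R := (\sum_(e : n.-tuple bool) dyadic_max h e K x `^ p)%R.
have mZ K : measurable_fun setT (Z K).
  by apply: measurable_sum => e; apply: mfun_pow; exact: measurable_dyadic_max.
have Z0 K x : (0 <= Z K x)%R by apply: sumr_ge0 => e _; exact: powR_ge0.
have ndZ x : nondecreasing_seq (Z ^~ x).
  apply/nondecreasing_seqP => K; apply: ler_sum => e _.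
  by apply: ler_powRl; rewrite ?(ltW p0) ?dyadic_max_ge0// dyadic_max_nd.
have Zb K : \int[mu]_x (Z K x * w x)%:E <= (M%:R * (c * X))%:E.
  have -> : \int[mu]_x (Z K x * w x)%:E =
      \int[mu]_x (\sum_(e : n.-tuple bool) (dyadic_max h e K x `^ p * w x)%:E).
    by apply: eq_integral => x _; rewrite /Z sumEFin mulr_suml.
  have mZe e : measurable_fun setT (fun x => (dyadic_max h e K x `^ p * w x)%:E).
    exact: mfun_EFin (measurable_funM (mfun_pow p (measurable_dyadic_max h e K)) mw).
  have Ze0 e x : setT x -> 0 <= (dyadic_max h e K x `^ p * w x)%:E.
    by move=> _; rewrite lee_fin; apply: mulr_ge0 => //; exact: powR_ge0.
  rewrite (ge0_integral_sum mu measurableT mZe Ze0).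
  apply: (@le_trans _ _ (\sum_(e : n.-tuple bool) (c * X)%:E)); last first.
    by rewrite sumEFin lee_fin sumr_const -[leLHS]mulr_natl lexx.
  by apply: lee_sum => e _; rewrite EFinM -XE; exact: buckley_dyadic.
have [Y [mY Y0 Yb Ylim]] := ae_monotone_limit mZ Z0 ndZ mw w0 Zb.
exists (fun x => 6 ^+ n * Y x `^ p^-1)%R; split.
- exact: measurable_funM (@measurable_cst _ _ E R _ _) (mfun_pow p^-1 mY).
- by move=> x; apply: mulr_ge0; [exact: exprn_ge0|exact: powR_ge0].
- have eH x : ((6 ^+ n * Y x `^ p^-1) `^ p * w x =
      (6 ^+ n) `^ p * (Y x * w x))%R.
    rewrite powRM ?exprn_ge0 ?powR_ge0// -powRrM mulVf ?gt_eqF// powRr1//.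
    by rewrite mulrA.
  under eq_integral do rewrite eH.
  rewrite (int_scale mu measurableT (measurable_funM mY mw)) ?powR_ge0//; last first.
    by move=> x _; rewrite mulr_ge0.
  apply: (le_trans (lee_wpmul2l _ Yb)); first by rewrite lee_fin powR_ge0.
  rewrite XE -!EFinM lee_fin le_eqVlt; apply/orP; left; apply/eqP.
  rewrite powRM ?powR_ge0// /maxop_const -!powRrM mulVf ?gt_eqF// powRr1; last first.
    by rewrite !mulr_ge0 ?powR_ge0// ?divr_ge0 ?ltW.
  rewrite /c powRM ?powR_ge0 ?(ltW A0)// -powRrM (mulrC _^-1%R p) /M.
  by ring.
- move=> Q [a [l [l0 ->]]].
  have [e [K eK]] := avg_le_dyadic a mh h0 hp l0.
  move: Ylim; apply: filterS => x Yx Qx.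
  apply: (le_trans (eK x Qx)); rewrite lee_fin ler_pM2l ?exprn_gt0//.
  rewrite -[leLHS](@powR_conjK _ _ p) ?gt_eqF ?dyadic_max_ge0//.
  apply: ler_powRl; rewrite ?powR_ge0 ?invr_ge0 ?(ltW p0)//.
  have ZY : (Z K x <= Y x)%R.
    have := nondecreasing_cvgn_le (ndZ x) (cvgP _ Yx) K.
    by rewrite (cvg_lim _ Yx).
  apply: le_trans ZY; rewrite /Z (bigD1 e)//= lerDl.
  by apply: sumr_ge0 => ? _; exact: powR_ge0.
Qed.
End weighted.
End maximal.

(** * Rubio de Francia iteration *)

Section limits.
Context d (T : measurableType d) {R : realType} (mu : {measure set T -> \bar R}).

Lemma nondecreasing_cvg_powR (s : nat -> R) (l u : R) : (0 < u)%R ->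
  (forall k, 0 <= s k)%R -> nondecreasing_seq s -> s @ \oo --> l ->
  (fun k => s k `^ u)%R @ \oo --> (l `^ u)%R.
Proof.
move=> u0 s0 nds sl; have sle k : (s k <= l)%R.
  by have := nondecreasing_cvgn_le nds (cvgP _ sl) k; rewrite (cvg_lim _ sl).
have := le_trans (s0 0%N) (sle 0%N); rewrite le_eqVlt => /predU1P[l0|l0].
  have sz k : s k = 0%R by apply/le_anti/andP; split; [rewrite l0|].
  rewrite -l0 powR0 ?gt_eqF//; under eq_fun do rewrite sz powR0 ?gt_eqF//.
  exact: cvg_cst.
have e : (fun k => expR (u * ln (s k)))%R @ \oo --> expR (u * ln l).
  apply: continuous_cvg; first exact: continuous_expR.
  apply: cvgM; first exact: cvg_cst.
  by apply: continuous_cvg => //; exact: continuous_ln.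
have -> : (l `^ u = expR (u * ln l))%R by rewrite /powR gt_eqF.
apply: cvg_trans e; apply: near_eq_cvg.
have : \forall k \near \oo, (0 < s k)%R by exact: (cvgr_gt _ sl).
by apply: filterS => k sk; rewrite /powR gt_eqF.
Qed.

Lemma int_limit_le D (S : nat -> T -> R) (U : T -> R) (u : R) (c : \bar R) :
  (0 < u)%R -> measurable D -> (forall K, measurable_fun setT (S K)) ->
  (forall K x, 0 <= S K x)%R -> (forall x, nondecreasing_seq (S ^~ x)) ->
  measurable_fun setT U -> (forall x, 0 <= U x)%R ->
  {ae mu, forall x, S ^~ x @ \oo --> U x} ->
  (forall K, \int[mu]_(x in D) (S K x `^ u)%:E <= c) ->
  \int[mu]_(x in D) (U x `^ u)%:E <= c.
Proof.
move=> u0 mD mS S0 ndS mU U0 SU Sc.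
pose g K x := (S K x `^ u)%:E.
have mg K : measurable_fun D (g K).
  by apply: mfun_EFin; apply: measurable_funTS; exact: mfun_pow.
have g0 K x : D x -> 0 <= g K x by rewrite lee_fin powR_ge0.
have ndg x : D x -> nondecreasing_seq (g ^~ x).
  by move=> _ i j ij; rewrite lee_fin ler_powRl ?(ltW u0)// ndS.
have ndI : nondecreasing_seq (fun K => \int[mu]_(x in D) g K x).
  move=> i j ij; apply: ge0_le_integral => //; first by move=> x; exact: g0.
  by move=> x Dx; exact: ndg.
have lc : limn (fun K => \int[mu]_(x in D) g K x) <= c.
  by apply: lime_le; [exact: ereal_nondecreasing_is_cvgn|exact: nearW].
apply: le_trans lc; rewrite -(monotone_convergence mu mD mg g0 ndg).
have cvgg x : D x -> g ^~ x @ \oo --> limn (g ^~ x).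
  by move=> Dx; apply: ereal_nondecreasing_is_cvgn; exact: ndg.
apply: ae_ge0_le_integral => //.
- by move=> x _; rewrite lee_fin powR_ge0.
- by apply: mfun_EFin; apply: measurable_funTS; exact: mfun_pow.
- move=> x Dx; apply: lime_ge; first exact: cvgg.
  by apply: nearW => K; exact: g0.
- by apply: (emeasurable_fun_cvg g) => // x Dx; exact: cvgg.
move: SU; apply: filterS => x Sx Dx; rewrite le_eqVlt; apply/orP; left.
apply/eqP/esym/cvg_lim => //; apply: cvg_EFin; first exact: nearW.
exact: (nondecreasing_cvg_powR u0 (S0 ^~ x) (ndS x) Sx).
Qed.

(** The limit Y of the p-th powers supplies the integral bound and the almost everywhere bound
    Y^(1/p); [U] itself is the limit of [S], below that bound. *)
Lemma ae_monotone_limit_powR (S : nat -> T -> R) (w : T -> R) (p b : R) :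
  (0 < p)%R ->
  (forall K, measurable_fun setT (S K)) -> (forall K x, 0 <= S K x)%R ->
  (forall x, nondecreasing_seq (S ^~ x)) ->
  measurable_fun setT w -> (forall x, 0 < w x)%R ->
  (forall K, \int[mu]_x (S K x `^ p * w x)%:E <= b%:E) ->
  exists U : T -> R, [/\ measurable_fun setT U, (forall x, 0 <= U x)%R,
    \int[mu]_x (U x `^ p * w x)%:E <= b%:E &
    {ae mu, forall x, S ^~ x @ \oo --> U x}].
Proof.
move=> p0 mS S0 ndS mw w0 Sb.
have mZ K : measurable_fun setT (fun x => S K x `^ p)%R by exact: mfun_pow.
have Z0 K x : (0 <= S K x `^ p)%R by exact: powR_ge0.
have ndZ x : nondecreasing_seq (fun K => S K x `^ p)%R.
  by move=> i j ij; rewrite ler_powRl ?(ltW p0)// ndS.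
have [Y [mY Y0 Yb Ylim]] := ae_monotone_limit mZ Z0 ndZ mw w0 Sb.
have SY : {ae mu, forall x, forall K, (S K x <= Y x `^ p^-1)%R}.
  move: Ylim; apply: filterS => x Yx K.
  rewrite -[leLHS](@powR_conjK _ _ p) ?gt_eqF//.
  apply: ler_powRl; rewrite ?powR_ge0 ?invr_ge0 ?(ltW p0)//.
  by have := nondecreasing_cvgn_le (ndZ x) (cvgP _ Yx) K; rewrite (cvg_lim _ Yx).
pose L x := limn (fun K => (S K x)%:E).
have cvgL x : (fun K => (S K x)%:E) @ \oo --> L x.
  apply: ereal_nondecreasing_is_cvgn => i j ij; rewrite lee_fin; exact: ndS.
have mL : measurable_fun setT L.
  have mSE K : measurable_fun setT (fun x => (S K x)%:E) by exact: mfun_EFin.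
  apply: (emeasurable_fun_cvg (fun K x => (S K x)%:E)) => [|x _].
    exact: mSE.
  exact: cvgL.
have L0 x : 0 <= L x.
  by apply: lime_ge; [exact: cvgL|apply: nearW => K; rewrite lee_fin].
have LY x : (forall K, (S K x <= Y x `^ p^-1)%R) -> L x <= (Y x `^ p^-1)%:E.
  move=> h; apply: lime_le; first exact: cvgL.
  by apply: nearW => K; rewrite lee_fin.
have LYf x : (forall K, (S K x <= Y x `^ p^-1)%R) -> L x \is a fin_num.
  by move=> h; rewrite ge0_fin_numE// (le_lt_trans (LY x h))// ltry.
have mU : measurable_fun setT (fun x => fine (L x)) by exact: measurableT_comp.
have U0 x : (0 <= fine (L x))%R by exact: fine_ge0.
exists (fun x => fine (L x)); split => //.
- apply: le_trans Yb; apply: ae_ge0_le_integral => //.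
  + by move=> x _; rewrite lee_fin mulr_ge0 ?powR_ge0// ltW.
  + by apply: mfun_EFin; apply: measurable_funM => //; exact: mfun_pow.
  + by move=> x _; rewrite lee_fin mulr_ge0// ltW.
  + by apply: mfun_EFin; exact: measurable_funM.
  move: SY; apply: filterS => x Sx _; rewrite lee_fin ler_pM2r//.
  have := LY x Sx; rewrite -(fineK (LYf x Sx)) lee_fin => h.
  have := ler_powRl (ltW p0) (U0 x) h.
  by rewrite -powRrM mulVf ?gt_eqF// powRr1.
- move: SY; apply: filterS => x Sx.
  have h : (fun K => (S K x)%:E) @ \oo --> (fine (L x))%:E.
    by rewrite fineK ?LYf//; exact: cvgL.
  exact: (fine_cvg h).
Qed.

End limits.

Section weighted_norm.
Context d (T : measurableType d) {R : realType} (mu : {measure set T -> \bar R}).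
Variables (D : set T) (w : T -> R) (p : R).
Hypothesis mD : measurable D.
Hypothesis mw : measurable_fun setT w.
Hypothesis w0 : forall x, (0 <= w x)%R.
Hypothesis p1 : (1 <= p)%R.
Implicit Types f g : T -> R.

Definition wnorm f := (\int[mu]_(x in D) (f x `^ p * w x)%:E) `^ p^-1.

Let p0 : (0 < p)%R. Proof. exact: lt_le_trans p1. Qed.

Lemma wnormZ (c : R) f : (0 <= c)%R -> measurable_fun setT f ->
  (forall x, 0 <= f x)%R -> wnorm (fun x => c * f x)%R = c%:E * wnorm f.
Proof.
move=> c0 mf f0; rewrite /wnorm.
have -> : \int[mu]_(x in D) ((c * f x) `^ p * w x)%:E =
    \int[mu]_(x in D) (c `^ p * (f x `^ p * w x))%:E.
  by apply: eq_integral => x _; rewrite powRM// mulrA.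
have fw0 x : D x -> (0 <= f x `^ p * w x)%R by rewrite mulr_ge0 ?powR_ge0.
rewrite (int_scale mu mD (measurable_funM (mfun_pow p mf) mw) fw0) ?powR_ge0//.
rewrite poweRM ?lee_fin ?powR_ge0 ?int_ge0// poweR_EFin -powRrM.
by rewrite mulfV ?gt_eqF// powRr1.
Qed.

(** Absorbing the weight and the domain into the function makes Minkowski's inequality for [Lnorm]
    available. *)
Let wnormE f : (forall x, 0 <= f x)%R ->
  wnorm f = 'N[mu]_p%:E[EFin \o (fun x => f x * w x `^ p^-1 * \1_D x)%R].
Proof.
move=> f0; rewrite unlock /wnorm; congr (_ `^ _).
rewrite integral_mkcond; apply: eq_integral => x _ /=.
rewrite patchE indicE; have i0 b : (0 <= f x * w x `^ p^-1 * b%:R)%R.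
  by rewrite !mulr_ge0 ?powR_ge0.
rewrite ger0_norm//; case: ifPn => _; rewrite ?mulr1 ?mulr0 ?powR0 ?gt_eqF//.
by rewrite powRM ?powR_ge0// -powRrM mulVf ?gt_eqF// powRr1.
Qed.

Lemma wnormD f g : measurable_fun setT f -> measurable_fun setT g ->
  (forall x, 0 <= f x)%R -> (forall x, 0 <= g x)%R ->
  wnorm (fun x => f x + g x)%R <= wnorm f + wnorm g.
Proof.
move=> mf mg f0 g0; rewrite !wnormE//; last by move=> x; rewrite addr_ge0.
have m1 (h : T -> R) : measurable_fun setT h ->
    measurable_fun setT (fun x => h x * w x `^ p^-1 * \1_D x)%R.
  by move=> mh; apply: measurable_funM; [mfun|exact: measurable_indic].
apply: le_trans (minkowski_EFin mu (m1 _ mf) (m1 _ mg) p1).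
rewrite le_eqVlt; apply/orP; left; apply/eqP; apply: eq_Lnorm => x /=.
by rewrite !mulrDl.
Qed.

Lemma wnorm_sum (f : nat -> T -> R) (b : nat -> \bar R) N :
  (forall k, measurable_fun setT (f k)) -> (forall k x, 0 <= f k x)%R ->
  (forall k, wnorm (f k) <= b k) ->
  wnorm (fun x => \sum_(k < N.+1) f k x)%R <= \sum_(k < N.+1) b k.
Proof.
move=> mf f0 fb; elim: N => [|N IH].
  rewrite big_ord1 /= (_ : (fun x => _) = f 0%N) ?fb//.
  by apply/funext => x; rewrite big_ord1.
rewrite big_ord_recr /=.
have -> : (fun x => \sum_(k < N.+2) f k x)%R =
    (fun x => \sum_(k < N.+1) f k x + f N.+1 x)%R.
  by apply/funext => x; rewrite big_ord_recr.
apply: (le_trans (wnormD _ (mf _) _ (f0 _))).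
- exact: measurable_sum.
- by move=> x; exact: sumr_ge0.
- exact: leeD.
Qed.

End weighted_norm.

Section rubio_de_francia.
Context d (T : measurableType d) {R : realType} (mu : {measure set T -> \bar R}).
Variables (QQ : set (set T)) (w : T -> R) (p : R).
Hypothesis mQQ : forall Q, QQ Q -> measurable Q.
Hypothesis QQfin : forall Q, QQ Q -> exists2 m : R, (0 < m)%R & mu Q = m%:E.
Hypothesis mw : measurable_fun setT w.
Hypothesis w0 : forall x, (0 < w x)%R.
Hypothesis p1 : (1 <= p)%R.

(** For [v] and [c] equal to 1, [H] dominates M h; in general c H dominates M(h^v)^(1/v), cube by
    cube and almost everywhere. With [H] equal to [h] this is an A_1 condition on h^v. *)
Definition majorizes (v c : R) (h H : T -> R) := forall Q, QQ Q ->
  {ae mu, forall x, Q x ->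
    \int[mu]_(z in Q) (h z `^ v)%:E <= ((c * H x) `^ v)%:E * mu Q}.

Definition admissible (h : T -> R) := [/\ measurable_fun setT h,
  (forall x, 0 <= h x)%R & \int[mu]_x (h x `^ p * w x)%:E < +oo].

Let p0 : (0 < p)%R. Proof. exact: lt_le_trans p1. Qed.

Section iteration.
Variables (K : R) (h : nat -> T -> R).
Hypothesis K0 : (0 < K)%R.
Hypothesis ah : forall k, admissible (h k).
Hypothesis hK : forall k, \int[mu]_x (h k.+1 x `^ p * w x)%:E <=
  (K `^ p)%:E * \int[mu]_x (h k x `^ p * w x)%:E.

Let t k x : R := ((2 * K) ^- k * h k x)%R.
Let S N x : R := (\sum_(k < N.+1) t k x)%R.
Let K2 : (0 < 2 * K)%R. Proof. by rewrite mulr_gt0. Qed.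
Let w0' x : (0 <= w x)%R. Proof. exact: ltW. Qed.
Let mh k : measurable_fun setT (h k). Proof. by have [] := ah k. Qed.
Let h0 k x : (0 <= h k x)%R. Proof. by have [] := ah k. Qed.
Let t0 k x : (0 <= t k x)%R.
Proof. by rewrite mulr_ge0// invr_ge0 exprn_ge0// ltW. Qed.
Let mt k : measurable_fun setT (t k). Proof. by rewrite /t; mfun; exact: mh. Qed.
Let S0 N x : (0 <= S N x)%R. Proof. exact: sumr_ge0. Qed.
Let mS N : measurable_fun setT (S N). Proof. exact: measurable_sum. Qed.
Let ndS x : nondecreasing_seq (S ^~ x).
Proof. by apply/nondecreasing_seqP => N; rewrite /S [leRHS]big_ord_recr lerDl. Qed.

Local Notation nw := (wnorm mu setT w p).

Let nw_iter k : nw (h k) <= (K ^+ k)%:E * nw (h 0%N).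
Proof.
elim: k => [|k IH]; first by rewrite expr0 mul1e.
have : nw (h k.+1) <= K%:E * nw (h k).
  rewrite /wnorm; apply: (le_trans (lee_poweR _ _ (hK k))).
  - by rewrite invr_ge0 ltW.
  - by apply: int_ge0 => x _; rewrite mulr_ge0 ?powR_ge0.
  have I0 : 0 <= \int[mu]_x (h k x `^ p * w x)%:E.
    by apply: int_ge0 => x _; rewrite mulr_ge0 ?powR_ge0.
  have pn0 : p != 0%R by rewrite gt_eqF.
  by have -> := poweR_powRM (ltW K0) I0 pn0; exact: lexx.
move=> /le_trans; apply; rewrite exprS EFinM -muleA.
by apply: lee_wpmul2l => //; rewrite lee_fin ltW.
Qed.

Let geo N (c : R) : (0 <= c)%R ->
  (\sum_(k < N.+1) 2 ^- k * c <= 2 * c)%R.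
Proof.
move=> c0; rewrite -mulr_suml ler_wpM2r//.
suff -> : (\sum_(k < N.+1) 2 ^- k = 2 - 2 ^- N :> R)%R.
  by rewrite lerBlDr lerDl invr_ge0 exprn_ge0.
elim: N => [|N IH]; first by rewrite big_ord1 expr0 invr1; lra.
rewrite big_ord_recr /= IH exprS invfM.
have -> : ((2 : R) ^- N = 2 * (2^-1 * 2 ^- N))%R by rewrite mulrA mulfV ?mul1r.
by rewrite mulrA mulfV ?mul1r//; lra.
Qed.

Let S_bound N : \int[mu]_x (S N x `^ p * w x)%:E <=
  (2 `^ p)%:E * \int[mu]_x (h 0%N x `^ p * w x)%:E.
Proof.
have [_ _ hf] := ah 0%N.
have I0 (f : T -> R) : 0 <= \int[mu]_x (f x `^ p * w x)%:E.
  by apply: int_ge0 => x _; rewrite mulr_ge0 ?powR_ge0.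
have [J J0 JE] := ge0_lty_EFin (I0 (h 0%N)) hf.
pose c := (J `^ p^-1)%R.
have c0 : (0 <= c)%R by exact: powR_ge0.
have cE : nw (h 0%N) = c%:E by rewrite /wnorm JE.
have tb k : nw (t k) <= (2 ^- k * c)%:E.
  rewrite /t (wnormZ _ measurableT mw w0' p1)//; last first.
    by rewrite invr_ge0 exprn_ge0// ltW.
  apply: (le_trans (lee_wpmul2l _ (nw_iter k))).
    by rewrite lee_fin invr_ge0 exprn_ge0// ltW.
  rewrite cE -!EFinM lee_fin mulrA ler_wpM2r// exprMn invfM -mulrA mulVf ?mulr1//.
  by rewrite expf_neq0// gt_eqF.
have := wnorm_sum measurableT mw w0' p1 N mt t0 tb.
rewrite sumEFin -/(S N) => /le_trans /(_ (_ : _ <= (2 * c)%:E)).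
rewrite lee_fin => /(_ (geo N c0)).
move=> /(poweR_inv_le p0 (I0 _)) => /le_trans; apply.
by rewrite JE -EFinM lee_fin powRM// -powRrM mulVf ?gt_eqF// powRr1.
Qed.

(** U is the sum of (2K)^-k h_k. The bounds for the norms of the terms halve, whence the factor 2.
    Minkowski's inequality in L^v(Q) bounds the averages term by term, and passing from h_k to
    h_(k+1) shifts the series by one index at the cost of 2K. *)
Lemma neumann_series : exists U : T -> R, [/\ measurable_fun setT U,
  (forall x, 0 <= U x)%R,
  \int[mu]_x (U x `^ p * w x)%:E <=
    (2 `^ p)%:E * \int[mu]_x (h 0%N x `^ p * w x)%:E,
  {ae mu, forall x, (h 0%N x <= U x)%R} &
  forall v c, (1 <= v)%R -> (0 <= c)%R ->
    (forall k, majorizes v c (h k) (h k.+1)) ->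
    majorizes v (2 * K * c)%R U U].
Proof.
have [_ _ hf] := ah 0%N.
have I0 : 0 <= \int[mu]_x (h 0%N x `^ p * w x)%:E.
  by apply: int_ge0 => x _; rewrite mulr_ge0 ?powR_ge0.
have bE : (2 `^ p)%:E * \int[mu]_x (h 0%N x `^ p * w x)%:E =
    (2 `^ p * fine (\int[mu]_x (h 0%N x `^ p * w x)%:E))%:E.
  by rewrite EFinM fineK// ge0_fin_numE.
have Sb N := S_bound N; rewrite bE in Sb.
have [U [mU U0 Ub SU]] := ae_monotone_limit_powR p0 mS S0 ndS mw w0 Sb.
have SleU : {ae mu, forall x, forall N, (S N x <= U x)%R}.
  move: SU; apply: filterS => x Sx N.
  by have := nondecreasing_cvgn_le (ndS x) (cvgP _ Sx) N; rewrite (cvg_lim _ Sx).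
exists U; split => //.
- by rewrite bE.
- move: SleU; apply: filterS => x /(_ 0%N).
  by rewrite /S big_ord1 /t expr0 invr1 mul1r.
move=> v c v1 c0 maj Q QQ_Q.
have mQ := mQQ QQ_Q; have [m m0 mE] := QQfin QQ_Q.
have v0 : (0 < v)%R by exact: lt_le_trans v1.
have : {ae mu, forall x, forall k, Q x ->
    \int[mu]_(z in Q) (h k z `^ v)%:E <= ((c * h k.+1 x) `^ v)%:E * mu Q}.
  by apply: ae_foralln => k; exact: maj.
move=> majx; move: majx SleU; apply: filterS2 => x hx Sx Qx.
apply: (int_limit_le v0 mQ mS S0 ndS mU U0 SU) => N.
have m1 : measurable_fun setT (fun _ : T => 1%R : R) by exact: measurable_cst.
have le01 (z : T) : (0 <= 1 :> R)%R by [].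
pose b k := (t k.+1 x * (2 * K * c * m `^ v^-1))%:E.
have tb k : wnorm mu Q (fun=> 1%R) v (t k) <= b k.
  rewrite /t (wnormZ _ mQ m1 le01 v1)//; last by rewrite invr_ge0 exprn_ge0// ltW.
  have : wnorm mu Q (fun=> 1%R) v (h k) <= (c * h k.+1 x * m `^ v^-1)%:E.
    rewrite /wnorm.
    have -> : \int[mu]_(z in Q) (h k z `^ v * 1)%:E = \int[mu]_(z in Q) (h k z `^ v)%:E.
      by apply: eq_integral => z _; rewrite mulr1.
    apply: (le_trans (lee_poweR _ _ (hx k Qx))).
    - by rewrite invr_ge0 ltW.
    - by apply: int_ge0 => z _; exact: powR_ge0.
    have ch0 : (0 <= c * h k.+1 x)%R by rewrite mulr_ge0.
    have m0' : 0 <= m%:E by rewrite lee_fin ltW.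
    have vn0 : v != 0%R by rewrite gt_eqF.
    by rewrite mE (poweR_powRM ch0 m0' vn0) poweR_EFin -EFinM lexx.
  move=> /(lee_wpmul2l (_ : 0 <= ((2 * K) ^- k)%:E)) h'.
  apply: (le_trans (h' _)); first by rewrite lee_fin invr_ge0 exprn_ge0// ltW.
  rewrite -EFinM lee_fin le_eqVlt; apply/orP; left; apply/eqP.
  rewrite /t exprS; field; rewrite expf_neq0 ?gt_eqF//.
have := wnorm_sum mQ m1 le01 v1 N mt t0 tb.
rewrite sumEFin -/(S N) -mulr_suml => hS.
have {}hS : wnorm mu Q (fun=> 1%R) v (S N) <= (2 * K * c * U x * m `^ v^-1)%:E.
  apply: (le_trans hS); rewrite lee_fin.
  have -> : (2 * K * c * U x * m `^ v^-1 = U x * (2 * K * c * m `^ v^-1))%R by ring.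
  rewrite ler_wpM2r//; first by rewrite !mulr_ge0 ?powR_ge0// ltW.
  (* The shifted sum is [S N.+1] without its term of index 0. *)
  apply: le_trans (Sx N.+1); rewrite /S [leRHS]big_ord_recl lerDr.
  exact: t0.
move: hS; rewrite /wnorm.
have -> : \int[mu]_(z in Q) (S N z `^ v * 1)%:E = \int[mu]_(z in Q) (S N z `^ v)%:E.
  by apply: eq_integral => z _; rewrite mulr1.
have S0' : 0 <= \int[mu]_(z in Q) (S N z `^ v)%:E.
  by apply: int_ge0 => z _; exact: powR_ge0.
move=> /(poweR_inv_le v0 S0') => /le_trans; apply.
rewrite powRM ?powR_ge0//; last by rewrite !mulr_ge0// ltW.
by rewrite -(powRrM m) mulVf ?gt_eqF// powRr1 ?(ltW m0)// mE -EFinM lexx.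
Qed.
End iteration.

(** The iterated operator is a choice of a majorant for each admissible function; sublinearity
    enters only through Minkowski's inequality for averages. Both majorizations pass to the same
    series. *)
Lemma rubio_de_francia (K v c : R) : (0 < K)%R -> (1 <= v)%R -> (0 <= c)%R ->
  (forall h, admissible h -> exists H : T -> R, [/\ measurable_fun setT H,
    (forall x, 0 <= H x)%R,
    \int[mu]_x (H x `^ p * w x)%:E <=
      (K `^ p)%:E * \int[mu]_x (h x `^ p * w x)%:E,
    majorizes 1 1 h H & majorizes v c h H]) ->
  forall h, admissible h -> exists U : T -> R, [/\ measurable_fun setT U,
    (forall x, 0 <= U x)%R,
    \int[mu]_x (U x `^ p * w x)%:E <=
      (2 `^ p)%:E * \int[mu]_x (h x `^ p * w x)%:E,
    {ae mu, forall x, (h x <= U x)%R} &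
    majorizes 1 (2 * K) U U /\ majorizes v (2 * K * c) U U].
Proof.
move=> K0 v1 c0 step h ah.
have /choice[op opP] : forall g : T -> R, exists H : T -> R, admissible g ->
    [/\ measurable_fun setT H, (forall x, 0 <= H x)%R,
    \int[mu]_x (H x `^ p * w x)%:E <=
      (K `^ p)%:E * \int[mu]_x (g x `^ p * w x)%:E,
    majorizes 1 1 g H & majorizes v c g H].
  move=> g; have [ag|nag] := pselect (admissible g).
    by have [H HP] := step g ag; exists H.
  by exists g.
pose hk k := iter k op h.
have ahk k : admissible (hk k).
  elim: k => [//|k IH]; have [m0 H0 HI _ _] := opP _ IH; split => //=.
  apply: (le_lt_trans HI); have [_ _ If] := IH.
  by rewrite lte_mul_pinfty ?lee_fin ?powR_ge0.
have hkK k : \int[mu]_x (hk k.+1 x `^ p * w x)%:E <=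
    (K `^ p)%:E * \int[mu]_x (hk k x `^ p * w x)%:E.
  by have [] := opP _ (ahk k).
have [U [mU U0 UI hU majU]] := neumann_series K0 ahk hkK.
exists U; split => //; split; last first.
  by apply: majU => // k; have [] := opP _ (ahk k).
by rewrite -[(2 * K)%R]mulr1; apply: majU => // k; have [] := opP _ (ahk k).
Qed.

End rubio_de_francia.

Section rdf_Rn.
Context {R : realType} (n : nat).
Local Notation E := (Rn R n).
Local Notation mu := (@leb R n).

Lemma maxop_const_gt0 (p : R) : (1 < p)%R -> (0 < maxop_const n p)%R.
Proof.
move=> p1; have p0 := lt_trans ltr01 p1.
have q0 : (0 < p / (p - 1))%R by rewrite divr_gt0// subr_gt0.
rewrite /maxop_const powR_gt0// !mulr_gt0 ?powR_gt0 ?exprn_gt0//.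
by rewrite ltr0n card_tuple expn_gt0 card_bool.
Qed.

(** Half the side is N + 1, so that N = 0 already gives a cube of positive side. *)
Definition centered_cube (N : nat) : set E :=
  cube ([tuple (- N.+1%:R)%R | i < n] : n.-tuple (measurableTypeR R)) (2 * N.+1%:R)%R.

Lemma cubes_centered N : cubes (centered_cube N).
Proof.
exists ([tuple (- N.+1%:R)%R | i < n] : n.-tuple (measurableTypeR R)).
by exists (2 * N.+1%:R)%R; rewrite mulr_gt0.
Qed.

Lemma centered_cubeP N (x : E) :
  centered_cube N x <-> forall i, (`|tnth x i| <= N.+1%:R)%R.
Proof.
split=> h i; have := h i; rewrite tnth_mktuple ler_norml => /andP[-> h2] /=;
  by move: h2; lra.
Qed.

Lemma centered_cube_nd N M : (N <= M)%N -> centered_cube N `<=` centered_cube M.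
Proof.
move=> NM x /centered_cubeP h; apply/centered_cubeP => i.
by apply: (le_trans (h i)); rewrite ler_nat.
Qed.

Lemma centered_cube_cover (x : E) : exists N, centered_cube N x.
Proof.
pose s : R := (\sum_(i < n) `|tnth x i|)%R.
exists (Num.truncn s); apply/centered_cubeP => i.
apply: (@le_trans _ _ s); last by exact/ltW/truncnS_gt.
by rewrite /s (bigD1 i)//= lerDl sumr_ge0.
Qed.

Lemma int_le_avg (Q : set E) (f : E -> \bar R) (c : R) : cubes Q ->
  (\int[mu]_(x in Q) f x <= c%:E * mu Q) = (avg Q f <= c%:E).
Proof.
move=> Qc; rewrite (int_avg _ Qc); have [m m0 ->] := leb_cube_fin Qc.
by rewrite lee_pmul2r// lte_fin.
Qed.

Section step.
Variables (p A u A' : R) (w : E -> R).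
Hypothesis p1 : (1 < p)%R.
Hypothesis A0 : (0 < A)%R.
Hypothesis u1 : (1 <= u)%R.
Hypothesis pu1 : (1 < p / u)%R.
Hypothesis A'0 : (0 < A')%R.
Hypothesis mw : measurable_fun setT w.
Hypothesis w0 : forall x, (0 < w x)%R.
Hypothesis wA : forall Q, cubes Q ->
  avg Q (EFin \o w) *
  avg Q (EFin \o (fun x => w x `^ (- (p - 1)^-1))%R) `^ (p - 1) <= A%:E.
Hypothesis wA' : forall Q, cubes Q ->
  avg Q (EFin \o w) *
  avg Q (EFin \o (fun x => w x `^ (- (p / u - 1)^-1))%R) `^ (p / u - 1) <= A'%:E.

Let p0 : (0 < p)%R. Proof. exact: lt_trans p1. Qed.
Let pn0 : p != 0%R. Proof. by rewrite gt_eqF. Qed.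
Let u0 : (0 < u)%R. Proof. exact: lt_le_trans u1. Qed.
Let un0 : u != 0%R. Proof. by rewrite gt_eqF. Qed.
Let w0' x : (0 <= w x)%R. Proof. exact: ltW. Qed.
Let K1 := (maxop_const n p * A `^ (p - 1)^-1)%R.
Let K2 := (maxop_const n (p / u) * A' `^ (p / u - 1)^-1)%R.
Let K10 : (0 < K1)%R.
Proof. by apply: mulr_gt0; [exact: maxop_const_gt0|exact: powR_gt0]. Qed.
Let K20 : (0 < K2)%R.
Proof. by apply: mulr_gt0; [exact: maxop_const_gt0|exact: powR_gt0]. Qed.
(* The weight of h |-> M(h^u)^(1/u) in the iterated operator: it makes its norm
   that of M, so that A' does not enter the A_1 bound of the majorant. *)
Let eps := (K1 / K2 `^ u^-1)%R.
Let eps0 : (0 < eps)%R. Proof. by apply: divr_gt0 => //; exact: powR_gt0. Qed.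

(** [H] is a majorant of M h plus eps times one of M(h^u)^(1/u). The second operator is bounded on
    L^p(w) with the (1/u)-th power of the norm of M on L^(p/u)(w), which is why the A_(p/u) bound
    [wA'] is assumed. *)
Let rdf_step (h : E -> R) : admissible mu w p h -> exists H : E -> R,
  [/\ measurable_fun setT H, (forall x, 0 <= H x)%R,
    \int[mu]_x (H x `^ p * w x)%:E <=
      ((2 * K1) `^ p)%:E * \int[mu]_x (h x `^ p * w x)%:E,
    majorizes mu (@cubes R n) 1 1 h H & majorizes mu (@cubes R n) u eps^-1 h H].
Proof.
move=> [mh h0 hf].
have [H1 [mH1 H10 H1b H1m]] := maximal_majorant p1 A0 mw w0 wA mh h0 hf.
have hu x : ((h x `^ u) `^ (p / u) = h x `^ p)%R.
  by rewrite -powRrM mulrCA mulfV// mulr1.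
have huf : \int[mu]_x ((h x `^ u) `^ (p / u) * w x)%:E < +oo.
  by under eq_integral do rewrite hu.
have [G [mG G0 Gb Gm]] := maximal_majorant pu1 A'0 mw w0 wA' (mfun_pow u mh)
  (fun x => powR_ge0 _ _) huf.
pose H2 x := (G x `^ u^-1)%R.
have mH2 : measurable_fun setT H2 by exact: mfun_pow.
have H20 x : (0 <= H2 x)%R by exact: powR_ge0.
have meH2 : measurable_fun setT (fun x => eps * H2 x)%R.
  exact: measurable_funM (@measurable_cst _ _ E R _ _) mH2.
have eH20 x : (0 <= eps * H2 x)%R by rewrite mulr_ge0// ltW.
have I0 (f : E -> R) : 0 <= \int[mu]_x (f x `^ p * w x)%:E.
  by apply: int_ge0 => x _; rewrite mulr_ge0 ?powR_ge0.
have [J J0 JE] := ge0_lty_EFin (I0 h) hf.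
have J0' : 0 <= J%:E by rewrite lee_fin.
have n1 : wnorm mu setT w p H1 <= (K1 * J `^ p^-1)%:E.
  have := lee_poweR (_ : (0 <= p^-1)%R) (I0 H1) H1b.
  rewrite invr_ge0 (ltW p0) => /(_ isT) /le_trans; apply.
  rewrite JE; have -> := poweR_powRM (ltW K10) J0' pn0.
  by rewrite poweR_EFin -EFinM lexx.
have n2 : wnorm mu setT w p (fun x => eps * H2 x)%R <= (K1 * J `^ p^-1)%:E.
  rewrite (wnormZ mu measurableT mw w0' (ltW p1) (ltW eps0) mH2 H20).
  have -> : (K1 * J `^ p^-1)%:E = eps%:E * (K2 `^ u^-1 * J `^ p^-1)%:E.
    by rewrite -EFinM mulrA /eps divfK// gt_eqF// powR_gt0.
  apply: lee_wpmul2l; first by rewrite lee_fin ltW.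
  have H2p x : (H2 x `^ p = G x `^ (p / u))%R by rewrite -powRrM (mulrC u^-1%R).
  have Gb' : \int[mu]_x (H2 x `^ p * w x)%:E <=
      ((K2 `^ u^-1) `^ p)%:E * \int[mu]_x (h x `^ p * w x)%:E.
    have eL : \int[mu]_x (H2 x `^ p * w x)%:E = \int[mu]_x (G x `^ (p / u) * w x)%:E.
      by apply: eq_integral => x _; rewrite H2p.
    have eR : \int[mu]_x ((h x `^ u) `^ (p / u) * w x)%:E =
        \int[mu]_x (h x `^ p * w x)%:E.
      by apply: eq_integral => x _; rewrite hu.
    by rewrite eL -eR -powRrM (mulrC u^-1%R).
  have := lee_poweR (_ : (0 <= p^-1)%R) (I0 H2) Gb'.
  rewrite invr_ge0 (ltW p0) => /(_ isT) /le_trans; apply.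
  rewrite JE; have -> := poweR_powRM (powR_ge0 K2 u^-1) J0' pn0.
  by rewrite poweR_EFin -EFinM lexx.
exists (fun x => H1 x + eps * H2 x)%R; split.
- exact: measurable_funD mH1 meH2.
- by move=> x; exact: addr_ge0.
- have := le_trans (wnormD mu measurableT mw w0' (ltW p1) mH1 meH2 H10 eH20)
    (leeD n1 n2).
  rewrite -EFinD => /(poweR_inv_le p0 (I0 _)) /le_trans; apply.
  have -> : (K1 * J `^ p^-1 + K1 * J `^ p^-1 = 2 * K1 * J `^ p^-1)%R by ring.
  have K1'0 : (0 <= 2 * K1)%R by apply: mulr_ge0 => //; exact: ltW.
  rewrite JE (powRM _ K1'0 (powR_ge0 _ _)).
  by rewrite -(powRrM J) mulVf// powRr1// -EFinM lexx.
- move=> Q Qc; move: (H1m Q Qc); apply: filterS => x hx Qx.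
  rewrite int_le_avg//; have {}hx := hx Qx.
  have -> : (fun z => (h z `^ 1)%:E) = EFin \o h.
    by apply/funext => z /=; rewrite powRr1.
  apply: (le_trans hx); rewrite lee_fin mul1r powRr1 ?lerDl//.
  by rewrite addr_ge0.
- move=> Q Qc; move: (Gm Q Qc); apply: filterS => x hx Qx.
  rewrite int_le_avg//; apply: (le_trans (hx Qx)); rewrite lee_fin.
  rewrite -[leLHS](@powR_conjK _ _ u^-1) ?invr_eq0// invrK -/(H2 x).
  apply: ler_powRl; rewrite ?(ltW u0)//.
  by rewrite mulrDr mulrA mulVf ?gt_eqF// mul1r lerDr mulr_ge0// invr_ge0 ltW.
Qed.

Let B := (2 * (2 * K1) * eps^-1)%R.

(** If U has integral 0 over all centered cubes, it vanishes almost everywhere and so does h, which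
    is excluded. Otherwise the A_1 bound on a large centered cube through x keeps U(x) away from
    0. *)
Lemma rdf_positive (U h : E -> R) (c : R) : measurable_fun setT U ->
  (forall x, 0 <= U x)%R -> (forall x, 0 <= h x)%R ->
  {ae mu, forall x, (h x <= U x)%R} -> measurable_fun setT h ->
  0 < \int[mu]_x (h x `^ p * w x)%:E ->
  (forall Q, cubes Q -> {ae mu, forall x, Q x -> avg Q (EFin \o U) <= (c * U x)%:E}) ->
  {ae mu, forall x, (0 < U x)%R}.
Proof.
move=> mU U0 h0 hU mh hp UA.
have mUE : measurable_fun setT (EFin \o U) by exact: mfun_EFin.
have [N IN] : exists N, 0 < \int[mu]_(x in centered_cube N) (U x)%:E.
  apply: contrapT => nN; move: hp; rewrite lt_neqAle => /andP[+ _].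
  apply/negP; rewrite negbK; apply/eqP/esym.
  have Uz N : {ae mu, forall x, centered_cube N x -> U x = 0%R}.
    have mC := measurable_cubes (cubes_centered N).
    have IU : \int[mu]_(x in centered_cube N) `|(U x)%:E| = 0.
      have -> : \int[mu]_(x in centered_cube N) `|(U x)%:E| =
          \int[mu]_(x in centered_cube N) (U x)%:E.
        by apply: eq_integral => x _; rewrite gee0_abs ?lee_fin.
      apply/eqP; rewrite eq_le int_ge0 ?andbT//.
      by rewrite leNgt; apply/negP => h'; apply: nN; exists N.
    have := proj1 (ae_eq_integral_abs mu mC (measurable_funTS mUE)) IU.
    by apply: filterS => x /[apply] -[].
  have hz : {ae mu, forall x, setT x -> (h x `^ p * w x)%:E = 0}.
    move: hU (ae_foralln Uz); apply: filterS2 => x hx Ux _.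
    have [M xM] := centered_cube_cover x.
    have h0x : h x = 0%R by apply/le_anti/andP; rewrite -{1}(Ux M xM).
    by rewrite h0x powR0// mul0r.
  have mhp : measurable_fun setT (fun x => (h x `^ p * w x)%:E).
    exact: mfun_EFin (measurable_funM (mfun_pow p mh) mw).
  rewrite -[RHS](proj2 (ae_eq_integral_abs mu measurableT mhp) hz).
  apply: eq_integral => x _; rewrite gee0_abs// lee_fin.
  by apply: mulr_ge0 => //; exact: powR_ge0.
have mC M := measurable_cubes (cubes_centered M).
have aeA : {ae mu, forall x, forall M, centered_cube M x ->
    avg (centered_cube M) (EFin \o U) <= (c * U x)%:E}.
  by apply: ae_foralln => M; exact: UA (cubes_centered M).
move: aeA; apply: filterS => x Ax.
have [M xM] := centered_cube_cover x.
have xNM : centered_cube (maxn N M) x.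
  exact: centered_cube_nd (leq_maxr N M) _ xM.
have INM : 0 < \int[mu]_(z in centered_cube (maxn N M)) (U z)%:E.
  apply: (lt_le_trans IN).
  apply: (ge0_subset_integral mu (mC N) (mC (maxn N M))).
  - exact: measurable_funTS mUE.
  - by move=> z _; rewrite lee_fin.
  - exact: centered_cube_nd (leq_maxl N M).
have := lt_le_trans _ (Ax _ xNM).
rewrite lt_neqAle U0 andbT; apply: contraPneq => <- /(_ 0).
rewrite mulr0 ltxx => h'; apply: notF; apply: h'.
have [m m0 mE] := leb_cube_fin (cubes_centered (maxn N M)).
rewrite /avg mE inver gt_eqF//; apply: mule_gt0; first exact: INM.
by rewrite lte_fin invr_gt0.
Qed.

Let B_gt0 : (0 < B)%R.
Proof.
by apply: mulr_gt0; [apply: mulr_gt0 => //; apply: mulr_gt0|rewrite invr_gt0].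
Qed.

(** The factor 4 is 2 from the series times 2 from the two summands in [rdf_step]. The constant [B]
    depends on A'; this is harmless because the bound for U^u serves for membership in a class and
    not for its constant. *)
Lemma rdf_weight : exists2 B : R, (0 < B)%R & forall h : E -> R,
  measurable_fun setT h -> (forall x, 0 <= h x)%R ->
  0 < \int[mu]_x (h x `^ p * w x)%:E < +oo ->
  exists U : E -> R, [/\ measurable_fun setT U, (forall x, 0 < U x)%R,
    \int[mu]_x (U x `^ p * w x)%:E <=
      (2 `^ p)%:E * \int[mu]_x (h x `^ p * w x)%:E,
    {ae mu, forall x, (h x <= U x)%R} &
    forall Q, cubes Q ->
      {ae mu, forall x, Q x -> avg Q (EFin \o U) <=
        (4 * maxop_const n p * A `^ (p - 1)^-1 * U x)%:E} /\
      {ae mu, forall x, Q x -> avg Q (fun z => (U z `^ u)%:E) <=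
        ((B * U x) `^ u)%:E}].
Proof.
exists B => // h mh h0 /andP[hp hf].
have ei0 : (0 <= eps^-1)%R by rewrite invr_ge0 ltW.
have KK0 : (0 < 2 * K1)%R by exact: mulr_gt0.
have QQfin (Q : set E) : cubes Q -> exists2 m : R, (0 < m)%R & mu Q = m%:E.
  exact: leb_cube_fin.
have mQQ (Q : set E) : cubes Q -> measurable Q by exact: measurable_cubes.
have [U [mU U0 UI hU [UA Uu]]] := rubio_de_francia mQQ QQfin mw w0 (ltW p1)
  KK0 u1 ei0 rdf_step (And3 mh h0 hf).
have UA' Q : cubes Q -> {ae mu, forall x, Q x ->
    avg Q (EFin \o U) <= (2 * (2 * K1) * U x)%:E}.
  move=> Qc; move: (UA Q Qc); apply: filterS => x Ux Qx.
  have := Ux Qx; rewrite int_le_avg//.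
  have -> : (fun z => (U z `^ 1)%:E) = EFin \o U.
    by apply/funext => z /=; rewrite powRr1.
  by rewrite powRr1// mulr_ge0// mulr_ge0// ltW.
have Up := rdf_positive mU U0 h0 hU mh hp UA'.
(* [U] may vanish on a null set; adding the indicator of that set gives a version that is positive
   everywhere. *)
pose V x := (U x + \1_(U @^-1` [set 0%R]) x)%R.
have UV : {ae mu, forall x, V x = U x}.
  move: Up; apply: filterS => x Ux; rewrite /V indicE memNset ?addr0//=.
  by move=> Ux0; move: Ux; rewrite Ux0 ltxx.
have mV : measurable_fun setT V.
  have mI : measurable_fun setT (\1_(U @^-1` [set 0%R]) : E -> R).
    by apply: measurable_indic; rewrite -[X in measurable X]setTI; exact: mU.
  exact: measurable_funD mU mI.
have V0 x : (0 < V x)%R.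
  rewrite /V indicE; have [Ux|Ux] := eqVneq (U x) 0%R.
    by rewrite mem_set// Ux add0r.
  by rewrite ltr_wpDr// lt_neqAle eq_sym Ux U0.
have avV Q (g : R -> R) : cubes Q -> measurable_fun setT g -> (forall x, 0 <= g x)%R ->
    avg Q (fun z => (g (V z))%:E) = avg Q (fun z => (g (U z))%:E).
  move=> Qc mg g0; rewrite /avg; congr (_ * _).
  apply: (ge0_ae_eq_integral (measurable_cubes Qc)).
  - exact: measurable_funTS (mfun_EFin (measurableT_comp mg mV)).
  - exact: measurable_funTS (mfun_EFin (measurableT_comp mg mU)).
  - by move=> z _; rewrite lee_fin.
  - by move=> z _; rewrite lee_fin.
  - by move: UV; apply: filterS => z -> _.
have Ipos (f : E -> R) x : (0 <= f x)%R -> 0 <= (f x `^ p * w x)%:E.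
  by move=> fx0; rewrite lee_fin; apply: mulr_ge0 => //; exact: powR_ge0.
have VUI : {ae mu, forall x, setT x -> (V x `^ p * w x)%:E <= (U x `^ p * w x)%:E}.
  by move: UV; apply: filterS => x -> _; exact: lexx.
have VI := @ae_ge0_le_integral _ E R mu setT measurableT _ _
  (fun x _ => Ipos V x (ltW (V0 x)))
  (mfun_EFin (measurable_funM (mfun_pow p mV) mw))
  (fun x _ => Ipos U x (U0 x))
  (mfun_EFin (measurable_funM (mfun_pow p mU) mw)) VUI.
exists V; split.
- exact: mV.
- exact: V0.
- exact: le_trans VI UI.
- by move: UV hU; apply: filterS2 => x ->.
- move=> Q Qc; split.
  + have -> : avg Q (EFin \o V) = avg Q (EFin \o U).
      rewrite /avg; congr (_ * _).
      apply: (ge0_ae_eq_integral (measurable_cubes Qc)).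
      * exact: measurable_funTS (mfun_EFin mV).
      * exact: measurable_funTS (mfun_EFin mU).
      * by move=> z _; rewrite lee_fin ltW.
      * by move=> z _; rewrite lee_fin.
      * by move: UV; apply: filterS => z /= -> _.
    move: UV (UA' Q Qc); apply: filterS2 => x -> /[apply] /le_trans; apply.
    by rewrite lee_fin /K1 !mulrA -natrM lexx.
  + have -> := avV Q (fun r => r `^ u)%R Qc (measurable_powR u)
      (fun r => powR_ge0 r u).
    move: UV (Uu Q Qc); apply: filterS2 => x -> Ux Qx.
    by have := Ux Qx; rewrite int_le_avg.
Qed.
End step.
End rdf_Rn.

(** * The two-sided condition *)

Lemma powRE (R : realType) (a r : R) : (0 < a)%R -> (a `^ r = expR (r * ln a))%R.
Proof. by move=> a0; rewrite /powR gt_eqF. Qed.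

Lemma expR_powR (R : realType) (a r : R) : (expR a `^ r = expR (r * a))%R.
Proof. by rewrite powRE ?expR_gt0// expRK. Qed.

(** Once positive numbers are written as exponentials, an identity between powers becomes one
    between exponents, which [field] settles. *)
Lemma expR_surj (R : realType) (a : R) : (0 < a)%R -> exists b, a = expR b.
Proof. by move=> a0; exists (ln a); rewrite lnK// posrE. Qed.

Lemma poweR_two_sided (R : realType) (A B : \bar R) (x y : R) : 0 <= A ->
  x != 0%R -> (A `^ x^-1 * B `^ y^-1) `^ x = A * B `^ (y^-1 * x).
Proof.
move=> A0 x0; rewrite poweRM ?poweR_ge0// -!poweRrM mulVf//.
by rewrite [X in X * _]poweRe1.
Qed.

Section power_identities.
Context {R : realType}.
Local Open Scope ring_scope.
Variables (x y x0 y0 s t kappa th : R).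
Hypotheses (xp : 0 < x) (yp : 0 < y) (x0p : 0 < x0) (y0p : 0 < y0) (sp : 0 < s)
  (tp : 0 < t).
Hypothesis thE : th = x * y0 / (x0 * y).
Hypothesis th1 : 1 - th = kappa * y0.

Lemma powR_rdf_dual (w U : R) : 0 < w -> 0 < U ->
  (w `^ (- (y * t))) `^ th * (U `^ t) `^ (1 - th) =
  (w `^ (x / x0) * U `^ (- kappa)) `^ (- (y0 * t)).
Proof.
move=> /expR_surj[a ->] /expR_surj[b ->].
rewrite !expR_powR th1 -!expRD expR_powR; congr expR.
by rewrite thE; field; rewrite !gt_eqF.
Qed.

Lemma powR_rdf_const (a b m A : R) : 0 < a -> 0 < b -> 0 < m -> 0 < A ->
  ((A * m `^ (- t^-1)) `^ (kappa * (x0 * s)) * a) `^ (x0 * s)^-1 *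
    (b `^ th * m `^ (1 - th)) `^ (y0 * t)^-1 =
  A `^ kappa * (a `^ (x * s)^-1 * b `^ (y * t)^-1) `^ (x / x0).
Proof.
move=> /expR_surj[a' ->] /expR_surj[b' ->] /expR_surj[m' ->] /expR_surj[A' ->].
rewrite th1 !expR_powR -!expRD !expR_powR -!expRD !expR_powR -!expRD; congr expR.
by rewrite thE; field; rewrite !gt_eqF.
Qed.
End power_identities.

Section averages.
Context {R : realType} (n : nat).
Local Notation E := (Rn R n).
Local Notation mu := (@leb R n).
Implicit Types (Q : set E) (f g w U : E -> R).

Lemma avg_gt0 Q f : cubes Q -> measurable_fun setT f -> (forall x, 0 < f x)%R ->
  0 < avg Q (fun z => (f z)%:E).
Proof.
move=> Qc mf f0; have [m m0 mE] := leb_cube_fin Qc.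
have mQ0 : 0 < mu Q by rewrite mE lte_fin.
rewrite /avg mE inver gt_eqF//; apply: mule_gt0; last by rewrite lte_fin invr_gt0.
exact: (int_gt0 (measurable_cubes Qc) mf f0 mQ0).
Qed.

Lemma avg_le Q f g : cubes Q -> measurable_fun setT f -> measurable_fun setT g ->
  (forall x, 0 <= f x)%R -> (forall x, 0 <= g x)%R ->
  {ae mu, forall x, Q x -> (f x <= g x)%R} ->
  avg Q (fun z => (f z)%:E) <= avg Q (fun z => (g z)%:E).
Proof.
move=> Qc mf mg f0 g0 fg; have [m m0 mE] := leb_cube_fin Qc.
rewrite /avg mE inver gt_eqF//; apply: lee_wpmul2r.
  by rewrite lee_fin invr_ge0 ltW.
exact: (@ae_ge0_le_integral _ E R mu Q (measurable_cubes Qc)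
  (fun z => (f z)%:E) (fun z => (g z)%:E)
  (fun x _ => f0 x) (measurable_funTS (mfun_EFin mf))
  (fun x _ => g0 x) (measurable_funTS (mfun_EFin mg)) fg).
Qed.

Lemma avgZ Q f (c : R) : cubes Q -> measurable_fun setT f ->
  (forall x, 0 <= f x)%R -> (0 <= c)%R ->
  avg Q (fun z => (c * f z)%:E) = c%:E * avg Q (fun z => (f z)%:E).
Proof.
move=> Qc mf f0 c0; rewrite /avg muleA; congr (_ * _).
exact: (int_scale mu (measurable_cubes Qc) mf (fun x _ => f0 x) c0).
Qed.

Lemma avg1 Q : cubes Q -> avg Q (fun=> 1) = 1.
Proof.
move=> Qc; have [m m0 mE] := leb_cube_fin Qc.
rewrite /avg; have -> := integral_cst mu (measurable_cubes Qc) 1.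
rewrite mul1e; change (mu Q / mu Q = 1); rewrite mE inver gt_eqF//.
by rewrite -[LHS]/((m * m^-1)%R)%:E mulfV// gt_eqF.
Qed.

Lemma avg_hoelder Q f g (t : R) : cubes Q ->
  measurable_fun setT f -> measurable_fun setT g ->
  (forall x, 0 <= f x)%R -> (forall x, 0 <= g x)%R -> (0 <= t <= 1)%R ->
  avg Q (fun z => (f z `^ t * g z `^ (1 - t))%:E) <=
  avg Q (fun z => (f z)%:E) `^ t * avg Q (fun z => (g z)%:E) `^ (1 - t).
Proof.
move=> Qc mf mg f0 g0 t01; have [m m0 mE] := leb_cube_fin Qc.
have H := hoelder_int mu (measurable_cubes Qc) mf mg f0 g0 t01.
have If : 0 <= \int[mu]_(z in Q) (f z)%:E by exact: int_ge0.
have Ig : 0 <= \int[mu]_(z in Q) (g z)%:E by exact: int_ge0.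
have m0' : 0 <= (m^-1)%:E by rewrite lee_fin invr_ge0 ltW.
have e : (m^-1)%:E `^ t * (m^-1)%:E `^ (1 - t) = (m^-1)%:E.
  rewrite -[LHS]/((m^-1 `^ t * m^-1 `^ (1 - t))%R)%:E powR_split//.
rewrite /avg mE inver gt_eqF// !poweRM// muleACA e.
exact: lee_wpmul2r.
Qed.

Lemma ae_cube Q (P : E -> Prop) : cubes Q -> {ae mu, forall x, Q x -> P x} ->
  exists x, P x.
Proof.
move=> Qc [N [mN N0 NP]]; apply: contrapT => nP.
have [m m0 mE] := leb_cube_fin Qc.
have : mu Q <= mu N.
  apply: le_measure; rewrite ?inE//; first exact: measurable_cubes.
  by move=> x Qx; apply: NP => /= /(_ Qx) Px; apply: nP; exists x.
by rewrite N0 mE lee_fin leNgt m0.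
Qed.

Definition pmean (r : R) w Q : \bar R := avg Q (fun z => (w z `^ r)%:E).

Lemma pmean_gt0 r w Q : cubes Q -> measurable_fun setT w ->
  (forall x, 0 < w x)%R -> 0 < pmean r w Q.
Proof.
move=> Qc mw w0; apply: (avg_gt0 Qc (mfun_pow r mw)) => x; exact: powR_gt0.
Qed.

Lemma pmean_mono (s t : R) w Q : cubes Q -> measurable_fun setT w ->
  (forall x, 0 < w x)%R -> (0 < s)%R -> (s <= t)%R ->
  pmean s w Q `^ s^-1 <= pmean t w Q `^ t^-1.
Proof.
move=> Qc mw w0 s0 st; have t0 := lt_le_trans s0 st.
have st01 : (0 <= s / t <= 1)%R.
  by rewrite divr_ge0 ?(ltW s0) ?(ltW t0)//= ler_pdivrMr// mul1r.
have := avg_hoelder Qc (mfun_pow t mw) (@measurable_cst _ _ E R setT 1%R)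
  (fun x => powR_ge0 _ _) (fun=> ler01) st01.
rewrite avg1// poweR1r mule1.
have -> : (fun z => ((w z `^ t) `^ (s / t) * cst 1 z `^ (1 - s / t))%:E) =
    (fun z => (w z `^ s)%:E).
  apply/funext => z; rewrite powR1 mulr1 -powRrM mulrCA mulfV ?mulr1//.
  by rewrite gt_eqF.
move=> h; have := lee_poweR (_ : (0 <= s^-1)%R) _ h.
rewrite invr_ge0 (ltW s0) => /(_ isT (ltW (pmean_gt0 s Qc mw w0))).
by rewrite -poweRrM mulrAC mulfV ?mul1r// gt_eqF.
Qed.

(** Hölder's inequality for 1 = (w^a)^(b/(a+b)) (w^(-b))^(a/(a+b)). *)
Lemma pmean_dual (a b : R) w Q : cubes Q -> measurable_fun setT w ->
  (forall x, 0 < w x)%R -> (0 < a)%R -> (0 < b)%R ->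
  1 <= pmean a w Q `^ a^-1 * pmean (- b) w Q `^ b^-1.
Proof.
move=> Qc mw w0 a0 b0; have ab0 : (0 < a + b)%R by exact: addr_gt0.
have abn : (a + b != 0)%R by rewrite gt_eqF.
have t01 : (0 <= b / (a + b) <= 1)%R.
  by rewrite divr_ge0 ?(ltW b0) ?(ltW ab0)//= ler_pdivrMr// mul1r lerDr ltW.
have := avg_hoelder Qc (mfun_pow a mw) (mfun_pow (- b) mw)
  (fun x => powR_ge0 _ _) (fun x => powR_ge0 _ _) t01.
have -> : (fun z => ((w z `^ a) `^ (b / (a + b)) *
    (w z `^ (- b)) `^ (1 - b / (a + b)))%:E) = (fun=> 1).
  apply/funext => z; rewrite -!powRrM -powRD; last by rewrite (gt_eqF (w0 z)) implybT.
  have -> : (a * (b / (a + b)) + - b * (1 - b / (a + b)) = 0)%R by field.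
  by rewrite powRr0.
rewrite avg1// -/(pmean a w Q) -/(pmean (- b) w Q).
have pa := ltW (pmean_gt0 a Qc mw w0); have pb := ltW (pmean_gt0 (- b) Qc mw w0).
move=> h; have r0 : (0 <= (a + b) / (a * b))%R.
  by rewrite divr_ge0 ?mulr_ge0 ?ltW.
have := lee_poweR r0 lee01 h; rewrite poweR1r poweRM ?poweR_ge0// -!poweRrM.
have -> : (b / (a + b) * ((a + b) / (a * b)) = a^-1)%R.
  by field; rewrite abn !gt_eqF.
have -> : ((1 - b / (a + b)) * ((a + b) / (a * b)) = b^-1)%R.
  by field; rewrite abn !gt_eqF.
by [].
Qed.

Definition two_sided (x y c : R) w := forall Q, cubes Q ->
  pmean x w Q `^ x^-1 * pmean (- y) w Q `^ y^-1 <= c%:E.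

(** Both means are positive, so a finite bound on the product makes each of them finite. *)
Lemma two_sided_fin x y c w Q : cubes Q -> measurable_fun setT w ->
  (forall x, 0 < w x)%R -> (0 < x)%R -> (0 < y)%R -> two_sided x y c w ->
  exists a b : R, [/\ (0 < a)%R, (0 < b)%R, pmean x w Q = a%:E,
    pmean (- y) w Q = b%:E & (a `^ x^-1 * b `^ y^-1 <= c)%R].
Proof.
move=> Qc mw w0 x0 y0 /(_ Q Qc).
have := pmean_gt0 x Qc mw w0; have := pmean_gt0 (- y) Qc mw w0.
have x'0 : (x^-1 != 0)%R by rewrite invr_eq0 gt_eqF.
have y'0 : (y^-1 != 0)%R by rewrite invr_eq0 gt_eqF.
case: (pmean x w Q) => [a| |]//; case: (pmean (- y) w Q) => [b| |]//.
- by rewrite !lte_fin => b0 a0; rewrite !poweR_EFin -EFinM lee_fin; exists a, b.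
- by move=> _ a0; rewrite (poweRyr y'0) gt0_muley ?poweR_gt0.
- by move=> b0 _; rewrite (poweRyr x'0) gt0_mulye ?poweR_gt0.
- by rewrite (poweRyr x'0) (poweRyr y'0) mulyy.
Qed.

Lemma two_sided_mono (x y x' y' c : R) w : measurable_fun setT w ->
  (forall x, 0 < w x)%R -> (0 < x)%R -> (0 < y)%R -> (x <= x')%R -> (y <= y')%R ->
  two_sided x' y' c w -> two_sided x y c w.
Proof.
move=> mw w0 x0 y0 xx yy h Q Qc; apply: le_trans (h Q Qc).
apply: lee_pmul; rewrite ?poweR_ge0//; first exact: pmean_mono.
have winv (r : R) : pmean (- r) w Q = pmean r (fun z => w z `^ (-1))%R Q.
  by congr avg; apply/funext => z; rewrite -powRrM mulN1r.
rewrite !winv.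
exact: (pmean_mono Qc (mfun_pow (-1)%R mw) (fun z => powR_gt0 _ (w0 z)) y0 yy).
Qed.

Lemma two_sided_inv (x y c : R) w :
  two_sided x y c w -> two_sided y x c (fun z => w z `^ (-1))%R.
Proof.
move=> h Q Qc; have := h Q Qc; rewrite muleC.
have winv (r : R) : pmean r (fun z => w z `^ (-1))%R Q = pmean (- r) w Q.
  by congr avg; apply/funext => z; rewrite -powRrM mulN1r.
by rewrite !winv opprK.
Qed.

(** Let v be the new weight and m the mean of U^t on Q. Since m^(1/t) <= A U on Q, the factor
    U^(-kappa) leaves the first mean as a power of A m^(-1/t). In the second, v^(-y0 t) = (w^(-y
    t))^th (U^t)^(1 - th), and Hölder's inequality applies. The powers of m cancel, which leaves
    A^kappa N^(x/x0). With s = t = 1 the lemma bounds the constant of v; larger values carry the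
    extra integrability over to v. *)
Lemma two_sided_rdf (x y x0 y0 s t kappa beta N A : R) w U :
  measurable_fun setT w -> (forall z, 0 < w z)%R ->
  measurable_fun setT U -> (forall z, 0 < U z)%R ->
  (0 < x)%R -> (0 < y)%R -> (0 < x0)%R -> (0 < y0)%R -> (0 < s)%R -> (0 < t)%R ->
  (0 <= beta)%R -> (0 < A)%R ->
  (x^-1 = x0^-1 + beta)%R -> (y0^-1 = y^-1 + beta)%R ->
  (kappa = x * (x^-1 + y^-1) * beta)%R ->
  two_sided (x * s) (y * t) N w ->
  (forall Q, cubes Q -> {ae mu, forall z, Q z ->
    avg Q (fun z => (U z `^ t)%:E) <= ((A * U z) `^ t)%:E}) ->
  two_sided (x0 * s) (y0 * t) (A `^ kappa * N `^ (x / x0))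
    (fun z => w z `^ (x / x0) * U z `^ (- kappa))%R.
Proof.
move=> mw w0 mU U0 x_0 y_0 x00 y00 s0 t0 beta0 A0 Ex Ey Ek wN UA Q Qc.
have xs0 : (0 < x * s)%R by exact: mulr_gt0.
have yt0 : (0 < y * t)%R by exact: mulr_gt0.
have [a [b [a0 b0 aE bE abN]]] := two_sided_fin Qc mw w0 xs0 yt0 wN.
have kappa0 : (0 <= kappa)%R.
  rewrite Ek; apply: mulr_ge0 => //; apply: mulr_ge0; first exact: ltW.
  by apply: addr_ge0; rewrite invr_ge0 ltW.
have mUt := mfun_pow t mU.
have mv : measurable_fun setT (fun z => w z `^ (x / x0) * U z `^ (- kappa))%R.
  exact: measurable_funM (mfun_pow _ mw) (mfun_pow _ mU).
have v0 z : (0 < w z `^ (x / x0) * U z `^ (- kappa))%R.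
  by apply: mulr_gt0; exact: powR_gt0.
have Ut0 z : (0 < U z `^ t)%R by exact: powR_gt0.
have [m m0 mE] : exists2 m : R, (0 < m)%R & avg Q (fun z => (U z `^ t)%:E) = m%:E.
  have [z hz] := ae_cube Qc (UA Q Qc).
  have := avg_gt0 Qc mUt Ut0; move: hz.
  case: (avg Q _) => [m| |]//; rewrite ?lte_fin => _ m0; first by exists m.
have lower : {ae mu, forall z, Q z -> (m `^ t^-1 <= A * U z)%R}.
  move: (UA Q Qc); apply: filterS => z /[apply]; rewrite mE lee_fin => h.
  have := ler_powRl (_ : (0 <= t^-1)%R) (ltW m0) h.
  have AU0 : (0 <= A * U z)%R by apply: mulr_ge0; exact: ltW.
  have tn0 : t != 0%R by rewrite gt_eqF.
  by rewrite invr_ge0 (ltW t0) (powR_conjK AU0 tn0) => /(_ isT).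
pose r := (x0 * s)%R.
have r0 : (0 < r)%R by exact: mulr_gt0.
pose c := ((A * m `^ (- t^-1)) `^ (kappa * r))%R.
have mp0 : (0 < m `^ (- t^-1))%R by exact: powR_gt0.
have c0 : (0 <= c)%R by exact: powR_ge0.
have first_mean : pmean r (fun z => w z `^ (x / x0) * U z `^ (- kappa))%R Q <=
    (c * a)%:E.
  rewrite EFinM -aE -(avgZ Qc (mfun_pow (x * s)%R mw) (fun z => powR_ge0 _ _) c0).
  have mg : measurable_fun setT (fun z => c * w z `^ (x * s))%R.
    exact: measurable_funM (@measurable_cst _ _ E R _ c) (mfun_pow _ mw).
  apply: (avg_le Qc (mfun_pow r mv) mg).
  - by move=> z; exact: powR_ge0.
  - by move=> z; apply: mulr_ge0 => //; exact: powR_ge0.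
  move: lower; apply: filterS => z /[apply].
  move: (w z) (U z) (w0 z) (U0 z) => w' U' w'0 U'0 h.
  rewrite powRM ?powR_ge0// -!powRrM.
  have -> : (x / x0 * r = x * s)%R by rewrite /r; field; rewrite gt_eqF.
  rewrite [leLHS]mulrC; apply: ler_wpM2r; first exact: powR_ge0.
  have -> : (- kappa * r = - (kappa * r))%R by rewrite mulNr.
  rewrite powRN -[(U' `^ _)^-1%R]mul1r ler_pdivrMr ?powR_gt0//.
  have mt : (m `^ (- t^-1) * m `^ t^-1 = 1)%R.
    by rewrite powRN mulVf// gt_eqF// powR_gt0.
  have AM0 : (0 <= A * m `^ (- t^-1))%R by rewrite ltW// mulr_gt0.
  rewrite /c -(powRM _ AM0 (ltW U'0)).
  have -> : (1 = 1 `^ (kappa * r) :> R)%R by rewrite powR1.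
  have kr0 : (0 <= kappa * r)%R by rewrite mulr_ge0// ltW.
  apply: (ler_powRl kr0) => //.
  have := ler_wpM2l (ltW mp0) h; rewrite mt => /le_trans; apply.
  by rewrite mulrCA mulrA lexx.
(* The value of [th] is forced by the powers of w. That 1 - th = kappa y0 matches those of U as well
   is where the relations between the exponents enter. *)
pose th := (x * y0 / (x0 * y))%R.
have th1 : (1 - th = kappa * y0)%R.
  have Ex0 : (x0^-1 = x^-1 - beta)%R by rewrite Ex addrK.
  have Eb : ((x^-1 - beta) * y^-1 + (x^-1 + y^-1) * beta = x^-1 * y0^-1)%R.
    by rewrite Ey; ring.
  have : (th + kappa * y0 = x * y0 * (x^-1 * y0^-1))%R.
    rewrite -Eb /th Ek invfM Ex0; ring.
  rewrite mulrACA !mulfV ?gt_eqF// mul1r => <-; ring.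
have th0 : (0 <= th)%R by apply: divr_ge0; rewrite ltW// mulr_gt0.
have th01 : (0 <= th <= 1)%R.
  by rewrite th0 -subr_ge0 th1 mulr_ge0// ltW.
have second_mean :
    pmean (- (y0 * t)) (fun z => w z `^ (x / x0) * U z `^ (- kappa))%R Q <=
    (b `^ th * m `^ (1 - th))%:E.
  have := avg_hoelder Qc (mfun_pow (- (y * t))%R mw) mUt
    (fun z => powR_ge0 _ _) (fun z => powR_ge0 _ _) th01.
  rewrite mE -/(pmean (- (y * t)) w Q) bE => h; apply: le_trans h.
  rewrite le_eqVlt; apply/orP; left; apply/eqP; congr avg; apply/funext => z.
  congr (_%:E).
  exact: esym (powR_rdf_dual t y_0 x00 erefl th1 (w0 z) (U0 z)).
have P0 := ltW (pmean_gt0 (- (y0 * t)) Qc mv v0).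
have P0' := ltW (pmean_gt0 r Qc mv v0).
apply: (@le_trans _ _ (((c * a) `^ r^-1)%:E *
    ((b `^ th * m `^ (1 - th)) `^ (y0 * t)^-1)%:E)).
  have r'0 : (0 <= r^-1)%R by rewrite invr_ge0 ltW.
  have y'0 : (0 <= (y0 * t)^-1)%R by rewrite invr_ge0 ltW// mulr_gt0.
  apply: (lee_pmul (poweR_ge0 _ _) (poweR_ge0 _ _)).
    exact: (lee_poweR r'0 P0' first_mean).
  exact: (lee_poweR y'0 P0 second_mean).
rewrite -EFinM lee_fin /c /r.
rewrite (powR_rdf_const x_0 y_0 x00 y00 s0 t0 erefl th1 a0 b0 m0 A0).
apply: ler_wpM2l; first exact: powR_ge0.
apply: ler_powRl => //; first by rewrite divr_ge0// ltW.
by apply: mulr_ge0; exact: powR_ge0.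
Qed.

End averages.

(** * Muckenhoupt constants in terms of the two-sided condition *)

Section constants.
Context {R : realType} (n : nat).
Local Notation E := (Rn R n).
Local Notation mu := (@leb R n).
Implicit Types (Q : set E) (u v w U : E -> R).

Lemma cubes_nonempty : exists Q : set E, cubes Q.
Proof. by exists (@centered_cube R n 0); exact: cubes_centered. Qed.

Lemma conjrE (q : R) : (1 < q)%R -> (1 - conjr q = - (q - 1)^-1)%R.
Proof.
move=> q1; have q10 : (q - 1 != 0)%R by rewrite subr_eq0 gt_eqF.
have q0 : q != 0%R by rewrite gt_eqF// (lt_trans ltr01).
rewrite /conjr /hoelder_conjugate/= eqe (negbTE q0) -EFinB inver (negbTE q10) /=.
by field.
Qed.

(** With tau = 1 + x/y one has 1 - tau' = -y/x, so the dual weight of w^x is w^(-y), and the outer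
    power tau - 1 = x/y fits. *)
Lemma A_const_summand (x y : R) w Q : (0 < x)%R -> (0 < y)%R -> cubes Q ->
  measurable_fun setT w -> (forall z, 0 < w z)%R ->
  avg Q (fun z => (w z `^ x)%:E) *
  avg Q (wpow (fun z => (w z `^ x)%:E) (1 - conjr (1 + x / y)))
    `^ (1 + x / y - 1) =
  (pmean x w Q `^ x^-1 * pmean (- y) w Q `^ y^-1) `^ x.
Proof.
move=> x0 y0 Qc mw w0; have xy : (0 < x / y)%R by exact: divr_gt0.
have xn0 : x != 0%R by rewrite gt_eqF.
have P0 := ltW (pmean_gt0 x Qc mw w0).
have q1 : (1 < 1 + x / y)%R by rewrite ltrDl.
rewrite (conjrE q1) (poweR_two_sided _ _ P0 xn0).
have -> : (1 + x / y - 1 = y^-1 * x)%R by ring.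
suff -> : avg Q (wpow (fun z => (w z `^ x)%:E) (- (y^-1 * x)^-1)) =
    pmean (- y) w Q by [].
congr avg; apply/funext => z; rewrite /wpow poweR_EFin.
move: (w z) => w'; rewrite -powRrM; congr ((_ `^ _)%:E).
by field; rewrite !gt_eqF.
Qed.

Lemma A_const_le_two_sided (x y c : R) w : (0 < x)%R -> (0 < y)%R -> (0 <= c)%R ->
  measurable_fun setT w -> (forall z, 0 < w z)%R -> two_sided x y c w ->
  A_const (1 + x / y) (fun z => (w z `^ x)%:E) <= (c `^ x)%:E.
Proof.
move=> x0 y0 c0 mw w0 h; have xy : (0 < x / y)%R by exact: divr_gt0.
rewrite /A_const ifF; last by rewrite gt_eqF// ltrDl.
apply: ge_ereal_sup => _ [Q Qc <-]; rewrite A_const_summand//.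
rewrite -poweR_EFin; apply: lee_poweR; [exact: ltW| |exact: h].
exact: mule_ge0 (poweR_ge0 _ _) (poweR_ge0 _ _).
Qed.

Lemma two_sided_le_A_const (x y M : R) w : (0 < x)%R -> (0 < y)%R ->
  measurable_fun setT w -> (forall z, 0 < w z)%R ->
  A_const (1 + x / y) (fun z => (w z `^ x)%:E) <= M%:E ->
  two_sided x y (M `^ x^-1) w.
Proof.
move=> x0 y0 mw w0; have xy : (0 < x / y)%R by exact: divr_gt0.
have xn0 : x != 0%R by rewrite gt_eqF.
rewrite /A_const ifF; last by rewrite gt_eqF// ltrDl.
move=> h Q Qc; have {}h : (pmean x w Q `^ x^-1 * pmean (- y) w Q `^ y^-1) `^ x <=
    M%:E.
  rewrite -A_const_summand//; apply: le_trans h; apply: ereal_sup_ubound.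
  by exists Q.
have := lee_poweR (_ : (0 <= x^-1)%R) (poweR_ge0 _ _) h.
rewrite invr_ge0 (ltW x0) => /(_ isT).
by rewrite (poweR_conjK (mule_ge0 (poweR_ge0 _ _) (poweR_ge0 _ _)) xn0) poweR_EFin.
Qed.

Lemma A_const_ge1 (x y : R) w : (0 < x)%R -> (0 < y)%R ->
  measurable_fun setT w -> (forall z, 0 < w z)%R ->
  1 <= A_const (1 + x / y) (fun z => (w z `^ x)%:E).
Proof.
move=> x0 y0 mw w0; have xy : (0 < x / y)%R by exact: divr_gt0.
have [Q Qc] := cubes_nonempty.
rewrite /A_const ifF; last by rewrite gt_eqF// ltrDl.
apply: le_trans (_ : _ <= (pmean x w Q `^ x^-1 * pmean (- y) w Q `^ y^-1) `^ x) _.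
  rewrite -(poweR1r x); apply: lee_poweR; [exact: ltW|exact: lee01|].
  exact: pmean_dual.
by rewrite -A_const_summand//; apply: ereal_sup_ubound; exists Q.
Qed.

Lemma avg_cst Q (c : R) : cubes Q -> (0 <= c)%R -> avg Q (fun=> c%:E) = c%:E.
Proof.
move=> Qc c0.
have m1 : measurable_fun setT (fun _ : E => 1%R : R) := @measurable_cst _ _ E R _ _.
have := avgZ Qc m1 (fun=> ler01) c0; rewrite avg1// mule1 => e.
by rewrite -[RHS]e; congr avg; apply/funext => z; rewrite mulr1.
Qed.

Lemma avg_fin_of_ae Q u (M : R) : cubes Q -> measurable_fun setT u ->
  (forall z, 0 < u z)%R ->
  {ae mu, forall z, Q z -> avg Q (fun z => (u z)%:E) <= (M * u z)%:E} ->
  exists2 m : R, (0 < m)%R & avg Q (fun z => (u z)%:E) = m%:E.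
Proof.
move=> Qc mu0 u0 h; have [z hz] := ae_cube Qc h.
have := avg_gt0 Qc mu0 u0; move: hz.
by case: (avg Q _) => [m| |]//; rewrite ?lte_fin => _ m0; exists m.
Qed.

Lemma A1_const_le u (M : R) : (0 < M)%R -> measurable_fun setT u ->
  (forall z, 0 < u z)%R ->
  (forall Q, cubes Q ->
    {ae mu, forall z, Q z -> avg Q (fun z => (u z)%:E) <= (M * u z)%:E}) ->
  A_const 1 (fun z => (u z)%:E) <= M%:E.
Proof.
move=> M0 mu0 u0 h; rewrite /A_const eqxx; apply: ge_ereal_sup => _ [Q Qc <-].
have [m m0 mE] := avg_fin_of_ae Qc mu0 u0 (h Q Qc).
rewrite mE; have : ess_sup_on Q (fun z => (u z)%:E^-1) <= (M / m)%:E.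
  apply: ereal_inf_lbound; move: (h Q Qc); apply: filterS => z /[apply].
  rewrite mE lee_fin inver gt_eqF// lee_fin => hz.
  by rewrite -[leLHS]mul1r ler_pdivrMr// mulrAC ler_pdivlMr// mul1r.
move=> /(lee_wpmul2l (_ : 0 <= m%:E)); rewrite lee_fin (ltW m0) => /(_ isT).
by rewrite -EFinM mulrC divfK// gt_eqF.
Qed.

(** An almost everywhere bound y of 1/u on Q gives u >= 1/y there, so the mean of u is at least
    1/y. *)
Lemma A1_const_ge1 u (M : R) : measurable_fun setT u -> (forall z, 0 < u z)%R ->
  (forall Q, cubes Q ->
    {ae mu, forall z, Q z -> avg Q (fun z => (u z)%:E) <= (M * u z)%:E}) ->
  1 <= A_const 1 (fun z => (u z)%:E).
Proof.
move=> mu0 u0 h; have [Q Qc] := cubes_nonempty.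
have [m m0 mE] := avg_fin_of_ae Qc mu0 u0 (h Q Qc).
rewrite /A_const eqxx.
apply: le_trans (_ : _ <= avg Q (fun z => (u z)%:E) *
  ess_sup_on Q (fun z => (u z)%:E^-1)) _; last first.
  by apply: ereal_sup_ubound; exists Q.
have pos : 0 < avg Q (fun z => (u z)%:E) := avg_gt0 Qc mu0 u0.
have lower y : {ae mu, forall z, Q z -> (u z)%:E^-1 <= y} ->
    1 <= avg Q (fun z => (u z)%:E) * y.
  move=> hy; have [z hz] := ae_cube Qc hy.
  have y0 : 0 < y.
    by apply: lt_le_trans hz; rewrite inver gt_eqF// lte_fin invr_gt0.
  move: y y0 hy {hz} => [y| |]// y0 hy; last by rewrite gt0_muley// leey.
  rewrite lte_fin in y0.
  have mc : measurable_fun setT (fun _ : E => y^-1%R) := @measurable_cst _ _ E R _ _.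
  have : avg Q (fun=> (y^-1)%:E) <= avg Q (fun z => (u z)%:E).
    apply: (avg_le Qc mc mu0) => [_|x|]; [by rewrite invr_ge0 ltW|exact: ltW|].
    move: hy; apply: filterS => x /[apply]; rewrite inver gt_eqF// lee_fin => uy.
    by rewrite -[leRHS]invrK lef_pV2// posrE ?invr_gt0.
  have -> : avg Q (fun=> (y^-1)%:E) = (y^-1)%:E.
    by apply: (avg_cst Qc); rewrite invr_ge0 ltW.
  move=> /(lee_wpmul2r (_ : 0 <= y%:E)); rewrite lee_fin (ltW y0) => /(_ isT).
  by rewrite -EFinM mulVf// gt_eqF.
rewrite mE; have : (m^-1)%:E <= ess_sup_on Q (fun z => (u z)%:E^-1).
  apply: le_ereal_inf_tmp => y /lower; rewrite mE => hy.
  have := lee_wpmul2l (_ : 0 <= (m^-1)%:E) hy.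
  rewrite lee_fin invr_ge0 (ltW m0) => /(_ isT).
  by rewrite mule1 muleA -EFinM mulVf ?gt_eqF// mul1e.
move=> /(lee_wpmul2l (_ : 0 <= m%:E)); rewrite lee_fin (ltW m0) => /(_ isT).
by rewrite -EFinM mulfV// gt_eqF.
Qed.

End constants.

(** * Reverse Hölder classes and the two-sided condition *)

Section johnson_neugebauer.
Context {R : realType} (n : nat).
Local Notation E := (Rn R n).
Local Notation mu := (@leb R n).
Implicit Types (Q : set E) (u v w U : E -> R).

Lemma RH_ratio_le (S m c : R) u Q : (0 < m)%R ->
  avg Q (fun z => (u z)%:E) = m%:E -> pmean S u Q `^ S^-1 <= (c * m)%:E ->
  RH_ratio S%:E Q (fun z => (u z)%:E) <= c%:E.
Proof.
move=> m0 mE h; rewrite /RH_ratio mE /= inver gt_eqF//.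
have -> : wpow (fun z => (u z)%:E) S = (fun z => (u z `^ S)%:E) by [].
have m'0 : 0 <= (m^-1)%:E by rewrite lee_fin invr_ge0 ltW.
apply: (le_trans (lee_wpmul2r m'0 h)).
by rewrite -EFinM mulfK ?gt_eqF.
Qed.

Lemma pmean_powR (p S : R) v Q :
  pmean S (fun z => v z `^ p)%R Q = pmean (p * S) v Q.
Proof. by congr avg; apply/funext => z; rewrite powRrM. Qed.

(** By [pmean_dual] the p-mean of v, with its root, is at least the inverse of the dual mean, which
    can thus be traded for it in the two-sided condition. *)
Lemma RH_const_le_two_sided (p X y N : R) v : (0 < p)%R -> (p < X)%R ->
  (0 < y)%R -> (0 <= N)%R -> measurable_fun setT v -> (forall z, 0 < v z)%R ->
  two_sided X y N v ->
  RH_const (X / p)%:E (fun z => (v z `^ p)%:E) <= (N `^ p)%:E.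
Proof.
move=> p0 pX y0 N0 mv v0 h; apply: ge_ereal_sup => _ [Q Qc <-].
have X0 := lt_trans p0 pX.
have [a [b [a0 b0 aE bE ab]]] := two_sided_fin Qc mv v0 X0 y0 h.
have h' := two_sided_mono mv v0 p0 y0 (ltW pX) (lexx y) h.
have [m [b' [m0 b'0 mE b'E mb]]] := two_sided_fin Qc mv v0 p0 y0 h'.
have dual := pmean_dual Qc mv v0 p0 y0.
apply: (RH_ratio_le m0 mE); rewrite pmean_powR.
have -> : (p * (X / p) = X)%R by rewrite mulrC divfK// gt_eqF.
rewrite mE bE in dual; rewrite aE poweR_EFin lee_fin.
have {}dual : (1 <= m `^ p^-1 * b `^ y^-1)%R by rewrite -lee_fin.
have aX : (a `^ (X / p)^-1 = (a `^ X^-1) `^ p)%R.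
  by rewrite -powRrM invfM invrK mulrC.
have b'p : (0 < b `^ y^-1)%R by exact: powR_gt0.
have h1 : (a `^ X^-1 <= N * m `^ p^-1)%R.
  have aN : (a `^ X^-1 <= N / b `^ y^-1)%R by rewrite ler_pdivlMr.
  apply: (le_trans aN); apply: ler_wpM2l => //.
  by rewrite -[X in (X <= _)%R]mul1r ler_pdivrMr.
rewrite aX; apply: (le_trans (ler_powRl (ltW p0) (powR_ge0 _ _) h1)).
by rewrite powRM ?powR_ge0// -powRrM mulVf ?gt_eqF// powRr1 ?lexx// ltW.
Qed.

(** At the lower endpoint A_(p/pm) is A_1, and v itself takes the place of the dual mean. Jensen's
    inequality turns the pointwise bound into the A_1 bound; averaging its p-th power gives the
    reverse Hölder bound. *)
Lemma A1_RH_pointwise (p X N : R) v : (0 < p)%R -> (p < X)%R -> (0 < N)%R ->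
  measurable_fun setT v -> (forall z, 0 < v z)%R ->
  (forall Q, cubes Q ->
    {ae mu, forall z, Q z -> pmean X v Q `^ X^-1 <= (N * v z)%:E}) ->
  RH_const (X / p)%:E (fun z => (v z `^ p)%:E) <= (N `^ p)%:E /\
  A_const 1 (fun z => (v z `^ p)%:E) <= (N `^ p)%:E.
Proof.
move=> p0 pX N0 mv v0 h; have X0 := lt_trans p0 pX.
have mvp := mfun_pow p mv.
have vp0 z : (0 < v z `^ p)%R by exact: powR_gt0.
have ptw Q : cubes Q -> {ae mu, forall z, Q z ->
    pmean X v Q `^ (X / p)^-1 <= (N `^ p * v z `^ p)%:E}.
  move=> Qc; move: (h Q Qc); apply: filterS => z /[apply] hz.
  have := lee_poweR (ltW p0) (poweR_ge0 _ _) hz.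
  rewrite -poweRrM poweR_EFin powRM ?(ltW N0) ?(ltW (v0 z))//.
  by rewrite invfM invrK mulrC.
have A1 Q : cubes Q -> {ae mu, forall z, Q z ->
    avg Q (fun z => (v z `^ p)%:E) <= (N `^ p * v z `^ p)%:E}.
  move=> Qc; move: (ptw Q Qc); apply: filterS => z /[apply]; apply: le_trans.
  have pp0 : 0 <= pmean p v Q := ltW (pmean_gt0 p Qc mv v0).
  have := lee_poweR (ltW p0) (poweR_ge0 _ _) (pmean_mono Qc mv v0 p0 (ltW pX)).
  have pn0 : p != 0%R by rewrite gt_eqF.
  by rewrite (poweR_conjVK pp0 pn0) -poweRrM invfM invrK mulrC.
have Np0 : (0 < N `^ p)%R by exact: powR_gt0.
split; last exact: A1_const_le.
apply: ge_ereal_sup => _ [Q Qc <-].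
have [m m0 mE] := avg_fin_of_ae Qc mvp vp0 (A1 Q Qc).
apply: (RH_ratio_le m0 mE); rewrite pmean_powR.
have -> : (p * (X / p) = X)%R by rewrite mulrC divfK// gt_eqF.
have [z hz] := ae_cube Qc (ptw Q Qc).
have : 0 <= pmean X v Q `^ (X / p)^-1 by exact: poweR_ge0.
move: hz (ptw Q Qc); case: (pmean X v Q `^ (X / p)^-1) => [k| |]// _ hk k0.
have mk : measurable_fun setT (fun _ : E => k) := @measurable_cst _ _ E R _ _.
have mNv : measurable_fun setT (fun z => N `^ p * v z `^ p)%R.
  exact: measurable_funM (@measurable_cst _ _ E R _ _) mvp.
have : avg Q (fun=> k%:E) <= avg Q (fun z => (N `^ p * v z `^ p)%:E).
  apply: (avg_le Qc mk mNv) => [_|x|].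
  - by rewrite -lee_fin.
  - by apply: mulr_ge0; exact: powR_ge0.
  - by move: hk; apply: filterS => x /[apply]; rewrite lee_fin.
rewrite (avg_cst Qc) ?(avgZ Qc mvp) -?lee_fin//.
- by rewrite mE -EFinM.
- by move=> x; exact: powR_ge0.
- exact: powR_ge0.
Qed.

Lemma ess_sup_on_ge Q u (S : R) : cubes Q -> (0 < S)%R -> measurable_fun setT u ->
  (forall z, 0 < u z)%R ->
  pmean S u Q `^ S^-1 <= ess_sup_on Q (fun z => (u z)%:E).
Proof.
move=> Qc S0 mu0 u0; apply: le_ereal_inf_tmp => y hy.
have [z uz] := ae_cube Qc hy.
have : 0 <= y by apply: le_trans uz; rewrite lee_fin ltW.
case: y hy {uz} => [y| |] hy y0; [|exact: leey|by []].
rewrite lee_fin in y0.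
have mc : measurable_fun setT (fun _ : E => y `^ S)%R := @measurable_cst _ _ E R _ _.
have : pmean S u Q <= (y `^ S)%:E.
  rewrite -(avg_cst Qc (powR_ge0 y S)); apply: (avg_le Qc (mfun_pow S mu0) mc).
  - by move=> x; exact: powR_ge0.
  - by move=> x; exact: powR_ge0.
  - move: hy; apply: filterS => x /[apply]; rewrite lee_fin => uy.
    by apply: ler_powRl; rewrite // ltW.
have S'0 : (0 <= S^-1)%R by rewrite invr_ge0 ltW.
move=> /(lee_poweR S'0 (ltW (pmean_gt0 S Qc mu0 u0))).
by rewrite poweR_EFin powR_conjK// gt_eqF.
Qed.

(** By the convention in [RH_ratio] a finite constant forces finite means, so m is a real number.
    For s = +oo every real S is allowed, the S-mean being below the essential supremum. *)
Lemma RH_const_lty (s : \bar R) u Q : 0 < s -> cubes Q -> measurable_fun setT u ->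
  (forall z, 0 < u z)%R -> forall M : R, RH_const s (fun z => (u z)%:E) <= M%:E ->
  exists2 m : R, (0 < m)%R & avg Q (fun z => (u z)%:E) = m%:E /\
    forall S : R, (0 < S)%R -> (s = S%:E \/ s = +oo) ->
    pmean S u Q `^ S^-1 <= (M * m)%:E.
Proof.
move=> s0 Qc mu0 u0 M RM.
have : RH_ratio s Q (fun z => (u z)%:E) <= M%:E.
  by apply: le_trans RM; apply: ereal_sup_ubound; exists Q.
have := avg_gt0 Qc mu0 u0; rewrite /RH_ratio.
case: (avg Q _) => [m| |]//; rewrite lte_fin => m0 /=.
rewrite inver gt_eqF// => h; exists m => //; split => // S S0 sS.
have {}h : smean s Q (fun z => (u z)%:E) <= (M * m)%:E.
  have := lee_wpmul2r (_ : 0 <= m%:E) h; rewrite lee_fin (ltW m0) => /(_ isT).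
  by rewrite -muleA -!EFinM mulVf ?gt_eqF// mule1.
apply: le_trans h; case: sS => ->; first exact: lexx.
exact: ess_sup_on_ge.
Qed.

Lemma RH_class_real (s : R) u : (1 <= s)%R -> measurable_fun setT u ->
  (forall z, 0 < u z)%R -> RH_class s%:E (fun z => (u z)%:E) ->
  exists S M : R, [/\ (1 < S)%R, s != 1%R -> s = S &
    forall Q, cubes Q -> exists2 m : R, (0 < m)%R &
      avg Q (fun z => (u z)%:E) = m%:E /\ pmean S u Q `^ S^-1 <= (M * m)%:E].
Proof.
move=> s1 mu0 u0 [_].
have key (t : \bar R) : 1 < t -> RH_const t (fun z => (u z)%:E) < +oo ->
    forall S : R, (1 < S)%R -> (t = S%:E \/ t = +oo) -> exists M : R,
    forall Q, cubes Q -> exists2 m : R, (0 < m)%R &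
      avg Q (fun z => (u z)%:E) = m%:E /\ pmean S u Q `^ S^-1 <= (M * m)%:E.
  move=> t1 tf S S1 tS; have S0 := lt_trans ltr01 S1.
  have [M RM] : exists M : R, RH_const t (fun z => (u z)%:E) <= M%:E.
    move: tf; case: (RH_const _ _) => [M| |]// _; first by exists M.
    by exists 0%R; exact: leNye.
  exists M => Q Qc; have t0 : 0 < t by exact: lt_trans t1.
  have [m m0 [mE h]] := RH_const_lty t0 Qc mu0 u0 RM.
  by exists m => //; split => //; exact: h.
have [s1'|sn1] := eqVneq s 1%R.
  rewrite s1' eqxx => -[t t1 tf].
  have [S S1 tS] : exists2 S : R, (1 < S)%R & (t = S%:E \/ t = +oo).
    move: t t1 {tf} => [t| |]// t1; first by exists t; [rewrite -lte_fin|left].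
    (* For t = +oo any finite exponent larger than 1 would do. *)
    by exists 2%R; [rewrite ltr1n|right].
  have [M hM] := key t t1 tf S S1 tS.
  by exists S, M; split => // /eqP.
rewrite eqe (negbTE sn1) => sf.
have s1' : (1 < s)%R by rewrite lt_neqAle eq_sym sn1.
have [M hM] := key s%:E s1' sf s s1' (or_introl erefl).
by exists s, M.
Qed.

(** Half of the Johnson-Neugebauer equivalence between A cap RH and a single A_tau condition: the
    reverse Hölder bound replaces the p-mean in the two-sided condition by the (p S)-mean. *)
Lemma two_sided_of_A_RH (p y S M c : R) w : (0 < p)%R -> (0 < y)%R -> (1 < S)%R ->
  measurable_fun setT w -> (forall z, 0 < w z)%R ->
  two_sided p y c w ->
  (forall Q, cubes Q -> exists2 m : R, (0 < m)%R &
    avg Q (fun z => (w z `^ p)%:E) = m%:E /\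
    pmean S (fun z => w z `^ p)%R Q `^ S^-1 <= (M * m)%:E) ->
  two_sided (p * S) y (M `^ p^-1 * c) w.
Proof.
move=> p0 y0 S1 mw w0 h RH Q Qc.
have [m' m'0 [mE hM]] := RH Q Qc.
have [m [b [m0 b0 mE' bE mb]]] := two_sided_fin Qc mw w0 p0 y0 h.
have mm : m' = m by move: mE; rewrite -/(pmean p w Q) mE' => -[].
subst m'.
have p'0 : (0 <= p^-1)%R by rewrite invr_ge0 ltW.
have S0 := lt_trans ltr01 S1.
have M0 : (0 <= M)%R.
  rewrite -(pmulr_lge0 _ m0) -lee_fin; apply: le_trans hM; exact: poweR_ge0.
rewrite pmean_powR in hM.
have := lee_poweR p'0 (poweR_ge0 _ _) hM.
rewrite -poweRrM -invfM (mulrC S) poweR_EFin (powRM _ M0 (ltW m0)) => h1.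
rewrite bE poweR_EFin.
have b'0 : 0 <= (b `^ y^-1)%:E by rewrite lee_fin powR_ge0.
apply: (le_trans (lee_wpmul2r b'0 h1)); rewrite -EFinM lee_fin -mulrA.
by apply: ler_wpM2l => //; exact: powR_ge0.
Qed.

(** The A_1 bound gives v = U^(-delta) <= (A/m)^delta almost everywhere on Q, with m the mean of U.
    As v^(-1/delta) = U, [pmean_dual] makes the p-mean of v, with its root, at least m^(-delta),
    which gives the reverse Hölder bound with exponent +oo. *)
Lemma RH_infty_negative_power (p delta A : R) U : (0 < p)%R -> (0 < delta)%R ->
  (0 < A)%R -> measurable_fun setT U -> (forall z, 0 < U z)%R ->
  (forall Q, cubes Q -> {ae mu, forall z, Q z ->
    avg Q (fun z => (U z)%:E) <= (A * U z)%:E}) ->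
  two_sided p delta^-1 (A `^ delta) (fun z => U z `^ (- delta))%R /\
  RH_const +oo (fun z => ((U z `^ (- delta)) `^ p)%:E) <= (A `^ (delta * p))%:E.
Proof.
move=> p0 d0 A0 mU U0 UA; pose v z := (U z `^ (- delta))%R.
have mv : measurable_fun setT v by exact: mfun_pow.
have v0 z : (0 < v z)%R by exact: powR_gt0.
have d'0 : (0 < delta^-1)%R by rewrite invr_gt0.
have vmean Q : pmean (- delta^-1) v Q = avg Q (fun z => (U z)%:E).
  congr avg; apply/funext => z; rewrite -powRrM mulrNN mulfV ?gt_eqF//.
  by rewrite powRr1// ltW.
have bound Q m : (0 < m)%R -> cubes Q -> avg Q (fun z => (U z)%:E) = m%:E ->
    {ae mu, forall z, Q z -> (v z <= (A / m) `^ delta)%R}.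
  move=> m0 Qc mE; move: (UA Q Qc); apply: filterS => z /[apply].
  rewrite mE lee_fin => h; rewrite /v powRN -[leLHS]mul1r ler_pdivrMr ?powR_gt0//.
  have Am0 : (0 <= A / m)%R by rewrite divr_ge0 ?ltW.
  rewrite -(powRM _ Am0 (ltW (U0 z))).
  have -> : (1 = 1 `^ delta :> R)%R by rewrite powR1.
  by apply: ler_powRl; rewrite ?(ltW d0)// mulrAC ler_pdivlMr// mul1r.
have bound' Q m : (0 < m)%R -> cubes Q -> avg Q (fun z => (U z)%:E) = m%:E ->
    {ae mu, forall z, Q z -> (v z `^ p <= (A / m) `^ (delta * p))%R}.
  move=> m0 Qc mE; move: (bound Q m m0 Qc mE); apply: filterS => z /[apply] h.
  by rewrite powRrM; apply: ler_powRl => //; rewrite ltW.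
have pbound Q m : (0 < m)%R -> cubes Q -> avg Q (fun z => (U z)%:E) = m%:E ->
    pmean p v Q <= ((A / m) `^ (delta * p))%:E.
  move=> m0 Qc mE.
  have mc : measurable_fun setT (fun _ : E => (A / m) `^ (delta * p))%R.
    exact: (@measurable_cst _ _ E R _ _).
  rewrite -(avg_cst Qc (powR_ge0 (A / m) (delta * p))).
  apply: (avg_le Qc (mfun_pow p mv) mc).
  - by move=> x; exact: powR_ge0.
  - by move=> x; exact: powR_ge0.
  - exact: bound'.
have AmE m : (0 < m)%R -> ((A / m) `^ delta * m `^ delta = A `^ delta)%R.
  move=> m0; have Am0 : (0 <= A / m)%R by rewrite divr_ge0 ?ltW.
  by rewrite -(powRM _ Am0 (ltW m0)) divfK// gt_eqF.
have p'0 : (0 <= p^-1)%R by rewrite invr_ge0 ltW.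
split=> [|].
  move=> Q Qc; have [m m0 mE] := avg_fin_of_ae Qc mU U0 (UA Q Qc).
  rewrite vmean mE invrK poweR_EFin -(AmE m m0).
  have m'0 : 0 <= (m `^ delta)%:E by rewrite lee_fin powR_ge0.
  rewrite EFinM; apply: lee_wpmul2r => //.
  have := lee_poweR p'0 (ltW (pmean_gt0 p Qc mv v0)) (pbound Q m m0 Qc mE).
  by rewrite poweR_EFin -powRrM mulfK// gt_eqF.
apply: ge_ereal_sup => _ [Q Qc <-].
have [m m0 mE] := avg_fin_of_ae Qc mU U0 (UA Q Qc).
have := pmean_dual Qc mv v0 p0 d'0; rewrite vmean mE invrK.
have := pbound Q m m0 Qc mE; have := pmean_gt0 p Qc mv v0.
rewrite /RH_ratio.
have -> : avg Q (fun z => ((U z `^ (- delta)) `^ p)%:E) = pmean p v Q by [].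
case: (pmean p v Q) => [k| |]//; rewrite lte_fin => k0 _ dual /=.
rewrite inver gt_eqF//.
have {}dual : (1 <= k `^ p^-1 * m `^ delta)%R by rewrite -lee_fin.
have : ess_sup_on Q (fun z => ((U z `^ (- delta)) `^ p)%:E) <=
    ((A / m) `^ (delta * p))%:E.
  by apply: ereal_inf_lbound; exact: bound'.
have k'0 : 0 <= (k^-1)%:E by rewrite lee_fin invr_ge0 ltW.
move=> /(lee_wpmul2r k'0) /le_trans; apply.
rewrite -EFinM lee_fin ler_pdivrMr//.
have md0 : (0 < m `^ delta)%R by exact: powR_gt0.
have h : ((A / m) `^ delta <= A `^ delta * k `^ p^-1)%R.
  rewrite -(AmE m m0) -mulrA ler_peMr ?powR_ge0// mulrC.
  exact: dual.
rewrite !powRrM; apply: (le_trans (ler_powRl (ltW p0) (powR_ge0 _ _) h)).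
by rewrite powRM ?powR_ge0// -(powRrM k) mulVf ?gt_eqF// powRr1 ?lexx// ltW.
Qed.

End johnson_neugebauer.

(** * Off-diagonal norm estimates *)

Section off_diagonal.
Context d (T : measurableType d) {R : realType} (mu : {measure set T -> \bar R}).
Variables (f g : T -> \bar R) (w H : T -> R) (p q p0 q0 beta Phi : R).
Hypothesis mf : measurable_fun setT f.
Hypothesis mg : measurable_fun setT g.
Hypothesis f0 : forall x, 0 <= f x.
Hypothesis g0 : forall x, 0 <= g x.
Hypothesis mw : measurable_fun setT w.
Hypothesis w0 : forall x, (0 < w x)%R.
Hypothesis mH : measurable_fun setT H.
Hypothesis H0 : forall x, (0 < H x)%R.
Hypotheses (pp : (0 < p)%R) (qp : (0 < q)%R) (p0p : (0 < p0)%R) (q0p : (0 < q0)%R).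
Hypothesis betap : (0 < beta)%R.

Lemma LnormE_ge0 (h : T -> \bar R) (r : R) : (forall x, 0 <= h x) ->
  'N[mu]_r%:E[h] = (\int[mu]_x (h x `^ r)) `^ r^-1.
Proof.
move=> h0; rewrite unlock; congr (_ `^ _); apply: eq_integral => x _.
by rewrite gee0_abs.
Qed.

Let mul0 (h : T -> \bar R) (k : T -> R) : (forall x, 0 <= h x) ->
  (forall x, 0 <= k x)%R -> forall x, 0 <= (h \* (EFin \o k)) x.
Proof. by move=> h0 k0 x; apply: mule_ge0 => //; rewrite /= lee_fin. Qed.

Let mmul (h : T -> \bar R) (k : T -> R) : measurable_fun setT h ->
  measurable_fun setT k -> measurable_fun setT (h \* (EFin \o k)).
Proof. by move=> mh mk; apply: emeasurable_funM => //; exact: mfun_EFin. Qed.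

Let mpow (h : T -> \bar R) (r : R) : measurable_fun setT h ->
  measurable_fun setT (fun x => h x `^ r).
Proof. exact: (measurableT_comp (measurable_poweR r)). Qed.

(** Hölder's inequality for h w = (h v) H^beta with v = w H^(-beta) and 1/a = 1/b + beta. *)
Lemma Lnorm_hoelder_split (h : T -> \bar R) (a b : R) :
  measurable_fun setT h -> (forall x, 0 <= h x) -> (0 < a)%R -> (0 < b)%R ->
  (a^-1 = b^-1 + beta)%R ->
  'N[mu]_a%:E[h \* (EFin \o w)] <=
  'N[mu]_b%:E[h \* (EFin \o (fun x => w x * H x `^ (- beta))%R)] *
  (\int[mu]_x (H x)%:E) `^ beta.
Proof.
move=> mh h0 a0 b0 ab; pose v x := (w x * H x `^ (- beta))%R.
have v0 x : (0 <= v x)%R by rewrite mulr_ge0 ?powR_ge0// ltW.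
have mv : measurable_fun setT v by exact: measurable_funM mw (mfun_pow _ mH).
rewrite (LnormE_ge0 a (mul0 h0 (fun x => ltW (w0 x)))) (LnormE_ge0 b (mul0 h0 v0)).
have ab1 : (a / b = 1 - beta * a)%R.
  have -> : (b^-1 = a^-1 - beta)%R by rewrite ab addrK.
  by rewrite mulrBr mulfV ?gt_eqF// mulrC.
have th : (0 <= a / b <= 1)%R.
  apply/andP; split; first by apply: divr_ge0; exact: ltW.
  by rewrite ab1 gerBl; apply: mulr_ge0; exact: ltW.
have := @hoelder_interp _ _ _ mu setT (fun x => (h x * (v x)%:E) `^ b)
  (EFin \o H) (a / b) measurableT (mpow b (mmul mh mv)) (mfun_EFin mH).
move=> /(_ (fun x => poweR_ge0 _ _) (fun x => ltW (H0 x)) th).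
have -> : (1 - a / b = beta * a)%R by rewrite ab1; ring.
have -> : \int[mu]_x (((h x * (v x)%:E) `^ b) `^ (a / b) *
    (EFin \o H) x `^ (beta * a)) = \int[mu]_x ((h \* (EFin \o w)) x `^ a).
  apply: eq_integral => x _ /=.
  rewrite -poweRrM (_ : (b * (a / b) = a)%R); last by rewrite mulrC divfK// gt_eqF.
  have -> : (H x `^ (beta * a))%:E = (H x `^ beta)%:E `^ a.
    by rewrite poweR_EFin powRrM.
  rewrite -poweRM ?mule_ge0 ?lee_fin ?powR_ge0//.
  rewrite -muleA -EFinM /v -mulrA powRN mulVf ?mulr1//.
  by rewrite gt_eqF// powR_gt0.
move=> h'; have a'0 : (0 <= a^-1)%R by rewrite invr_ge0 ltW.
have I0 : 0 <= \int[mu]_x ((h \* (EFin \o w)) x `^ a).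
  by apply: integral_ge0 => x _; exact: poweR_ge0.
apply: (le_trans (lee_poweR a'0 I0 h')).
rewrite poweRM ?poweR_ge0// -!poweRrM.
have -> : (a / b * a^-1 = b^-1)%R by field; rewrite !gt_eqF.
have -> : (beta * a * a^-1 = beta)%R by rewrite mulfK// gt_eqF.
exact: lexx.
Qed.

Lemma offdiag_small :
  (p^-1 = p0^-1 + beta)%R -> (q^-1 = q0^-1 + beta)%R ->
  (0 <= Phi)%R ->
  {ae mu, forall x, (g x * (w x)%:E) `^ p <= (H x)%:E} ->
  'N[mu]_q0%:E[f \* (EFin \o (fun x => w x * H x `^ (- beta))%R)] <=
  Phi%:E * 'N[mu]_p0%:E[g \* (EFin \o (fun x => w x * H x `^ (- beta))%R)] ->
  'N[mu]_q%:E[f \* (EFin \o w)] <=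
  Phi%:E * ((\int[mu]_x (H x)%:E) `^ beta *
    (\int[mu]_x ((g x * (w x)%:E) `^ p)) `^ p0^-1).
Proof.
move=> pE qE Phi0 gH hyp.
pose v x := (w x * H x `^ (- beta))%R.
have v0 x : (0 <= v x)%R by rewrite mulr_ge0 ?powR_ge0// ltW.
have mv : measurable_fun setT v by exact: measurable_funM mw (mfun_pow _ mH).
have w0' x : (0 <= w x)%R by exact: ltW.
apply: (le_trans (Lnorm_hoelder_split mf f0 qp q0p qE)).
have IHb : 0 <= (\int[mu]_x (H x)%:E) `^ beta by exact: poweR_ge0.
apply: (le_trans (lee_wpmul2r IHb hyp)).
rewrite -muleA; apply: lee_wpmul2l; first by rewrite lee_fin.
rewrite muleC; apply: lee_wpmul2l => //.
rewrite (LnormE_ge0 p0 (mul0 g0 v0)); apply: lee_poweR.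
- by rewrite invr_ge0 ltW.
- by apply: integral_ge0 => x _; exact: poweR_ge0.
apply: (@ae_ge0_le_integral _ _ _ mu setT measurableT _ _).
- by move=> x _; exact: poweR_ge0.
- exact: mpow (mmul mg mv).
- by move=> x _; exact: poweR_ge0.
- exact: mpow (mmul mg mw).
move: gH; apply: filterS => x gx _ /=.
have : (g x * (w x)%:E) < +oo.
  by apply: (@lty_poweRy _ _ p); rewrite ?gt_eqF// (le_lt_trans gx)// ltry.
have : 0 <= g x * (w x)%:E by rewrite mule_ge0// lee_fin.
have -> : g x * (v x)%:E = g x * (w x)%:E * (H x `^ (- beta))%:E.
  by rewrite -muleA -EFinM.
move: gx; case: (g x * (w x)%:E) => [k| |]// kH k0 _.
rewrite lee_fin in k0; rewrite poweR_EFin lee_fin in kH.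
rewrite -EFinM !poweR_EFin lee_fin powRM ?powR_ge0//.
have [k00|kn0] := eqVneq k 0%R.
  by rewrite k00 !powR0 ?gt_eqF// mul0r.
have kp : (0 < k)%R by rewrite lt_neqAle eq_sym kn0.
have bp0 : (0 <= beta * p0)%R by rewrite mulr_ge0// ltW.
rewrite -powRrM mulNr powRN ler_pdivrMr ?powR_gt0//.
(* As p0 = p + p beta p0, the surplus power of k = g w is a power of k^p <= H, which H^(-beta p0)
   absorbs. *)
have -> : (k `^ p0 = k `^ p * (k `^ p) `^ (beta * p0))%R.
  rewrite -powRrM -powRD; last by rewrite kn0 implybT.
  congr (_ `^ _)%R.
  have -> : (beta = p^-1 - p0^-1)%R by rewrite pE [RHS]addrC addKr.
  by field; rewrite !gt_eqF.
by apply: ler_wpM2l; [exact: powR_ge0|apply: ler_powRl => //; exact: powR_ge0].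
Qed.

End off_diagonal.

Section off_diagonal_large.
Context d (T : measurableType d) {R : realType} (mu : {measure set T -> \bar R}).

(** The mirror image of [offdiag_small]: here v = w H^beta, Hölder's inequality is applied to g, and
    F^q <= H together with q = q0 + q beta q0 gives F^q <= (F H^beta)^q0 <= (f v)^q0. *)
Lemma offdiag_large (f g : T -> \bar R) (w H F : T -> R) (p q p0 q0 beta Phi : R) :
  measurable_fun setT f -> measurable_fun setT g ->
  (forall x, 0 <= f x) -> (forall x, 0 <= g x) ->
  measurable_fun setT w -> (forall x, 0 < w x)%R ->
  measurable_fun setT H -> (forall x, 0 < H x)%R ->
  (0 < p)%R -> (0 < q)%R -> (0 < p0)%R -> (0 < q0)%R -> (0 < beta)%R ->
  (p0^-1 = p^-1 + beta)%R -> (q0^-1 = q^-1 + beta)%R -> (0 <= Phi)%R ->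
  measurable_fun setT F -> (forall x, 0 <= F x)%R ->
  (forall x, (F x)%:E <= f x * (w x)%:E) ->
  {ae mu, forall x, (F x `^ q <= H x)%R} ->
  'N[mu]_q0%:E[f \* (EFin \o (fun x => w x * H x `^ beta)%R)] <=
  Phi%:E * 'N[mu]_p0%:E[g \* (EFin \o (fun x => w x * H x `^ beta)%R)] ->
  (\int[mu]_x (F x `^ q)%:E) `^ q0^-1 <=
  Phi%:E * ('N[mu]_p%:E[g \* (EFin \o w)] * (\int[mu]_x (H x)%:E) `^ beta).
Proof.
move=> mf mg f0 g0 mw w0 mH H0 pp qp p0p q0p bp pE qE Phi0 mF F0 Ff FH hyp.
pose v x := (w x * H x `^ beta)%R.
have v0 x : (0 < v x)%R by rewrite mulr_gt0 ?powR_gt0.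
have mv : measurable_fun setT v by exact: measurable_funM mw (mfun_pow _ mH).
apply: (@le_trans _ _ 'N[mu]_q0%:E[f \* (EFin \o v)]); last first.
  apply: (le_trans hyp); apply: lee_wpmul2l; first by rewrite lee_fin.
  have := Lnorm_hoelder_split mu mv v0 mH H0 bp mg g0 p0p pp pE.
  have -> : (fun x => v x * H x `^ (- beta))%R = w.
    by apply/funext => x; rewrite /v powRN mulfK// gt_eqF// powR_gt0.
  exact.
have fv0 x : 0 <= (f \* (EFin \o v)) x.
  by apply: mule_ge0 => //; rewrite /= lee_fin ltW.
rewrite (LnormE_ge0 mu q0 fv0); apply: lee_poweR.
- by rewrite invr_ge0 ltW.
- by apply: int_ge0 => x _; exact: powR_ge0.
apply: (@ae_ge0_le_integral _ _ _ mu setT measurableT _ _).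
- by move=> x _; rewrite lee_fin powR_ge0.
- exact: mfun_EFin (mfun_pow q mF).
- by move=> x _; exact: poweR_ge0.
- apply: (measurableT_comp (measurable_poweR q0)).
  by apply: emeasurable_funM => //; exact: mfun_EFin.
move: FH; apply: filterS => x Fx _ /=.
have -> : f x * (v x)%:E = f x * (w x)%:E * (H x `^ beta)%:E.
  by rewrite -muleA -EFinM.
apply: (@le_trans _ _ (((F x)%:E * (H x `^ beta)%:E) `^ q0)); last first.
  apply: lee_poweR; [exact: ltW| |].
  - by rewrite mule_ge0 ?lee_fin ?powR_ge0.
  - by apply: lee_wpmul2r => //; rewrite lee_fin powR_ge0.
rewrite -EFinM poweR_EFin lee_fin powRM ?powR_ge0//.
have [k00|kn0] := eqVneq (F x) 0%R.
  by rewrite k00 powR0 ?gt_eqF// powR0 ?gt_eqF// mul0r.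
have kp : (0 < F x)%R by rewrite lt_neqAle eq_sym kn0 F0.
have bq0 : (0 <= beta * q0)%R by rewrite mulr_ge0// ltW.
have -> : (F x `^ q = F x `^ q0 * (F x `^ q) `^ (beta * q0))%R.
  rewrite -powRrM -powRD; last by rewrite kn0 implybT.
  congr (_ `^ _)%R.
  have -> : (beta = q0^-1 - q^-1)%R by rewrite qE [RHS]addrC addKr.
  by field; rewrite !gt_eqF.
apply: ler_wpM2l; first exact: powR_ge0.
by rewrite -(powRrM (H x)); apply: ler_powRl => //; exact: powR_ge0.
Qed.

End off_diagonal_large.

(** * Exhaustion by truncations *)

Section exhaustion.
Context {R : realType} (n : nat).
Local Notation E := (Rn R n).
Local Notation mu := (@leb R n).

(** The functions min(G, k) on the k-th centered cube have finite integrals and increase to G. *)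
Lemma integral_le_truncations (G : E -> \bar R) (c : \bar R) :
  measurable_fun setT G -> (forall x, 0 <= G x) ->
  (forall P : E -> R, measurable_fun setT P -> (forall x, 0 <= P x)%R ->
    (forall x, (P x)%:E <= G x) -> \int[mu]_x (P x)%:E < +oo ->
    \int[mu]_x (P x)%:E <= c) ->
  \int[mu]_x G x <= c.
Proof.
move=> mG G0 h.
pose P k x : R := (fine (mine (G x) k%:R%:E) * \1_(@centered_cube R n k) x)%R.
have mfin k x : mine (G x) k%:R%:E \is a fin_num.
  rewrite ge0_fin_numE; last by rewrite le_min G0 lee_fin ler0n.
  by rewrite gt_min ltry orbT.
have m0 k x : (0 <= fine (mine (G x) k%:R%:E))%R.
  by apply: fine_ge0; rewrite le_min G0 lee_fin ler0n.
have mQ k := measurable_cubes (@cubes_centered R n k).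
have mP k : measurable_fun setT (P k).
  have mi : measurable_fun setT (\1_(@centered_cube R n k) : E -> R).
    exact: measurable_indic.
  have mm : measurable_fun setT (fun x => mine (G x) k%:R%:E).
    exact: measurable_mine mG (@measurable_cst _ _ E (\bar R) _ _).
  have mfi : measurable_fun [set: \bar R] (@fine R) by [].
  exact: measurable_funM (measurableT_comp mfi mm) mi.
have P0 k x : (0 <= P k x)%R by apply: mulr_ge0 => //; rewrite indicE ler0n.
have PG k x : (P k x)%:E <= G x.
  rewrite /P indicE; case: (x \in _); rewrite ?mulr1 ?mulr0//.
  by rewrite fineK// ge_min lexx.
have Pk k x : (P k x <= k%:R * \1_(@centered_cube R n k) x)%R.
  apply: ler_wpM2r; first by rewrite indicE ler0n.
  by rewrite -lee_fin fineK// ge_min lexx orbT.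
have Pnd x : nondecreasing_seq (fun k => (P k x)%:E).
  apply/nondecreasing_seqP => k; rewrite lee_fin.
  have i0 : (0 <= \1_(@centered_cube R n k) x :> R)%R by rewrite indicE ler0n.
  apply: (ler_pM (m0 k x) i0).
  - rewrite -lee_fin !fineK//; rewrite le_min ge_min lexx /= ge_min.
    by rewrite lee_fin ler_nat leqnSn orbT.
  - rewrite !indicE; have [xk|] := boolP (x \in centered_cube k); last by rewrite ler0n.
    rewrite mem_set//; apply: (@centered_cube_nd R n k k.+1) => //.
    by move: xk; rewrite inE.
have Plim x : (fun k => (P k x)%:E) @ \oo --> G x.
  have [N xN] := centered_cube_cover x.
  have PE k : (N <= k)%N -> (P k x)%:E = mine (G x) k%:R%:E.
    move=> Nk; rewrite /P indicE mem_set ?mulr1 ?fineK//.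
    exact: centered_cube_nd Nk _ xN.
  have cvg := ereal_nondecreasing_is_cvgn (Pnd x).
  suff -> : G x = limn (fun k => (P k x)%:E) by [].
  apply/eqP; rewrite eq_le; apply/andP; split; last first.
    by apply: lime_le => //; apply: nearW => k; exact: PG.
  have PL k : (P k x)%:E <= limn (fun k => (P k x)%:E).
    by rewrite (cvg_lim _ (ereal_nondecreasing_cvgn (Pnd x)))//; apply: ereal_sup_ubound; exists k.
  have big k : mine (G x) k%:R%:E <= limn (fun k => (P k x)%:E).
    apply: (@le_trans _ _ (mine (G x) (maxn N k)%:R%:E)).
      rewrite le_min ge_min lexx /= ge_min lee_fin ler_nat leq_maxr orbT//.
    by rewrite -PE ?leq_maxl.
  case: (G x) (G0 x) big => [r| |]// r0 big.
    have := big (Num.truncn r).+1; rewrite min_l// lee_fin.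
    by rewrite ltW// truncnS_gt.
  rewrite leye_eq; apply/eqP/eqyP => e e0.
  apply: le_trans (big (Num.truncn e).+1).
  by rewrite min_r ?leey// lee_fin ltW// truncnS_gt.
have e : \int[mu]_x G x = \int[mu]_x limn (fun k => (P k x)%:E).
  by apply: eq_integral => x _; apply/esym/cvg_lim.
rewrite e (monotone_convergence mu measurableT) => [|k|k x _|x _]; last 3 first.
- exact: mfun_EFin (mP k).
- by rewrite lee_fin.
- exact: Pnd.
have ndI : nondecreasing_seq (fun k => \int[mu]_x (P k x)%:E).
  move=> i j ij; apply: (@ge0_le_integral _ _ _ mu setT measurableT _ _).
  - by move=> x _; rewrite lee_fin.
  - exact: mfun_EFin (mP i).
  - exact: mfun_EFin (mP j).
  - by move=> x _; exact: Pnd.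
apply: lime_le; first exact: ereal_nondecreasing_is_cvgn.
apply: nearW => k; apply: h => //.
have mi : measurable_fun setT (\1_(@centered_cube R n k) : E -> R).
  exact: measurable_indic.
apply: (@le_lt_trans _ _ (\int[mu]_x (k%:R * \1_(@centered_cube R n k) x)%:E)).
  have mg : measurable_fun setT (fun x : E => k%:R * \1_(@centered_cube R n k) x : R)%R.
    exact: measurable_funM (@measurable_cst _ _ E R _ _) mi.
  exact: (le_int mu measurableT (mP k) mg (fun x _ => P0 k x) (fun x _ => Pk k x)).
rewrite (int_scale mu measurableT mi) ?ler0n//.
have [m m0' mE] := leb_cube_fin (@cubes_centered R n k).
have -> : \int[mu]_x (\1_(@centered_cube R n k) x)%:E = m%:E.
  by rewrite (integral_indic mu measurableT) ?setIT//.
by rewrite -EFinM ltry.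
Qed.

End exhaustion.

(** * Limited-range classes *)

Section ae_invariance.
Context {R : realType} (n : nat).
Local Notation E := (Rn R n).
Local Notation mu := (@leb R n).
Implicit Types (Q : set E) (u v w : E -> \bar R).

Lemma measurable_wpow u r : measurable_fun setT u -> measurable_fun setT (wpow u r).
Proof. exact: (measurableT_comp (measurable_poweR r)). Qed.

Lemma ae_eq_wpow u v r : {ae mu, forall x, u x = v x} ->
  {ae mu, forall x, wpow u r x = wpow v r x}.
Proof. by apply: filterS => x uv; rewrite /wpow uv. Qed.

Lemma ae_eq_avg u v Q : cubes Q -> measurable_fun setT u -> measurable_fun setT v ->
  {ae mu, forall x, u x = v x} -> avg Q u = avg Q v.
Proof.
move=> Qc mu0 mv uv; rewrite /avg; congr (_ * _).
apply: (ae_eq_integral v u (measurable_cubes Qc)).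
- exact: measurable_funTS.
- exact: measurable_funTS.
- by move: uv; apply: filterS => x ->.
Qed.

Lemma ae_eq_ess_sup_on u v Q : {ae mu, forall x, u x = v x} ->
  ess_sup_on Q u = ess_sup_on Q v.
Proof.
move=> uv; congr ereal_inf; apply/seteqP; split => y /= h.
- by move: uv h; apply: filterS2 => x ->.
- by move: uv h; apply: filterS2 => x <-.
Qed.

Lemma ae_eq_A_const q u v : measurable_fun setT u -> measurable_fun setT v ->
  {ae mu, forall x, u x = v x} -> A_const q u = A_const q v.
Proof.
move=> mu0 mv uv; rewrite /A_const.
case: (q == 1%R); apply: (congr1 (@ereal_sup R)).
- apply: eq_imagel => Q Qc /=; rewrite (ae_eq_avg Qc mu0 mv uv).
  congr (_ * _); apply: ae_eq_ess_sup_on; move: uv; apply: filterS => x.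
  by move=> ->.
- apply: eq_imagel => Q Qc /=; rewrite (ae_eq_avg Qc mu0 mv uv).
  congr (_ * _ `^ _).
  apply: (ae_eq_avg Qc (measurable_wpow _ mu0) (measurable_wpow _ mv)).
  exact: ae_eq_wpow.
Qed.

Lemma ae_eq_RH_const s u v : measurable_fun setT u -> measurable_fun setT v ->
  {ae mu, forall x, u x = v x} -> RH_const s u = RH_const s v.
Proof.
move=> mu0 mv uv; apply: (congr1 (@ereal_sup R)); apply: eq_imagel => Q Qc.
rewrite /RH_ratio (ae_eq_avg Qc mu0 mv uv); case: ifP => // _; congr (_ / _).
case: s => [s| |] /=; last 2 first.
- exact: ae_eq_ess_sup_on.
- exact: ae_eq_ess_sup_on.
congr (_ `^ _); apply: (ae_eq_avg Qc (measurable_wpow _ mu0) (measurable_wpow _ mv)).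
exact: ae_eq_wpow.
Qed.

Lemma is_weight_EFin (w : E -> R) : measurable_fun setT w -> (forall x, 0 < w x)%R ->
  is_weight (EFin \o w).
Proof.
move=> mw w0; split; first exact: mfun_EFin.
by apply/aeW => x; rewrite /= lte_fin w0 ltry.
Qed.

Lemma is_weight_powR (w : E -> R) r : measurable_fun setT w ->
  (forall x, 0 < w x)%R -> is_weight (fun x => (w x `^ r)%:E).
Proof.
move=> mw w0; apply: (is_weight_EFin (mfun_pow r mw)) => x; exact: powR_gt0.
Qed.

(** The estimates above are for real, everywhere positive functions. Classes, constants and norms
    ignore null sets, so a weight may be replaced by such a version. *)
Lemma is_weight_real u : is_weight u -> exists w : E -> R,
  [/\ measurable_fun setT w, forall x, (0 < w x)%R & {ae mu, forall x, u x = (w x)%:E}].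
Proof.
move=> [mu0 u0].
pose D : E -> bool := fun x => (0 < u x) && (u x < +oo).
have mD : measurable_fun setT D.
  apply: measurable_and.
    exact: (measurable_fun_lte (@measurable_cst _ _ E (\bar R) _ _) mu0).
  exact: (measurable_fun_lte mu0 (@measurable_cst _ _ E (\bar R) _ _)).
have mfi : measurable_fun [set: \bar R] (@fine R) by [].
exists (fun x => if D x then fine (u x) else 1%R); split.
- exact: (measurable_fun_ifT mD (measurableT_comp mfi mu0)
    (@measurable_cst _ _ E R _ _)).
- by move=> x; case: ifP => [/fine_gt0|].
- move: u0; apply: filterS => x ux; rewrite /D ux.
  by move/andP: ux => [? ?]; rewrite fineK// gt0_fin_numE.
Qed.

Lemma A_class_ae q u v : is_weight v -> measurable_fun setT u ->
  {ae mu, forall x, u x = v x} -> A_class q u -> A_class q v.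
Proof.
move=> wv mu0 uv [_ h]; split; first exact: wv.
rewrite -(ae_eq_A_const q mu0 wv.1 uv); exact: h.
Qed.

Lemma RH_class_ae s u v : is_weight v -> measurable_fun setT u ->
  {ae mu, forall x, u x = v x} -> RH_class s u -> RH_class s v.
Proof.
move=> wv mu0 uv [_ h]; split; [exact: wv|move: h].
case: (s == 1); last first.
  by move=> h; rewrite -(ae_eq_RH_const s mu0 wv.1 uv); exact: h.
move=> [t t1 h]; exists t; first exact: t1.
by rewrite -(ae_eq_RH_const t mu0 wv.1 uv); exact: h.
Qed.

Lemma ae_eq_Lnorm (f u v : E -> \bar R) (r : R) : measurable_fun setT f ->
  measurable_fun setT u -> measurable_fun setT v ->
  {ae mu, forall x, u x = v x} -> 'N[mu]_r%:E[f \* u] = 'N[mu]_r%:E[f \* v].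
Proof.
move=> mf mu0 mv uv; rewrite unlock; congr (_ `^ _).
apply: (ae_eq_integral _ _ measurableT).
- apply: (measurableT_comp (measurable_poweR r)).
  exact: (measurableT_comp (@abse_measurable R setT) (emeasurable_funM mf mu0)).
- apply: (measurableT_comp (measurable_poweR r)).
  exact: (measurableT_comp (@abse_measurable R setT) (emeasurable_funM mf mv)).
- by move: uv; apply: filterS => x /= ->.
Qed.

End ae_invariance.

(** * Exponents of the limited range *)

Section exponents.
Context {R : realType}.
Implicit Types (pm p : R) (pp : \bar R).

(* upper_exp pp p = p (pp/p)' (which is p for pp = +oo, as +oo^-1 = 0) and
   lower_exp pm p = p / (p/pm - 1): the exponents x and y above. *)
Definition upper_exp pp p : R := (p^-1 - fine pp^-1)^-1.

Definition lower_exp pm p : R := (pm^-1 - p^-1)^-1.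

Lemma fine_inve_bounds pp p : (0 < p)%R -> p%:E < pp ->
  (0 <= fine pp^-1 < p^-1)%R.
Proof.
move=> p0; case: pp => [r| |]//; last by rewrite invey invr_gt0 lexx.
rewrite lte_fin => pr; have r0 := lt_trans p0 pr.
by rewrite inver gt_eqF//= invr_ge0 (ltW r0) ltf_pV2.
Qed.

Lemma fine_inve_gt0 pp p : (0 < p)%R -> p%:E <= pp -> pp != +oo ->
  (0 < fine pp^-1)%R.
Proof.
move=> p0; case: pp => [r| |]//; rewrite lee_fin => pr _.
have r0 := lt_le_trans p0 pr.
by rewrite inver gt_eqF//= invr_gt0.
Qed.

Lemma upper_exp_ge pp p : (0 < p)%R -> p%:E < pp -> (p <= upper_exp pp p)%R.
Proof.
move=> p0 ppp; have /andP[i0 ip] := fine_inve_bounds p0 ppp.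
rewrite -[leLHS]invrK lef_pV2 ?posrE ?invr_gt0 ?subr_gt0//.
by rewrite gerBl.
Qed.

Lemma upper_exp_gt pp p : (0 < p)%R -> p%:E < pp -> pp != +oo ->
  (p < upper_exp pp p)%R.
Proof.
move=> p0 ppp ppy; have /andP[_ ip] := fine_inve_bounds p0 ppp.
have i0 := fine_inve_gt0 p0 (ltW ppp) ppy.
rewrite -[ltLHS]invrK ltf_pV2 ?posrE ?invr_gt0 ?subr_gt0//.
by rewrite gtrBl.
Qed.

Lemma upper_expy p : upper_exp +oo p = p.
Proof. by rewrite /upper_exp invey subr0 invrK. Qed.

Lemma lower_exp_gt0 pm p : (0 < pm)%R -> (pm < p)%R -> (0 < lower_exp pm p)%R.
Proof.
by move=> pm0 pmp; rewrite invr_gt0 subr_gt0 ltf_pV2// posrE (lt_trans pm0).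
Qed.

Lemma rhexpE pp p : (0 < p)%R -> p%:E < pp ->
  rhexp pp p = (upper_exp pp p / p)%:E.
Proof.
move=> p0 ppp; have /andP[i0 ip] := fine_inve_bounds p0 ppp.
have pn0 : p != 0%R by rewrite gt_eqF.
move: i0 ip; rewrite /upper_exp /rhexp; move: ppp; case: pp => [r| |]//.
  rewrite lte_fin => pr; have r0 := lt_trans p0 pr.
  rewrite !inver gt_eqF// (negbTE pn0) /= => _ ip.
  rewrite -EFinM /hoelder_conjugate /= eqe mulf_eq0 invr_eq0 !gt_eqF//=.
  have rp : (r / p - 1 != 0)%R.
    by rewrite subr_eq0 gt_eqF// ltr_pdivlMr// mul1r.
  rewrite -EFinB inver (negbTE rp) -EFinM; congr EFin.
  have rp0 : (r - p != 0)%R by rewrite subr_eq0 gt_eqF.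
  by field; rewrite pn0 gt_eqF//= mulN1r rp0.
move=> _ _ _; rewrite inver (negbTE pn0) invey subr0 invrK mulfV//.
by rewrite gt0_mulye// lte_fin invr_gt0.
Qed.

Lemma mul_rhexp pp p : (0 < p)%R -> p%:E < pp ->
  (p * fine (rhexp pp p) = upper_exp pp p)%R.
Proof. by move=> p0 ppp; rewrite rhexpE//= mulrC divfK// gt_eqF. Qed.

Lemma rhexp_top p : (0 < p)%R -> rhexp p%:E p = +oo.
Proof.
move=> p0; rewrite /rhexp inver gt_eqF// -EFinM mulfV ?gt_eqF//.
exact: hoelder_conjugate1.
Qed.

Lemma tauE pm pp p : (0 < pm)%R -> (0 < p)%R -> p%:E < pp ->
  (tau pm pp p = 1 + upper_exp pp p * (pm^-1 - p^-1))%R.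
Proof.
move=> pm0 p0 ppp; rewrite /tau rhexpE//=.
by field; rewrite !gt_eqF.
Qed.

Lemma conjr_1D (a : R) : (0 < a)%R -> (conjr (1 + a) = 1 + a^-1)%R.
Proof.
move=> a0; have := @conjrE R (1 + a)%R; rewrite ltrDl => /(_ a0).
have -> : (1 + a - 1 = a)%R by ring.
by move: (conjr _) (a^-1)%R => c b h; lra.
Qed.

End exponents.

Section limited_range_constants.
Context {R : realType} (n : nat).
Local Notation E := (Rn R n).
Local Notation mu := (@leb R n).
Variables (pm : R) (pp : \bar R).
Hypothesis pm0 : (0 < pm)%R.
Implicit Types (v w U : E -> R).

Lemma ARH_constE (p : R) (u : E -> \bar R) : (0 < p)%R -> p%:E < pp ->
  ARH_const pm pp p u = A_const (tau pm pp p) (wpow u (upper_exp pp p)).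
Proof. by move=> p0 ppp; rewrite /ARH_const ppp mul_rhexp. Qed.

Lemma divE_lower_exp (p : R) : (pm < p)%R ->
  (p / pm = 1 + p / lower_exp pm p)%R.
Proof.
move=> pmp; have p0 := lt_trans pm0 pmp.
by rewrite /lower_exp invrK; field; rewrite !gt_eqF.
Qed.

(** A_(p/pm) is the two-sided condition for (p, y), as p/pm = 1 + p/y, and reverse Hölder raises p
    to p S = x t. This step is qualitative, with an unspecified [N]; it makes the A_tau constant [A]
    finite, and [A] then gives the sharp condition for (x, y). *)
Lemma ARH_class_two_sided (p : R) (u : E -> \bar R) : (pm < p)%R -> p%:E < pp ->
  is_weight u -> ARH_class pm pp p (wpow u p) ->
  let x := upper_exp pp p in let y := lower_exp pm p in
  let A := fine (ARH_const pm pp p u) in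
  exists w t N, [/\ measurable_fun setT w, (forall z, 0 < w z)%R,
    {ae mu, forall z, u z = (w z)%:E},
    (1 <= t)%R /\ (pp = +oo -> (1 < t)%R) &
    two_sided (x * t) y N w /\ (1 <= A)%R /\ two_sided x y (A `^ x^-1) w].
Proof.
move=> pmp ppp uw [uA uRH] x y A; have p0 := lt_trans pm0 pmp.
have [w [mw w0 uE]] := is_weight_real uw.
have y0 : (0 < y)%R := lower_exp_gt0 pm0 pmp.
have px : (p <= x)%R := upper_exp_ge p0 ppp.
have x0 : (0 < x)%R := lt_le_trans p0 px.
have ww r := is_weight_powR r mw w0.
have uEr r : {ae mu, forall z, wpow u r z = (w z `^ r)%:E}.
  by move: uE; apply: filterS => z; rewrite /wpow => ->; rewrite poweR_EFin.
have mur r := measurable_wpow r uw.1.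
have [_ wA] := A_class_ae (ww p) (mur p) (uEr p) uA.
have wRH := RH_class_ae (ww p) (mur p) (uEr p) uRH.
have AE : ARH_const pm pp p u = A_const (1 + x / y)%R (fun z => (w z `^ x)%:E).
  rewrite ARH_constE// (tauE pm0 p0 ppp) -/x /y /lower_exp invrK.
  exact: (ae_eq_A_const _ (mur x) (ww x).1 (uEr x)).
have [c hc] : exists c : R, two_sided p y c w.
  move: wA; rewrite divE_lower_exp// -/y.
  have := A_const_ge1 p0 y0 mw w0.
  case AE' : (A_const _ _) => [c| |]// _ _; exists (c `^ p^-1)%R.
  by apply: two_sided_le_A_const => //; rewrite AE'.
have [S [M [S1 sS hRH]]] : exists S M : R, [/\ (1 < S)%R, (x / p != 1 -> x / p = S)%R &
    forall Q, cubes Q -> exists2 m : R, (0 < m)%R &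
      avg Q (fun z => (w z `^ p)%:E) = m%:E /\
      pmean S (fun z => w z `^ p)%R Q `^ S^-1 <= (M * m)%:E].
  move: wRH; rewrite rhexpE// -/x => wRH.
  apply: (RH_class_real _ (mfun_pow p mw) (fun z => powR_gt0 _ (w0 z)) wRH).
  by rewrite ler_pdivlMr// mul1r.
have hN := two_sided_of_A_RH p0 y0 S1 mw w0 hc hRH.
have xt : (x * (p * S / x) = p * S)%R by rewrite mulrC divfK// gt_eqF.
(* For finite pp the reverse Hölder exponent is x/p itself, so t = 1. For pp = +oo one has x = p,
   and RH_1 supplies some S > 1, so t = S. *)
have tE : ((p * S / x) = 1 \/ (p * S / x) = S /\ x = p)%R.
  have [xp|xp] := eqVneq (x / p)%R 1%R.
    right; have -> : x = p by rewrite -[x](divfK (negbT (gt_eqF p0))) xp mul1r.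
    by split => //; rewrite mulrC mulKf// gt_eqF.
  by left; rewrite -(sS xp) mulrCA mulfV ?gt_eqF// mulr1 mulfV// gt_eqF.
have t1 : (1 <= p * S / x)%R by case: tE => [->|[-> _]]; [exact: lexx|exact: ltW S1].
have hx : two_sided x y (M `^ p^-1 * c) w.
  apply: (two_sided_mono mw w0 x0 y0 _ (lexx y) hN).
  by rewrite -xt ler_peMr// ltW.
have hA1 := A_const_ge1 x0 y0 mw w0.
have hAfin : A_const (1 + x / y)%R (fun z => (w z `^ x)%:E) < +oo.
  have hc0 : (0 <= M `^ p^-1 * c)%R.
    have [Q Qc] := @cubes_nonempty R n.
    by rewrite -lee_fin (le_trans _ (hx Q Qc))// mule_ge0// poweR_ge0.
  by apply: le_lt_trans (A_const_le_two_sided x0 y0 hc0 mw w0 hx) (ltry _).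
have AA : A%:E = A_const (1 + x / y)%R (fun z => (w z `^ x)%:E).
  rewrite /A AE fineK// ge0_fin_numE//; exact: le_trans hA1.
exists w, (p * S / x)%R, (M `^ p^-1 * c)%R; split => //.
- split => // ppy; have xp : x = p by rewrite /x ppy upper_expy.
  by rewrite xp mulrC mulKf// gt_eqF.
- rewrite xt; split => //; split; first by rewrite -lee_fin AA.
  by apply: two_sided_le_A_const => //; rewrite AA lexx.
Qed.

End limited_range_constants.

Section limited_range_membership.
Context {R : realType} (n : nat).
Local Notation E := (Rn R n).
Local Notation mu := (@leb R n).
Variables (pm : R) (pp : \bar R).
Hypothesis pm0 : (0 < pm)%R.
Implicit Types (v w U : E -> R).

Lemma two_sided_ge0 (x y c : R) v : two_sided x y c v -> (0 <= c)%R.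
Proof.
move=> h; have [Q Qc] := @cubes_nonempty R n.
by rewrite -lee_fin (le_trans _ (h Q Qc))// mule_ge0// poweR_ge0.
Qed.

Lemma RH_class_intro (x p t : R) v : (0 < p)%R -> (p <= x)%R ->
  measurable_fun setT v -> (forall z, 0 < v z)%R ->
  (x != p -> RH_const (x / p)%:E (fun z => (v z `^ p)%:E) < +oo) ->
  (x = p -> (1 < t)%R /\ RH_const (x * t / p)%:E (fun z => (v z `^ p)%:E) < +oo) ->
  RH_class (x / p)%:E (fun z => (v z `^ p)%:E).
Proof.
move=> p0 px mv v0 h1 h2; split; first exact: is_weight_powR.
have pn0 := negbT (gt_eqF p0).
have xp1 : ((x / p)%:E == 1) = (x == p).
  by rewrite eqe -(inj_eq (mulIf pn0)) divfK// mul1r.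
rewrite xp1; case: (boolP (x == p)) => [/eqP xp|/h1 h]; last exact: h.
have [t1 h] := h2 xp; exists (x * t / p)%:E; last exact: h.
by rewrite lte_fin xp mulrC mulKf.
Qed.

(** The bound for the constant comes from [c] alone. The condition with x t serves the case x = p,
    that is pp = +oo, where RH_1 asks for an exponent larger than 1. *)
Lemma ARH_class_of_two_sided (p t N c : R) v : (pm < p)%R -> p%:E < pp ->
  measurable_fun setT v -> (forall z, 0 < v z)%R ->
  (1 <= t)%R -> (pp = +oo -> (1 < t)%R) ->
  let x := upper_exp pp p in let y := lower_exp pm p in
  two_sided (x * t) y N v -> two_sided x y c v ->
  ARH_class pm pp p (wpow (EFin \o v) p) /\
  1 <= ARH_const pm pp p (EFin \o v) <= (c `^ x)%:E.
Proof.
move=> pmp ppp mv v0 t1 ty x y hN hc; have p0 := lt_trans pm0 pmp.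
have y0 : (0 < y)%R := lower_exp_gt0 pm0 pmp.
have px : (p <= x)%R := upper_exp_ge p0 ppp.
have x0 : (0 < x)%R := lt_le_trans p0 px.
have c0 := two_sided_ge0 hc.
have vE r : wpow (EFin \o v) r = (fun z => (v z `^ r)%:E) by [].
split; last first.
  rewrite ARH_constE// vE (tauE pm0 p0 ppp).
  have -> : (upper_exp pp p * (pm^-1 - p^-1) = x / y)%R by rewrite /y /lower_exp invrK.
  apply/andP; split; first exact: A_const_ge1.
  exact: A_const_le_two_sided.
rewrite vE; split; first split.
- exact: is_weight_powR.
- rewrite divE_lower_exp//; have hp := two_sided_mono mv v0 p0 y0 px (lexx y) hc.
  exact: le_lt_trans (A_const_le_two_sided p0 y0 c0 mv v0 hp) (ltry _).
rewrite (rhexpE p0 ppp); apply: (@RH_class_intro x p t v p0 px mv v0).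
- move=> xp; have px' : (p < x)%R by rewrite lt_neqAle eq_sym xp.
  exact: le_lt_trans (RH_const_le_two_sided p0 px' y0 c0 mv v0 hc) (ltry _).
- move=> xp; have ppy : pp = +oo.
    apply/eqP/negP => /negP ppy; have := upper_exp_gt p0 ppp ppy.
    by rewrite -/x xp ltxx.
  split; first exact: ty.
  have px' : (p < x * t)%R by rewrite xp ltr_pMr// ty.
  have N0 := two_sided_ge0 hN.
  exact: le_lt_trans (RH_const_le_two_sided p0 px' y0 N0 mv v0 hN) (ltry _).
Qed.

(** At this endpoint tau is 1, and the constant is the A_1 constant of v^x = U. The bound for U^t
    supplies the exponent beyond 1 that RH_1 asks for when pp = +oo. *)
Lemma ARH_class_endpoint_low (t M B : R) U : pm%:E < pp ->
  measurable_fun setT U -> (forall z, 0 < U z)%R ->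
  (1 <= t)%R -> (pp = +oo -> (1 < t)%R) -> (0 < M)%R -> (0 < B)%R ->
  (forall Q, cubes Q -> {ae mu, forall z, Q z ->
    avg Q (fun z => (U z)%:E) <= (M * U z)%:E}) ->
  (forall Q, cubes Q -> {ae mu, forall z, Q z ->
    avg Q (fun z => (U z `^ t)%:E) <= ((B * U z) `^ t)%:E}) ->
  let v := (fun z => U z `^ (upper_exp pp pm)^-1)%R in
  ARH_class pm pp pm (wpow (EFin \o v) pm) /\
  1 <= ARH_const pm pp pm (EFin \o v) <= M%:E.
Proof.
move=> pmp mU U0 t1 ty M0 B0 hM hB v; pose x := upper_exp pp pm.
have px : (pm <= x)%R := upper_exp_ge pm0 pmp.
have x0 : (0 < x)%R := lt_le_trans pm0 px.
have xn0 := negbT (gt_eqF x0).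
have mv : measurable_fun setT v by exact: mfun_pow.
have v0 z : (0 < v z)%R by exact: powR_gt0.
have vx z : (v z `^ x = U z)%R.
  by rewrite /v -/x -powRrM mulVf// powRr1// ltW.
have vE r : wpow (EFin \o v) r = (fun z => (v z `^ r)%:E) by [].
have ptw (s C : R) : (1 <= s)%R -> (0 < C)%R -> (forall Q, cubes Q ->
      {ae mu, forall z, Q z -> avg Q (fun z => (U z `^ s)%:E) <= ((C * U z) `^ s)%:E}) ->
    forall Q, cubes Q -> {ae mu, forall z, Q z ->
      pmean (x * s) v Q `^ (x * s)^-1 <= (C `^ x^-1 * v z)%:E}.
  move=> s1 C0 hC Q Qc; move: (hC Q Qc); apply: filterS => z /[apply].
  have s0 : (0 < s)%R := lt_le_trans ltr01 s1.
  have -> : (fun z => (U z `^ s)%:E) = (fun z => (v z `^ (x * s))%:E).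
    by apply/funext => z'; rewrite powRrM vx.
  move=> h; have xs0 : (0 <= (x * s)^-1)%R by rewrite invr_ge0 mulr_ge0// ltW.
  have := lee_poweR xs0 (ltW (pmean_gt0 (x * s) Qc mv v0)) h.
  rewrite poweR_EFin -powRrM.
  have -> : (s * (x * s)^-1 = x^-1)%R by field; rewrite xn0 gt_eqF.
  by rewrite powRM// ltW.
have hM1 Q : cubes Q -> {ae mu, forall z, Q z ->
    avg Q (fun z => (U z `^ 1)%:E) <= ((M * U z) `^ 1)%:E}.
  move=> Qc; move: (hM Q Qc); apply: filterS => z.
  have -> : (fun z => (U z `^ 1)%:E) = (fun z => (U z)%:E).
    by apply/funext => z'; rewrite powRr1// ltW.
  by rewrite powRr1// mulr_ge0// ltW.
have hx := ptw 1%R M (lexx _) M0 hM1.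
have ht := ptw t B t1 B0 hB.
have key (s C : R) : (pm < x * s)%R -> (0 < C)%R -> (forall Q, cubes Q ->
    {ae mu, forall z, Q z -> pmean (x * s) v Q `^ (x * s)^-1 <= (C `^ x^-1 * v z)%:E}) ->
    RH_const (x * s / pm)%:E (fun z => (v z `^ pm)%:E) < +oo /\
    A_const 1 (fun z => (v z `^ pm)%:E) < +oo.
  move=> pxs C0 h; have C'0 : (0 < C `^ x^-1)%R by exact: powR_gt0.
  have [h1 h2] := A1_RH_pointwise pm0 pxs C'0 mv v0 h.
  by split; [apply: le_lt_trans h1 (ltry _)|apply: le_lt_trans h2 (ltry _)].
have pxt : (pm < x * t)%R.
  have [ppy|ppy] := eqVneq pp +oo.
    by rewrite /x ppy upper_expy ltr_pMr// ty.
  apply: (lt_le_trans (upper_exp_gt pm0 pmp ppy)).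
  by rewrite ler_peMr// ltW.
split; last first.
  rewrite ARH_constE// vE (tauE pm0 pm0 pmp) subrr mulr0 addr0.
  have -> : (fun z => (v z `^ upper_exp pp pm)%:E) = (fun z => (U z)%:E).
    by apply/funext => z; rewrite vx.
  by apply/andP; split; [exact: A1_const_ge1 hM|exact: A1_const_le].
rewrite vE; split; first split.
- exact: is_weight_powR.
- by rewrite divff ?gt_eqF//; have [] := key t B pxt B0 ht.
rewrite (rhexpE pm0 pmp); apply: (@RH_class_intro x pm t v pm0 px mv v0).
- move=> xp; have px' : (pm < x * 1)%R by rewrite mulr1 lt_neqAle eq_sym xp.
  by have [] := key 1%R M px' M0 hx; rewrite mulr1.
- move=> xp; have ppy : pp = +oo.
    apply/eqP/negP => /negP ppy; have := upper_exp_gt pm0 pmp ppy.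
    by rewrite -/x xp ltxx.
  split; first exact: ty.
  by have [] := key t B pxt B0 ht.
Qed.

(** With delta = 1/pm - 1/p one has v^(-1/delta) = U, and 1/delta is the lower exponent of p, so the
    dual mean of v is the mean of U. [RH_infty_negative_power] then gives both halves of the
    class. *)
Lemma ARH_class_endpoint_high (p M : R) U : (pm < p)%R ->
  measurable_fun setT U -> (forall z, 0 < U z)%R -> (0 < M)%R ->
  (forall Q, cubes Q -> {ae mu, forall z, Q z ->
    avg Q (fun z => (U z)%:E) <= (M * U z)%:E}) ->
  let v := (fun z => U z `^ (- (pm^-1 - p^-1)))%R in
  ARH_class pm p%:E p (wpow (EFin \o v) p) /\
  1 <= ARH_const pm p%:E p (EFin \o v) <= (M `^ ((pm^-1 - p^-1) * p))%:E.
Proof.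
move=> pmp mU U0 M0 hM v; have p0 := lt_trans pm0 pmp.
have mv : measurable_fun setT v by exact: mfun_pow.
have v0 z : (0 < v z)%R by exact: powR_gt0.
have vE r : wpow (EFin \o v) r = (fun z => (v z `^ r)%:E) by [].
set delta := (pm^-1 - p^-1)%R.
have d0 : (0 < delta)%R by have := lower_exp_gt0 pm0 pmp; rewrite invr_gt0.
have d'0 : (0 < delta^-1)%R by rewrite invr_gt0.
have [h1 h2] := RH_infty_negative_power p0 d0 M0 mU U0 hM.
have pE : (p / pm = 1 + p / delta^-1)%R by exact: divE_lower_exp.
have hA := A_const_le_two_sided p0 d'0 (powR_ge0 _ _) mv v0 h1.
split.
  rewrite vE; split; split; try exact: is_weight_powR.
    by rewrite pE; exact: le_lt_trans hA (ltry _).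
  by rewrite rhexp_top//=; exact: le_lt_trans h2 (ltry _).
rewrite /ARH_const ltxx rhexp_top// vE pE; apply/andP; split.
  by rewrite le_max (A_const_ge1 p0 d'0 mv v0).
rewrite ge_max; apply/andP; split; last exact: h2.
by move: hA; rewrite -powRrM.
Qed.

End limited_range_membership.

(** * The extrapolated weights *)

Section majorant.
Context {R : realType} (n : nat).
Local Notation E := (Rn R n).
Local Notation mu := (@leb R n).

Lemma two_sided_Ap (a b c : R) (w : E -> R) : (0 < a)%R -> (0 < b)%R ->
  measurable_fun setT w -> (forall z, 0 < w z)%R -> two_sided a b c w ->
  forall Q, cubes Q ->
  avg Q (EFin \o (fun z => w z `^ a)%R) *
  avg Q (EFin \o (fun z => (w z `^ a) `^ (- (1 + a / b - 1)^-1))%R)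
    `^ (1 + a / b - 1) <= (c `^ a)%:E.
Proof.
move=> a0 b0 mw w0 h Q Qc; have := A_const_summand a0 b0 Qc mw w0.
rewrite conjrE ?ltrDl ?divr_gt0// => e.
have h' := lee_poweR (ltW a0) (mule_ge0 (poweR_ge0 _ _) (poweR_ge0 _ _)) (h Q Qc).
by rewrite -e poweR_EFin in h'.
Qed.

(* At least 1, so that U = 1 is a majorant when the integral of P vanishes. *)
Definition rdf_const (tau : R) : R := Num.max 1%R (4 * maxop_const n tau)%R.

Lemma rdf_const_ge1 tau : (1 <= rdf_const tau)%R.
Proof. by rewrite /rdf_const le_max lexx. Qed.

(** With W = w^a the first condition puts W in A_tau with constant A, where 1/(tau - 1) = b/a; the
    second puts W in A_(tau/u), as tau/u = 1 + a/(b t). The iteration is run on h = (P/W)^(1/tau),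
    for which h^tau W = P. *)
Lemma rdf_majorant (a b A t N : R) (w P : E -> R) : (0 < a)%R -> (0 < b)%R ->
  (1 <= A)%R -> (1 <= t)%R -> measurable_fun setT w -> (forall z, 0 < w z)%R ->
  two_sided a b (A `^ a^-1) w -> two_sided a (b * t) N w ->
  measurable_fun setT P -> (forall z, 0 <= P z)%R ->
  \int[mu]_z (P z)%:E < +oo ->
  let tau := (1 + a / b)%R in
  exists (U : E -> R) (B : R), [/\ measurable_fun setT U, (forall z, 0 < U z)%R, (0 < B)%R,
    ({ae mu, forall z, (P z <= w z `^ a * U z `^ tau)%R} /\
    (0 < \int[mu]_z (P z)%:E ->
      \int[mu]_z (w z `^ a * U z `^ tau)%:E <=
      (2 `^ tau)%:E * \int[mu]_z (P z)%:E)) &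
    forall Q, cubes Q ->
      {ae mu, forall z, Q z -> avg Q (fun z => (U z)%:E) <=
        (rdf_const tau * A `^ (b / a)%R * U z)%:E} /\
      {ae mu, forall z, Q z ->
        avg Q (fun z => (U z `^ (tau / (1 + a / (b * t)))%R)%:E) <=
        ((B * U z) `^ (tau / (1 + a / (b * t)))%R)%:E}].
Proof.
move=> a0 b0 A1 t1 mw w0 hA hN mP P0 Pfin tau.
have t0 : (0 < t)%R := lt_le_trans ltr01 t1.
have A0 : (0 < A)%R := lt_le_trans ltr01 A1.
have bt0 : (0 < b * t)%R by exact: mulr_gt0.
have tau1 : (1 < tau)%R by rewrite ltrDl divr_gt0.
have tau0 : (0 < tau)%R := lt_trans ltr01 tau1.
have taun0 := negbT (gt_eqF tau0).
set u := (tau / (1 + a / (b * t)))%R.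
have rho1 : (1 < 1 + a / (b * t))%R by rewrite ltrDl divr_gt0.
have rho0 : (0 < 1 + a / (b * t))%R := lt_trans ltr01 rho1.
have u1 : (1 <= u)%R.
  rewrite ler_pdivlMr// mul1r lerD2l; apply: ler_wpM2l; first exact: ltW.
  by rewrite lef_pV2 ?posrE// ler_peMr// ltW.
have tauu : (tau / u = 1 + a / (b * t))%R.
  by rewrite /u invfM invrK mulrA mulfV// mul1r.
have N0 : (0 <= N)%R := two_sided_ge0 hN.
have K1 : (1 <= rdf_const tau * A `^ (b / a))%R.
  apply: mulr_ege1; first exact: rdf_const_ge1.
  have -> : (1 = 1 `^ (b / a) :> R)%R by rewrite powR1.
  by apply: ler_powRl => //; rewrite divr_ge0 // ltW.
have [I0|In0] := eqVneq (\int[mu]_z (P z)%:E) 0.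
  exists (fun=> 1%R), 1%R; split => //.
    split; last by rewrite I0 ltxx.
    have : ae_eq mu setT (EFin \o P) (cst 0).
      apply/(ae_eq_integral_abs mu measurableT (mfun_EFin mP)).
      rewrite -[RHS]I0; apply: eq_integral => z _ /=.
      by rewrite ger0_norm.
    apply: filterS => z /(_ I) /= [->].
    by rewrite mulr_ge0// powR_ge0.
  move=> Q Qc; split; apply/aeW => z _.
    by rewrite avg1// mulr1 lee_fin.
  rewrite powR1 avg1// mulr1 powR1 //.
pose W z := (w z `^ a)%R.
have mW : measurable_fun setT W by exact: mfun_pow.
have W0 z : (0 < W z)%R by exact: powR_gt0.
pose h z := ((P z * W z `^ (-1)) `^ tau^-1)%R.
have mh : measurable_fun setT h.
  exact: (mfun_pow _ (measurable_funM mP (mfun_pow _ mW))).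
have h0 z : (0 <= h z)%R by exact: powR_ge0.
have hW z : (h z `^ tau * W z = P z)%R.
  have PW0 : (0 <= P z * W z `^ (-1))%R by rewrite mulr_ge0 ?powR_ge0.
  rewrite /h -powRrM mulVf// (powRr1 PW0) powR_inv1 ?(ltW (W0 z))//.
  by rewrite divfK// gt_eqF.
have hA' : (1 + a / b - 1 = a / b)%R by ring.
have wA := two_sided_Ap a0 b0 mw w0 hA.
have wN := two_sided_Ap a0 bt0 mw w0 hN.
have AE : ((A `^ a^-1) `^ a = A)%R.
  by rewrite -powRrM mulVf ?gt_eqF// powRr1// ltW.
rewrite AE in wA.
have Na0 : (0 < N `^ a)%R.
  rewrite powR_gt0// lt_neqAle N0 andbT; apply/eqP => N00.
  have [Q Qc] := @cubes_nonempty R n.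
  have [a' [b' [a'0 b'0 _ _]]] := two_sided_fin Qc mw w0 a0 bt0 hN.
  by rewrite -N00 leNgt mulr_gt0// powR_gt0.
have pu1 : (1 < tau / u)%R by rewrite tauu.
rewrite -tauu in wN.
have [B B0 hB] := rdf_weight tau1 A0 u1 pu1 Na0 mW W0 wA wN.
have hP : (fun z => (h z `^ tau * W z)%:E) = (fun z => (P z)%:E).
  by apply/funext => z; rewrite hW.
have [|U [mU U0 UI hU UQ]] := hB h mh h0.
  by rewrite hP Pfin andbT lt0e In0 /=; apply: int_ge0.
exists U, B; split => //.
  split.
    move: hU; apply: filterS => z hz; rewrite -(hW z) mulrC -/(W z).
    by apply: ler_wpM2l; [exact: ltW|apply: ler_powRl => //; exact: ltW].
  move=> _; move: UI; rewrite hP.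
  have -> : (fun z => (U z `^ tau * W z)%:E) = (fun z => (w z `^ a * U z `^ tau)%:E).
    by apply/funext => z; rewrite mulrC.
  exact: id.
move=> Q Qc; have [h1 h2] := UQ Q Qc; split; last exact: h2.
move: h1; apply: filterS => z /[apply] /le_trans; apply; rewrite lee_fin.
apply: ler_wpM2r; first exact: ltW.
rewrite /tau hA' invf_div; apply: ler_wpM2r; first exact: powR_ge0.
by rewrite /rdf_const le_max lexx orbT.
Qed.

End majorant.

Section gamma_exponent.
Context {R : realType} (n : nat).
Local Notation E := (Rn R n).
Local Notation mu := (@leb R n).
Variables (pm : R) (pp : \bar R) (p p0 : R).
Hypotheses (pm0 : (0 < pm)%R) (pmp : (pm < p)%R) (ppp : p%:E < pp).
Hypotheses (pmp0 : (pm <= p0)%R) (p0pp : p0%:E <= pp).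
Implicit Types (v w U : E -> R).

Local Notation x := (upper_exp pp p).
Local Notation y := (lower_exp pm p).

Let p_gt0 : (0 < p)%R := lt_trans pm0 pmp.
Let p0_gt0 : (0 < p0)%R := lt_le_trans pm0 pmp0.
Let x_gt0 : (0 < x)%R := lt_le_trans p_gt0 (upper_exp_ge p_gt0 ppp).
Let y_gt0 : (0 < y)%R := lower_exp_gt0 pm0 pmp.

Lemma avg_powR1 U (M : R) : (0 < M)%R -> (forall z, 0 < U z)%R ->
  (forall Q, cubes Q -> {ae mu, forall z, Q z ->
    avg Q (fun z => (U z)%:E) <= (M * U z)%:E}) ->
  forall Q, cubes Q -> {ae mu, forall z, Q z ->
    avg Q (fun z => (U z `^ 1)%:E) <= ((M * U z) `^ 1)%:E}.
Proof.
move=> M0 U0 h Q Qc; move: (h Q Qc); apply: filterS => z.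
have -> : (fun z => (U z `^ 1)%:E) = (fun z => (U z)%:E).
  by apply/funext => z'; rewrite powRr1// ltW.
by rewrite powRr1// mulr_ge0// ltW.
Qed.

(** The left-hand side is the exponent of A in [powR_down_const], with kappa = x (1/x + 1/y) beta
    and x0 the upper exponent of p0. *)
Lemma gammaE : p0%:E < pp ->
  (1 + x * (x^-1 + y^-1) * (p^-1 - p0^-1) * upper_exp pp p0 * (y / x)
   = (tau pm pp p0 - 1) / (tau pm pp p - 1))%R.
Proof.
move=> p0p; rewrite !tauE//.
have x0_gt0 : (0 < upper_exp pp p0)%R.
  exact: lt_le_trans p0_gt0 (upper_exp_ge p0_gt0 p0p).
have -> : (pm^-1 - p^-1 = y^-1)%R by rewrite /lower_exp invrK.
have Ep : (p^-1 - p0^-1 = x^-1 - (upper_exp pp p0)^-1)%R.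
  by rewrite /upper_exp !invrK; ring.
have -> : (pm^-1 - p0^-1 = y^-1 + (x^-1 - (upper_exp pp p0)^-1))%R.
  by rewrite -Ep /lower_exp invrK; ring.
have cancel1 (a : R) : (1 + a - 1 = a)%R by ring.
rewrite Ep !cancel1; move: x_gt0 y_gt0 x0_gt0.
move: (upper_exp _ _) (lower_exp _ _) (upper_exp _ _) => x' y' x0' h1 h2 h3.
by field; rewrite !gt_eqF.
Qed.

End gamma_exponent.

Section weight_identities.
Context {R : realType}.

Lemma powR_down_const (K A x y x0 kappa : R) : (0 < K)%R -> (0 < A)%R ->
  (0 < x)%R -> (0 < x0)%R ->
  (((K * A `^ (y / x)) `^ kappa * (A `^ x^-1) `^ (x / x0)) `^ x0 =
   K `^ (kappa * x0) * A `^ (1 + kappa * x0 * (y / x)))%R.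
Proof.
move=> /expR_surj[k ->] /expR_surj[a ->] h1 h2.
rewrite !(expR_powR, =^~ expRD); congr expR.
by field; rewrite !gt_eqF.
Qed.

Lemma powR_down_weight (w U x x0 beta tau : R) : (0 < w)%R -> (0 < U)%R ->
  (0 < x)%R -> (0 < x0)%R -> (x^-1 = x0^-1 + beta)%R ->
  (w * (w `^ x * U `^ tau) `^ (- beta) =
   w `^ (x / x0) * U `^ (- (tau * beta)))%R.
Proof.
move=> /expR_surj[k ->] /expR_surj[a ->] h1 h2 h3.
rewrite !(expR_powR, =^~ expRD); congr expR.
have -> : (beta = x^-1 - x0^-1)%R by rewrite h3; ring.
by field; rewrite !gt_eqF.
Qed.

Lemma powR_up_weight (w U y y0 beta tau : R) : (0 < w)%R -> (0 < U)%R ->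
  (0 < y)%R -> (0 < y0)%R -> (y^-1 = y0^-1 + beta)%R ->
  (((w `^ (-1)) `^ (y / y0) * U `^ (- (tau * beta))) `^ (-1) =
   w * ((w `^ (-1)) `^ y * U `^ tau) `^ beta)%R.
Proof.
move=> /expR_surj[k ->] /expR_surj[a ->] h1 h2 h3.
rewrite !(expR_powR, =^~ expRD); congr expR.
have -> : (beta = y^-1 - y0^-1)%R by rewrite h3; ring.
by field; rewrite !gt_eqF.
Qed.

Lemma powR_up_const (K A x y x0 y0 beta : R) : (0 < K)%R -> (0 < A)%R ->
  (0 < x)%R -> (0 < x0)%R -> (0 < y)%R -> (0 < y0)%R ->
  (y^-1 = y0^-1 + beta)%R -> (x0^-1 = x^-1 + beta)%R ->
  (((K * A) `^ (y * (y^-1 + x^-1) * beta) * (A `^ x^-1) `^ (y / y0)) `^ x0 =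
   K `^ (y * (y^-1 + x^-1) * beta * x0) * A)%R.
Proof.
move=> /expR_surj[k ->] /expR_surj[a ->] h1 h2 h3 h4 e1 e2.
rewrite !(expR_powR, =^~ expRD); congr expR.
have eb : (beta = y^-1 - y0^-1)%R by rewrite e1; ring.
have ex : (x0 = (x^-1 + beta)^-1)%R by rewrite -e2 invrK.
have hb : (x^-1 + beta != 0)%R by rewrite -e2 invr_eq0 gt_eqF.
have hy0 : (y0 = (y^-1 - beta)^-1)%R by rewrite eb; rewrite subKr invrK.
rewrite hy0 ex.
set e := (y * (y^-1 + x^-1) * beta)%R.
suff h : ((e + x^-1 * (y * (y^-1 - beta))) * (x^-1 + beta)^-1 = 1)%R.
  rewrite invrK -[X in (_ = _ + X)%R]mulr1 -[in RHS]h; ring.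
have -> : (e + x^-1 * (y * (y^-1 - beta)) = x^-1 + beta)%R.
  by rewrite /e; field; rewrite !gt_eqF.
exact: mulfV.
Qed.
End weight_identities.

Section extrapolated_weights.
Context {R : realType} (n : nat).
Local Notation E := (Rn R n).
Local Notation mu := (@leb R n).
Variables (pm : R) (pp : \bar R) (p p0 : R).
Hypotheses (pm0 : (0 < pm)%R) (pmp : (pm < p)%R) (ppp : p%:E < pp).
Hypotheses (pmp0 : (pm <= p0)%R) (p0pp : p0%:E <= pp).
Implicit Types (v w U : E -> R).

Local Notation x := (upper_exp pp p).
Local Notation y := (lower_exp pm p).

Let p_gt0 : (0 < p)%R := lt_trans pm0 pmp.
Let p0_gt0 : (0 < p0)%R := lt_le_trans pm0 pmp0.
Let x_gt0 : (0 < x)%R := lt_le_trans p_gt0 (upper_exp_ge p_gt0 ppp).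
Let y_gt0 : (0 < y)%R := lower_exp_gt0 pm0 pmp.

Lemma tau_two_sided : (tau pm pp p = x * (x^-1 + y^-1))%R.
Proof.
rewrite tauE// [RHS]mulrDr mulfV ?gt_eqF//; congr (_ + _ * _)%R.
by rewrite /lower_exp invrK.
Qed.

Lemma powR_ge1 (a r : R) : (1 <= a)%R -> (0 <= r)%R -> (1 <= a `^ r)%R.
Proof.
move=> a1 r0; have -> : (1 = 1 `^ r :> R)%R by rewrite powR1.
exact: ler_powRl.
Qed.

(** For p0 < pp, v = w^(x/x0) U^(-kappa), and [two_sided_rdf] is used twice: with its [s] equal to t
    for membership in the class, and equal to 1 for the constant. *)
Lemma down_weight : (p < p0)%R -> exists2 C : R, (1 <= C)%R &
  forall w U (A t N : R), measurable_fun setT w -> (forall z, 0 < w z)%R ->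
  measurable_fun setT U -> (forall z, 0 < U z)%R ->
  (1 <= A)%R -> (1 <= t)%R -> (pp = +oo -> (1 < t)%R) ->
  two_sided (x * t) y N w -> two_sided x y (A `^ x^-1) w ->
  (forall Q, cubes Q -> {ae mu, forall z, Q z -> avg Q (fun z => (U z)%:E) <=
    (rdf_const n (tau pm pp p) * A `^ (y / x) * U z)%:E}) ->
  let v := (fun z => w z * (w z `^ x * U z `^ (tau pm pp p))
    `^ (- (p^-1 - p0^-1)))%R in
  ARH_class pm pp p0 (wpow (EFin \o v) p0) /\
  1 <= ARH_const pm pp p0 (EFin \o v) <= (C * A `^ gamma pm pp p p0)%:E.
Proof.
move=> pp0; set K := rdf_const n (tau pm pp p).
have K1 : (1 <= K)%R by exact: rdf_const_ge1.
have K0 : (0 < K)%R := lt_le_trans ltr01 K1.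
pose beta := (p^-1 - p0^-1)%R.
have beta0 : (0 < beta)%R by rewrite subr_gt0 ltf_pV2// posrE.
have pmp0' : (pm < p0)%R by exact: lt_trans pp0.
pose kappa := (x * (x^-1 + y^-1) * beta)%R.
have kappa0 : (0 < kappa)%R by rewrite !mulr_gt0// addr_gt0// invr_gt0.
have [p0p|p0p] := boolP (p0%:E < pp).
  pose x0 := upper_exp pp p0; pose y0 := lower_exp pm p0.
  have x0_gt0 : (0 < x0)%R := lt_le_trans p0_gt0 (upper_exp_ge p0_gt0 p0p).
  have y0_gt0 : (0 < y0)%R := lower_exp_gt0 pm0 pmp0'.
  have xE : (x^-1 = x0^-1 + beta)%R by rewrite /x0 /upper_exp !invrK /beta; ring.
  have yE : (y0^-1 = y^-1 + beta)%R by rewrite /y0 /lower_exp !invrK /beta; ring.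
  exists (K `^ (kappa * x0))%R; first by rewrite powR_ge1// ltW// mulr_gt0.
  move=> w U A t N mw w0 mU U0 A1 t1 ty hN hA hU v.
  have A0 : (0 < A)%R := lt_le_trans ltr01 A1.
  have M0 : (0 < K * A `^ (y / x))%R by rewrite mulr_gt0// powR_gt0.
  have hU1 := avg_powR1 M0 U0 hU.
  have vE : v = (fun z => w z `^ (x / x0) * U z `^ (- kappa))%R.
    apply/funext => z; rewrite /v (powR_down_weight _ (w0 z) (U0 z) x_gt0 x0_gt0 xE).
    by rewrite tau_two_sided.
  have mv : measurable_fun setT v.
    by rewrite vE; exact: measurable_funM (mfun_pow _ mw) (mfun_pow _ mU).
  have v0 z : (0 < v z)%R by rewrite vE mulr_gt0// powR_gt0.
  have t0 : (0 < t)%R := lt_le_trans ltr01 t1.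
  have hN' : two_sided (x * t) (y * 1) N w by rewrite mulr1.
  have hA' : two_sided (x * 1) (y * 1) (A `^ x^-1) w by rewrite !mulr1.
  have rdf s c := @two_sided_rdf R n x y x0 y0 s 1%R kappa beta c
    (K * A `^ (y / x))%R w U mw w0 mU U0 x_gt0 y_gt0 x0_gt0 y0_gt0.
  have := rdf t N t0 ltr01 (ltW beta0) M0 xE yE erefl hN' hU1.
  have := rdf 1%R _ ltr01 ltr01 (ltW beta0) M0 xE yE erefl hA' hU1.
  rewrite !mulr1 -vE => vA vN.
  have [h1 /andP[h2 h3]] := ARH_class_of_two_sided pm0 pmp0' p0p mv v0 t1 ty vN vA.
  split; first exact: h1.
  apply/andP; split; first exact: h2.
  apply: (le_trans h3); rewrite -/x0 powR_down_const// lee_fin.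
  apply: ler_wpM2l; first exact: powR_ge0.
  apply: (ler_powR A1); rewrite /gamma p0p le_max; apply/orP; right.
  by rewrite -(gammaE pm0 pmp ppp pmp0 p0p) lexx.
(* At the upper endpoint x = 1/beta: the power of w in H^(-beta) is w^(-1), it cancels, and v =
   U^(-delta) remains. *)
have ppE : pp = p0%:E.
  by apply/le_anti/andP; split => //; rewrite leNgt.
pose delta := (pm^-1 - p0^-1)%R.
have delta0 : (0 < delta)%R by rewrite subr_gt0 ltf_pV2// posrE.
have xE : (x^-1 = beta)%R.
  by rewrite /upper_exp invrK ppE inver gt_eqF.
have dE : (tau pm pp p * beta = delta)%R.
  rewrite tau_two_sided -xE mulrAC mulfV ?gt_eqF// mul1r xE.
  by rewrite /lower_exp invrK /beta /delta; ring.
exists (K `^ (delta * p0))%R; first by rewrite powR_ge1// ltW// mulr_gt0.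
move=> w U A t N mw w0 mU U0 A1 t1 ty hN hA hU v.
have A0 : (0 < A)%R := lt_le_trans ltr01 A1.
have M0 : (0 < K * A `^ (y / x))%R by rewrite mulr_gt0// powR_gt0.
have vE : v = (fun z => U z `^ (- delta))%R.
  apply/funext => z; rewrite /v -/beta -xE powRM ?powR_ge0// -!powRrM.
  rewrite [(x * - _)%R]mulrN mulfV ?gt_eqF// powR_inv1 ?(ltW (w0 z))// mulrA.
  by rewrite mulfV ?gt_eqF// mul1r mulrN xE dE.
have [h1 /andP[h2 h3]] := ARH_class_endpoint_high pm0 pmp0' mU U0 M0 hU.
rewrite vE -/delta ppE in h1 h2 h3 *; split; first exact: h1.
apply/andP; split; first exact: h2.
apply: (le_trans h3); rewrite lee_fin.
rewrite powRM ?powR_ge0 ?(ltW K0)//.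
apply: ler_wpM2l; first exact: powR_ge0.
rewrite -powRrM; apply: (ler_powR A1); rewrite /gamma ltxx inver gt_eqF//=.
rewrite -ppE tauE//.
have -> : (1 + x * (pm^-1 - p^-1) - 1 = x / y)%R by rewrite /lower_exp invrK; ring.
by rewrite -/delta invf_div le_eqVlt; apply/orP; left; apply/eqP; ring.
Qed.

(** [two_sided_rdf] is applied to 1/w with the roles of x and y exchanged, and its conclusion is
    inverted. The powers of A add up to exactly 1, which gamma dominates since p0 < pp. *)
Lemma up_weight : (p0 < p)%R -> exists2 C : R, (1 <= C)%R &
  forall w U (A t B N : R), measurable_fun setT w -> (forall z, 0 < w z)%R ->
  measurable_fun setT U -> (forall z, 0 < U z)%R -> (0 < B)%R ->
  (1 <= A)%R -> (1 <= t)%R -> (pp = +oo -> (1 < t)%R) ->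
  two_sided (x * t) y N w -> two_sided x y (A `^ x^-1) w ->
  (forall Q, cubes Q -> {ae mu, forall z, Q z -> avg Q (fun z => (U z)%:E) <=
    (rdf_const n (1 + y / x) * A * U z)%:E}) ->
  (forall Q, cubes Q -> {ae mu, forall z, Q z ->
    avg Q (fun z => (U z `^ ((1 + y / x) / (1 + y / (x * t))))%:E) <=
    ((B * U z) `^ ((1 + y / x) / (1 + y / (x * t))))%:E}) ->
  let v := (fun z => w z * ((w z `^ (-1)) `^ y * U z `^ (1 + y / x))
    `^ (p0^-1 - p^-1))%R in
  ARH_class pm pp p0 (wpow (EFin \o v) p0) /\
  1 <= ARH_const pm pp p0 (EFin \o v) <= (C * A `^ gamma pm pp p p0)%:E.
Proof.
move=> pp0; set K := rdf_const n (1 + y / x)%R.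
have K1 : (1 <= K)%R by exact: rdf_const_ge1.
have K0 : (0 < K)%R := lt_le_trans ltr01 K1.
pose beta := (p0^-1 - p^-1)%R.
have beta0 : (0 < beta)%R by rewrite subr_gt0 ltf_pV2// posrE.
have p0p : p0%:E < pp by apply: lt_trans ppp; rewrite lte_fin.
pose kappa := (y * (y^-1 + x^-1) * beta)%R.
have kappa0 : (0 < kappa)%R by rewrite !mulr_gt0// addr_gt0// invr_gt0.
have kE : ((1 + y / x) * beta = kappa)%R.
  by rewrite /kappa; field; rewrite !gt_eqF.
pose x0 := upper_exp pp p0.
have x0_gt0 : (0 < x0)%R := lt_le_trans p0_gt0 (upper_exp_ge p0_gt0 p0p).
have x0E : (x0^-1 = x^-1 + beta)%R by rewrite /x0 /upper_exp !invrK /beta; ring.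
exists (K `^ (kappa * x0))%R; first by rewrite powR_ge1// ltW// mulr_gt0.
move=> w U A t B N mw w0 mU U0 B0 A1 t1 ty hN hA hU hUu.
have A0 : (0 < A)%R := lt_le_trans ltr01 A1.
have M0 : (0 < K * A)%R by rewrite mulr_gt0.
have t0 : (0 < t)%R := lt_le_trans ltr01 t1.
have xt0 : (0 < x * t)%R by exact: mulr_gt0.
have rho0 : (0 < 1 + y / (x * t))%R by rewrite ltr_wpDr// ltW// divr_gt0.
set u := ((1 + y / x) / (1 + y / (x * t)))%R in hUu *.
have u1 : (1 <= u)%R.
  rewrite ler_pdivlMr// mul1r lerD2l; apply: ler_wpM2l; first exact: ltW.
  by rewrite lef_pV2 ?posrE// ler_peMr// ltW.
have u0 : (0 < u)%R := lt_le_trans ltr01 u1.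
have u1' : (1 < t)%R -> (1 < u)%R.
  move=> t1'; rewrite ltr_pdivlMr// mul1r ltrD2l ltr_pM2l//.
  by rewrite ltf_pV2 ?posrE// ltr_pMr.
have uy : pp = +oo -> (1 < u)%R by move=> /ty.
(* The A_1 bound is for U^u and the condition on w has the exponent x t; both are used at x u, which
   requires u <= t. *)
have ut : (u <= t)%R.
  rewrite ler_pdivrMr//.
  have -> : (t * (1 + y / (x * t)) = t + y / x)%R by field; rewrite !gt_eqF.
  by rewrite lerD2r.
have Agam : (A <= A `^ gamma pm pp p p0)%R.
  rewrite -[leLHS](powRr1 (ltW A0)); apply: (ler_powR A1).
  by rewrite /gamma p0p le_max lexx.
have Cbound (c : \bar R) : c <= (K `^ (kappa * x0) * A)%:E ->
    c <= (K `^ (kappa * x0) * A `^ gamma pm pp p p0)%:E.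
  move=> /le_trans; apply; rewrite lee_fin; apply: ler_wpM2l => //.
  exact: powR_ge0.
pose w' z := (w z `^ (-1))%R.
have mw' : measurable_fun setT w' by exact: mfun_pow.
have w'0 z : (0 < w' z)%R by exact: powR_gt0.
(* At the lower endpoint y = 1/beta: w cancels from v, and v^x0 = U. *)
have [pmE|pmn] := eqVneq p0 pm.
  move=> v; have yE : (y^-1 = beta)%R by rewrite /lower_exp invrK /beta pmE.
  have vE : v = (fun z => U z `^ (upper_exp pp pm)^-1)%R.
    apply/funext => z; rewrite /v -/beta.
    have -> : ((upper_exp pp pm)^-1 = (1 + y / x) / y)%R.
      have := x0E; rewrite /x0 pmE => ->; rewrite -yE.
      by field; rewrite !gt_eqF.
    rewrite -yE powRM ?powR_ge0// -!powRrM.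
    have -> : (-1 * (y / y) = -1)%R by field; rewrite gt_eqF.
    by rewrite powR_inv1 ?(ltW (w0 z))// mulrA mulfV ?gt_eqF// mul1r.
  have pmlt : pm%:E < pp by rewrite -pmE.
  have [h1 /andP[h2 h3]] := ARH_class_endpoint_low pm0 pmlt mU U0 u1 uy M0 B0 hU hUu.
  rewrite vE pmE in Cbound Agam *; split; first exact: h1.
  apply/andP; split; first exact: h2.
  apply: (le_trans h3); rewrite lee_fin.
  have -> : (kappa * x0 = 1)%R.
    have : (x0 = (x^-1 + beta)^-1)%R by rewrite -x0E invrK.
    move=> ->; rewrite /kappa -yE.
    have -> : (y * (y^-1 + x^-1) * y^-1 = x^-1 + y^-1)%R by field; rewrite !gt_eqF.
    rewrite mulfV//.
    by rewrite gt_eqF// addr_gt0// invr_gt0.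
  rewrite powRr1 ?(ltW K0)//; apply: ler_wpM2l; [exact: ltW|exact: Agam].
have pmp0' : (pm < p0)%R by rewrite lt_neqAle eq_sym pmn.
pose y0 := lower_exp pm p0.
have y0_gt0 : (0 < y0)%R := lower_exp_gt0 pm0 pmp0'.
have yE : (y^-1 = y0^-1 + beta)%R by rewrite /y0 /lower_exp !invrK /beta; ring.
move=> v.
have vE : v = (fun z => (w' z `^ (y / y0) * U z `^ (- kappa)) `^ (-1))%R.
  apply/funext => z; rewrite /v -/beta -kE.
  by rewrite /w' (powR_up_weight _ (w0 z) (U0 z) y_gt0 y0_gt0 yE).
have mv : measurable_fun setT v.
  rewrite vE; apply: mfun_pow.
  exact: measurable_funM (mfun_pow _ mw') (mfun_pow _ mU).
have v0 z : (0 < v z)%R.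
  by rewrite vE powR_gt0// mulr_gt0// powR_gt0.
have xu : (x * u <= x * t)%R by rewrite ler_pM2l.
have xu0 : (0 < x * u)%R by exact: mulr_gt0.
have hN' : two_sided (y * 1) (x * u) N w'.
  rewrite mulr1; apply: two_sided_inv.
  exact: (two_sided_mono mw w0 xu0 y_gt0 xu (lexx y) hN).
have hA' : two_sided (y * 1) (x * 1) (A `^ x^-1) w'.
  by rewrite !mulr1; apply: two_sided_inv.
have rdf s c M := @two_sided_rdf R n y x y0 x0 1%R s kappa beta c
  M w' U mw' w'0 mU U0 y_gt0 x_gt0 y0_gt0 x0_gt0 ltr01.
have := rdf u N B u0 (ltW beta0) B0 yE x0E erefl hN' hUu.
have := rdf 1%R _ _ ltr01 (ltW beta0) M0 yE x0E erefl hA' (avg_powR1 M0 U0 hU).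
move=> /two_sided_inv + /two_sided_inv; rewrite !mulr1 -vE => vA vN.
have [h1 /andP[h2 h3]] := ARH_class_of_two_sided pm0 pmp0' p0p mv v0 u1 uy vN vA.
split; first exact: h1.
apply/andP; split; first exact: h2.
apply: Cbound; apply: (le_trans h3); rewrite -/x0 powR_up_const//.
Qed.

End extrapolated_weights.

(** * Extrapolation *)

Section extrapolation.
Context {R : realType} (n : nat).
Local Notation E := (Rn R n).
Local Notation mu := (@leb R n).
Variables (pm : R) (pp : \bar R) (p p0 : R).
Hypotheses (pm0 : (0 < pm)%R) (pmp : (pm < p)%R) (ppp : p%:E < pp).
Hypotheses (pmp0 : (pm <= p0)%R) (p0pp : p0%:E <= pp).

Local Notation x := (upper_exp pp p).
Local Notation y := (lower_exp pm p).

Let p_gt0 : (0 < p)%R := lt_trans pm0 pmp.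
Let p0_gt0 : (0 < p0)%R := lt_le_trans pm0 pmp0.
Let x_gt0 : (0 < x)%R := lt_le_trans p_gt0 (upper_exp_ge p_gt0 ppp).
Let y_gt0 : (0 < y)%R := lower_exp_gt0 pm0 pmp.

Definition weighted_bound (q0 : R) (Phi : R -> R) (f g : E -> \bar R) :=
  forall v : E -> R, measurable_fun setT v -> (forall z, 0 < v z)%R ->
  ARH_class pm pp p0 (wpow (EFin \o v) p0) ->
  'N[mu]_q0%:E[f \* (EFin \o v)] <=
  (Phi (fine (ARH_const pm pp p0 (EFin \o v))))%:E *
    'N[mu]_p0%:E[g \* (EFin \o v)].

Lemma weighted_bound_le (q0 : R) (Phi : R -> R) (f g : E -> \bar R) (v : E -> R)
    (M : R) :
  (forall a b, (1 <= a)%R -> (a <= b)%R -> (Phi a <= Phi b)%R) ->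
  weighted_bound q0 Phi f g -> measurable_fun setT v -> (forall z, 0 < v z)%R ->
  ARH_class pm pp p0 (wpow (EFin \o v) p0) ->
  1 <= ARH_const pm pp p0 (EFin \o v) <= M%:E ->
  'N[mu]_q0%:E[f \* (EFin \o v)] <=
  (Phi M)%:E * 'N[mu]_p0%:E[g \* (EFin \o v)].
Proof.
move=> ndPhi hyp mv v0 vA /andP[c1 cM]; apply: (le_trans (hyp v mv v0 vA)).
apply: lee_wpmul2r; first exact: Lnorm_ge0.
rewrite lee_fin; move: c1 cM; case: (ARH_const _ _ _ _) => [c| |]//.
rewrite !lee_fin; exact: ndPhi.
Qed.

Lemma gamma_ge0 : (0 <= gamma pm pp p p0)%R.
Proof.
rewrite /gamma; case: ifP => _; first by rewrite le_max ler01.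
have -> : (tau pm pp p - 1 = x / y)%R.
  by rewrite tauE// /lower_exp invrK; ring.
apply: mulr_ge0; first by rewrite !divr_ge0// ltW.
have /andP[_ ip] := fine_inve_bounds p_gt0 ppp.
by rewrite subr_ge0 ltW// (lt_trans ip)// ltf_pV2// posrE.
Qed.

Lemma down_scaling (i beta tau : R) (J : \bar R) :
  (0 < beta)%R -> (0 < i)%R -> 0 <= J ->
  (p^-1 = p0^-1 + beta)%R -> J <= (2 `^ tau)%:E * i%:E ->
  J `^ beta * i%:E `^ p0^-1 <= (2 `^ (tau * beta))%:E * i%:E `^ p^-1.
Proof.
move=> b0 i0 J0 pE h.
have h' := lee_poweR (ltW b0) J0 h.
apply: (le_trans (lee_wpmul2r (poweR_ge0 _ _) h')).
rewrite -EFinM !poweR_EFin -!EFinM lee_fin powRM ?powR_ge0 ?(ltW i0)//.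
rewrite -powRrM -mulrA -powRD; last by rewrite (gt_eqF i0) implybT.
by rewrite [X in (_ * _ `^ X <= _)%R]addrC -pE lexx.
Qed.

Lemma extrapolation_down : (p < p0)%R -> exists2 C : R, (1 <= C)%R &
  forall (f g : E -> \bar R) (Phi : R -> R) (q0 q A t N : R) (w : E -> R),
  measurable_fun setT f -> measurable_fun setT g ->
  (forall z, 0 <= f z) -> (forall z, 0 <= g z) ->
  (forall a, (1 <= a)%R -> (1 <= Phi a)%R) ->
  (forall a b, (1 <= a)%R -> (a <= b)%R -> (Phi a <= Phi b)%R) ->
  (0 < q0)%R -> (0 < q)%R -> (p^-1 - q^-1 = p0^-1 - q0^-1)%R ->
  measurable_fun setT w -> (forall z, 0 < w z)%R ->
  (1 <= A)%R -> (1 <= t)%R -> (pp = +oo -> (1 < t)%R) ->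
  two_sided (x * t) y N w -> two_sided x y (A `^ x^-1) w ->
  weighted_bound q0 Phi f g ->
  'N[mu]_q%:E[f \* (EFin \o w)] <=
  (2 `^ (tau pm pp p * (p^-1 - p0^-1)))%:E *
    (Phi (C * A `^ gamma pm pp p p0))%:E * 'N[mu]_p%:E[g \* (EFin \o w)].
Proof.
move=> pp0; have [C C1 hC] := @down_weight R n pm pp p p0 pm0 pmp ppp pmp0 p0pp pp0.
exists C => // f g Phi q0 q A t N w mf mg f0 g0 Phi1 ndPhi q0p qp pqE mw w0.
move=> A1 t1 ty hN hA hyp; set M := (C * A `^ gamma pm pp p p0)%R.
have A0 : (0 < A)%R := lt_le_trans ltr01 A1.
have M1 : (1 <= M)%R by rewrite mulr_ege1// powR_ge1// gamma_ge0.
have PhiM1 : (0 < Phi M)%R := lt_le_trans ltr01 (Phi1 M M1).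
have PhiM0 := ltW PhiM1.
pose beta := (p^-1 - p0^-1)%R; rewrite -/beta.
have beta0 : (0 < beta)%R by rewrite subr_gt0 ltf_pV2// posrE.
have pE : (p^-1 = p0^-1 + beta)%R by rewrite /beta; ring.
have qE : (q^-1 = q0^-1 + beta)%R by rewrite /beta; lra.
have tauE' : tau pm pp p = (1 + x / y)%R.
  by rewrite tauE// /lower_exp invrK.
have hx1 : two_sided x (y * 1) (A `^ x^-1) w by rewrite mulr1.
pose G z := (g z * (w z)%:E) `^ p.
have mG : measurable_fun setT G.
  apply: (measurableT_comp (measurable_poweR p)).
  exact: emeasurable_funM mg (mfun_EFin mw).
have G0 z : 0 <= G z by exact: poweR_ge0.
have gw0 z : 0 <= (g \* (EFin \o w)) z.
  by apply: mule_ge0 => //; rewrite /= lee_fin ltW.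
have NE : 'N[mu]_p%:E[g \* (EFin \o w)] = (\int[mu]_z G z) `^ p^-1.
  exact: LnormE_ge0.
have I0 : 0 <= \int[mu]_z G z by apply: integral_ge0 => z _; exact: G0.
(* If the norm of g w is infinite, so is the right-hand side, because Phi M > 0. *)
rewrite NE; have [Iy|Iy] := eqVneq (\int[mu]_z G z) +oo.
  rewrite Iy poweRyr ?invr_eq0 ?gt_eqF// gt0_muley ?leey//.
  by rewrite -EFinM lte_fin mulr_gt0// powR_gt0.
have Ify : \int[mu]_z G z < +oo by rewrite ltey.
have Gint : mu.-integrable setT G.
  apply/integrableP; split; first exact: mG.
  have -> : (fun z => `|G z|) = G by apply/funext => z; rewrite gee0_abs.
  exact: Ify.
have Gfin : {ae mu, forall z, G z = (fine (G z))%:E}.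
  move: (integrable_ae measurableT Gint); apply: filterS => z /(_ I) Gz.
  by rewrite fineK.
pose P z := fine (G z).
have mP : measurable_fun setT P.
  have mfi : measurable_fun [set: \bar R] (@fine R) by [].
  exact: (measurableT_comp mfi mG).
have P0 z : (0 <= P z)%R by exact: fine_ge0.
have PE : \int[mu]_z (P z)%:E = \int[mu]_z G z.
  apply: (ae_eq_integral _ _ measurableT (mfun_EFin mP) mG).
  by move: Gfin; apply: filterS => z <-.
(* With t = 1 the exponent u is 1: for p < p0 the A_1 bound of U itself is what [down_weight] asks
   for. *)
have [|U [B [mU U0 B0 [PH IH] UQ]]] :=
  rdf_majorant x_gt0 y_gt0 A1 (lexx 1%R) mw w0 hA hx1 mP P0.
  by rewrite PE.
rewrite -tauE' in PH IH UQ.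
pose H z := (w z `^ x * U z `^ tau pm pp p)%R.
have mH : measurable_fun setT H.
  exact: measurable_funM (mfun_pow _ mw) (mfun_pow _ mU).
have H0 z : (0 < H z)%R by rewrite mulr_gt0// powR_gt0.
have [] := hC w U A t N mw w0 mU U0 A1 t1 ty hN hA (fun Q Qc => (UQ Q Qc).1).
rewrite -/beta -/M.
pose v z := (w z * H z `^ (- beta))%R.
have mv : measurable_fun setT v.
  exact: measurable_funM mw (mfun_pow _ mH).
have v0 z : (0 < v z)%R by rewrite mulr_gt0// powR_gt0.
rewrite -/v => vA vM.
have hv := weighted_bound_le ndPhi hyp mv v0 vA vM.
have GH : {ae mu, forall z, (g z * (w z)%:E) `^ p <= (H z)%:E}.
  move: Gfin PH; apply: filterS2 => z; rewrite -/(G z) => -> Pz.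
  by rewrite lee_fin.
have key := offdiag_small mf mg f0 g0 mw w0 mH H0 p_gt0 qp p0_gt0 q0p beta0
  pE qE PhiM0 GH hv.
apply: (le_trans key); rewrite [X in _ <= X * _]muleC -[leRHS]muleA.
apply: lee_wpmul2l; first by rewrite lee_fin.
have JH0 : 0 <= \int[mu]_z (H z)%:E by apply: int_ge0 => z _; exact: ltW.
move: I0 Ify PE IH JH0 => + + -> IH.
move: IH.
have -> : (fun z => (w z `^ x * U z `^ tau pm pp p)%:E) = (fun z => (H z)%:E) by [].
move: (\int[mu]_z (H z)%:E) => J.
have -> : (fun z => (g z * (w z)%:E) `^ p) = G by [].
case: (\int[mu]_z G z) => [i| |]// IH i0 _ J0.
rewrite lee_fin in i0; rewrite lte_fin in IH.
have [i00|in0] := eqVneq i 0%R.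
  rewrite i00 !poweR_EFin !powR0 ?invr_eq0 ?gt_eqF// !mule0; exact: lexx.
have ip : (0 < i)%R by rewrite lt_neqAle eq_sym in0.
exact: (down_scaling beta0 ip J0 pE (IH ip)).
Qed.

End extrapolation.

Section extrapolation_up.
Context {R : realType} (n : nat).
Local Notation E := (Rn R n).
Local Notation mu := (@leb R n).
Variables (pm : R) (pp : \bar R) (p p0 : R).
Hypotheses (pm0 : (0 < pm)%R) (pmp : (pm < p)%R) (ppp : p%:E < pp).
Hypotheses (pmp0 : (pm <= p0)%R) (p0pp : p0%:E <= pp).

Local Notation x := (upper_exp pp p).
Local Notation y := (lower_exp pm p).

Let p_gt0 : (0 < p)%R := lt_trans pm0 pmp.
Let p0_gt0 : (0 < p0)%R := lt_le_trans pm0 pmp0.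
Let x_gt0 : (0 < x)%R := lt_le_trans p_gt0 (upper_exp_ge p_gt0 ppp).
Let y_gt0 : (0 < y)%R := lower_exp_gt0 pm0 pmp.

(** As i^(1/q0) = i^(1/q) i^beta, the bound 2^(tau beta) i^beta for J^beta allows a division by
    i^beta, which is why i is a positive real number. *)
Lemma up_scaling (i q0 q beta tau Phi G : R) (J : \bar R) :
  (0 < beta)%R -> (0 < i)%R -> (0 < q)%R -> (0 <= Phi)%R -> (0 <= G)%R -> 0 <= J ->
  (q0^-1 = q^-1 + beta)%R -> J <= (2 `^ tau)%:E * i%:E ->
  i%:E `^ q0^-1 <= Phi%:E * (G%:E * J `^ beta) ->
  (i <= (2 `^ (tau * beta) * Phi * G) `^ q)%R.
Proof.
move=> b0 i0 qp Phi0 G0 J0 qE h key.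
have h' := lee_poweR (ltW b0) J0 h.
rewrite -EFinM poweR_EFin powRM ?powR_ge0 ?(ltW i0)// -powRrM in h'.
have PG0 : 0 <= Phi%:E * G%:E by rewrite -EFinM lee_fin mulr_ge0.
rewrite muleA in key; have := le_trans key (lee_wpmul2l PG0 h').
rewrite poweR_EFin -!EFinM lee_fin qE powRD; last by rewrite (gt_eqF i0) implybT.
rewrite [X in (_ <= X)%R]mulrA ler_pM2r ?powR_gt0// => key'.
have -> : (i = (i `^ q^-1) `^ q)%R.
  by rewrite -powRrM mulVf ?gt_eqF// powRr1// ltW.
apply: ler_powRl; [exact: ltW|exact: powR_ge0|].
by apply: (le_trans key'); rewrite [leLHS]mulrC mulrA lexx.
Qed.

Lemma extrapolation_up : (p0 < p)%R -> exists2 C : R, (1 <= C)%R &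
  forall (f g : E -> \bar R) (Phi : R -> R) (q0 q A t N : R) (w : E -> R),
  measurable_fun setT f -> measurable_fun setT g ->
  (forall z, 0 <= f z) -> (forall z, 0 <= g z) ->
  (forall a, (1 <= a)%R -> (1 <= Phi a)%R) ->
  (forall a b, (1 <= a)%R -> (a <= b)%R -> (Phi a <= Phi b)%R) ->
  (0 < q0)%R -> (0 < q)%R -> (p^-1 - q^-1 = p0^-1 - q0^-1)%R ->
  measurable_fun setT w -> (forall z, 0 < w z)%R ->
  (1 <= A)%R -> (1 <= t)%R -> (pp = +oo -> (1 < t)%R) ->
  two_sided (x * t) y N w -> two_sided x y (A `^ x^-1) w ->
  weighted_bound pm pp p0 q0 Phi f g ->
  'N[mu]_q%:E[f \* (EFin \o w)] <=
  (2 `^ ((1 + y / x) * (p0^-1 - p^-1)))%:E *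
    (Phi (C * A `^ gamma pm pp p p0))%:E * 'N[mu]_p%:E[g \* (EFin \o w)].
Proof.
move=> pp0; have [C C1 hC] := @up_weight R n pm pp p p0 pm0 pmp ppp pmp0 pp0.
exists C => // f g Phi q0 q A t N w mf mg f0 g0 Phi1 ndPhi q0p qp pqE mw w0.
move=> A1 t1 ty hN hA hyp; set M := (C * A `^ gamma pm pp p p0)%R.
have A0 : (0 < A)%R := lt_le_trans ltr01 A1.
have M1 : (1 <= M)%R.
  by rewrite mulr_ege1// powR_ge1//; exact: gamma_ge0.
have PhiM1 : (0 < Phi M)%R := lt_le_trans ltr01 (Phi1 M M1).
have PhiM0 := ltW PhiM1.
pose beta := (p0^-1 - p^-1)%R; rewrite -/beta.
have beta0 : (0 < beta)%R by rewrite subr_gt0 ltf_pV2// posrE.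
have pE : (p0^-1 = p^-1 + beta)%R by rewrite /beta; ring.
have qE : (q0^-1 = q^-1 + beta)%R by rewrite /beta; lra.
pose w' z := (w z `^ (-1))%R.
have mw' : measurable_fun setT w' by exact: mfun_pow.
have w'0 z : (0 < w' z)%R by exact: powR_gt0.
(* The weight 1/w satisfies the exchanged condition with constant A^(y/x) and exponent 1 + y/x;
   Buckley's power x/y turns this back into A, see [AA]. *)
have A'1 : (1 <= A `^ (y / x))%R by apply: powR_ge1 A1 (ltW (divr_gt0 y_gt0 x_gt0)).
have AyxE r : ((A `^ (y / x)) `^ r = A `^ (y / x * r))%R by rewrite -powRrM.
have hA' : two_sided y x ((A `^ (y / x)) `^ y^-1) w'.
  rewrite AyxE (_ : (y / x * y^-1 = x^-1)%R); last by field; rewrite !gt_eqF.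
  exact: two_sided_inv.
have hN' : two_sided y (x * t) N w' by exact: two_sided_inv.
have AA : ((A `^ (y / x)) `^ (x / y) = A)%R.
  rewrite AyxE (_ : (y / x * (x / y) = 1)%R) ?powRr1 ?(ltW A0)//.
  by field; rewrite !gt_eqF.
have N0 : 0 <= 'N[mu]_p%:E[g \* (EFin \o w)] by exact: Lnorm_ge0.
move: N0; case NE : 'N[mu]_p%:E[g \* (EFin \o w)] => [G| |] G0 //; last first.
  rewrite gt0_muley ?leey// -EFinM lte_fin mulr_gt0// powR_gt0//.
rewrite lee_fin in G0.
set tau' := (1 + y / x)%R in hC *.
set c := (2 `^ (tau' * beta) * Phi M * G)%R.
have c0 : (0 <= c)%R by rewrite !mulr_ge0// powR_ge0.
have fw0 z : 0 <= (f \* (EFin \o w)) z.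
  by apply: mule_ge0 => //; rewrite /= lee_fin ltW.
suff fwc : \int[mu]_z ((f \* (EFin \o w)) z `^ q) <= (c `^ q)%:E.
  rewrite (LnormE_ge0 mu q fw0) -!EFinM -/c.
  have q'0 : (0 <= q^-1)%R by rewrite invr_ge0 ltW.
  have I0 : 0 <= \int[mu]_z ((f \* (EFin \o w)) z `^ q).
    by apply: integral_ge0 => z _; exact: poweR_ge0.
  have := lee_poweR q'0 I0 fwc.
  by rewrite poweR_EFin powR_conjK// gt_eqF.
apply: integral_le_truncations.
- apply: (measurableT_comp (measurable_poweR q)).
  exact: emeasurable_funM mf (mfun_EFin mw).
- by move=> z; exact: poweR_ge0.
move=> P mP P0 Pf Pfin.
pose F z := (P z `^ q^-1)%R.
have mF : measurable_fun setT F by exact: mfun_pow.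
have F0 z : (0 <= F z)%R by exact: powR_ge0.
have FqE z : (F z `^ q = P z)%R.
  by rewrite -powRrM mulVf ?gt_eqF// powRr1.
have Ff z : (F z)%:E <= f z * (w z)%:E.
  have q'0 : (0 <= q^-1)%R by rewrite invr_ge0 ltW.
  have P0' : 0 <= (P z)%:E by rewrite lee_fin.
  have := lee_poweR q'0 P0' (Pf z); rewrite poweR_EFin.
  by rewrite (poweR_conjK (fw0 z) (negbT (gt_eqF qp))).
have [U [B [mU U0 B0 [PH IH] UQ]]] :=
  rdf_majorant y_gt0 x_gt0 A'1 t1 mw' w'0 hA' hN' mP P0 Pfin.
rewrite AA in UQ.
pose H z := (w' z `^ y * U z `^ tau')%R.
have mH : measurable_fun setT H.
  exact: measurable_funM (mfun_pow _ mw') (mfun_pow _ mU).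
have H0 z : (0 < H z)%R by rewrite mulr_gt0// powR_gt0.
have [] := hC w U A t B N mw w0 mU U0 B0 A1 t1 ty hN hA
  (fun Q Qc => (UQ Q Qc).1) (fun Q Qc => (UQ Q Qc).2).
rewrite -/beta -/M.
pose v z := (w z * H z `^ beta)%R.
have mv : measurable_fun setT v.
  exact: measurable_funM mw (mfun_pow _ mH).
have v0 z : (0 < v z)%R by rewrite mulr_gt0// powR_gt0.
rewrite -/v => vA vM.
have hv := weighted_bound_le ndPhi hyp mv v0 vA vM.
have FH : {ae mu, forall z, (F z `^ q <= H z)%R}.
  by move: PH; apply: filterS => z; rewrite FqE.
have := offdiag_large mf mg f0 g0 mw w0 mH H0 p_gt0 qp p0_gt0 q0p beta0
  pE qE PhiM0 mF F0 Ff FH hv.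
rewrite NE.
have -> : (fun z => (F z `^ q)%:E) = (fun z => (P z)%:E).
  by apply/funext => z; rewrite FqE.
have JH0 : 0 <= \int[mu]_z (H z)%:E by apply: int_ge0 => z _; exact: ltW.
have Ip0 : 0 <= \int[mu]_z (P z)%:E by apply: int_ge0 => z _; exact: P0.
move: Ip0 Pfin IH JH0.
have -> : (fun z => (w' z `^ y * U z `^ (1 + y / x))%:E) = (fun z => (H z)%:E) by [].
move: (\int[mu]_z (H z)%:E) => J.
case: (\int[mu]_z (P z)%:E) => [i| |]// i0 _ IH J0 key.
rewrite lee_fin in i0; rewrite lte_fin in IH.
have [i00|in0] := eqVneq i 0%R; first by rewrite i00 lee_fin powR_ge0.
have ip : (0 < i)%R by rewrite lt_neqAle eq_sym in0.
rewrite lee_fin; exact: (up_scaling beta0 ip qp PhiM0 G0 J0 qE (IH ip) key).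
Qed.

End extrapolation_up.

Theorem theorem4p8 (R : realType) (n : nat) (pm : R) (pp : \bar R) (p0 p : R) :
  (0 < n)%N ->
  (1 <= pm)%R -> pm%:E < pp ->
  (0 < p0)%R -> (pm <= p0)%R -> p0%:E <= pp ->
  (pm < p)%R -> p%:E < pp ->
  exists C0 : R, (1 <= C0)%R /\
    forall (F : set ((Rn R n -> \bar R) * (Rn R n -> \bar R)))
           (Phi : R -> R) (q0 q : R),
    (forall f g, F (f, g) ->
       [/\ measurable_fun setT f, measurable_fun setT g,
           forall x, 0 <= f x & forall x, 0 <= g x]) ->
    (forall x, (1 <= x)%R -> (1 <= Phi x)%R) ->
    (forall x y, (1 <= x)%R -> (x <= y)%R -> (Phi x <= Phi y)%R) ->
    (0 < q0)%R -> (0 < q)%R ->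
    (p^-1 - q^-1 = p0^-1 - q0^-1)%R ->
    (forall v : Rn R n -> \bar R,
       is_weight v -> ARH_class pm pp p0 (wpow v p0) ->
       forall f g, F (f, g) ->
         'N[@leb R n]_q0%:E[f \* v] <=
         (Phi (fine (ARH_const pm pp p0 v)))%:E *
           'N[@leb R n]_p0%:E[g \* v]) ->
    forall w : Rn R n -> \bar R,
      is_weight w -> ARH_class pm pp p (wpow w p) ->
      forall f g, F (f, g) ->
        'N[@leb R n]_q%:E[f \* w] <=
        (2 `^ (Num.max (tau pm pp p / p) (conjr (tau pm pp p) / p0)))%:E *
          (Phi (C0 * fine (ARH_const pm pp p w) `^ gamma pm pp p p0))%:E *
          'N[@leb R n]_p%:E[g \* w].
Proof.
move=> _ pm1 _ _ pmp0 p0pp pmp ppp.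
have pm0 : (0 < pm)%R := lt_le_trans ltr01 pm1.
have p_gt0 : (0 < p)%R := lt_trans pm0 pmp.
have p0_gt0 : (0 < p0)%R := lt_le_trans pm0 pmp0.
pose x := upper_exp pp p; pose y := lower_exp pm p.
have x_gt0 : (0 < x)%R := lt_le_trans p_gt0 (upper_exp_ge p_gt0 ppp).
have y_gt0 : (0 < y)%R := lower_exp_gt0 pm0 pmp.
have tE : (tau pm pp p = 1 + x / y)%R by rewrite tauE// /y /lower_exp invrK.
have t'E : (conjr (tau pm pp p) = 1 + y / x)%R.
  by rewrite tE conjr_1D ?divr_gt0// invf_div.
have tau_gt0 : (0 < tau pm pp p)%R by rewrite tE addr_gt0// divr_gt0.
have tau'_gt0 : (0 < 1 + y / x)%R by rewrite addr_gt0// divr_gt0.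
set mx := Num.max _ _.
have mx0 : (0 <= mx)%R by rewrite le_max divr_ge0// ltW.
have two_le r : (r <= mx)%R -> (2 `^ r <= 2 `^ mx :> R)%R.
  by apply: ler_powR; rewrite ler1n.
have wide (r c : R) (N : \bar R) : (r <= mx)%R -> (0 <= c)%R -> 0 <= N ->
    (2 `^ r)%:E * c%:E * N <= (2 `^ mx)%:E * c%:E * N.
  move=> rm c0 N0; apply: lee_wpmul2r => //; apply: lee_wpmul2r => //.
  by rewrite lee_fin two_le.
have gam0 := gamma_ge0 pm0 pmp ppp pmp0.
(* Here q = q0 and the hypothesis applies as it stands; C0 = 1 works because A >= 1 and gamma >=
   1. *)
have [pE|pn] := eqVneq p p0.
  exists 1%R; split; first exact: lexx.
  move=> F Phi q0 q mF Phi1 ndPhi q0p qp pqE hyp w ww wA f g Ffg.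
  have qE : q0 = q.
    by apply: invr_inj; apply: oppr_inj; apply: (addrI p^-1%R); rewrite pqE pE.
  have [_ [_ [_ [_ _ _ _ [_ [A1 _]]]]]] := ARH_class_two_sided pm0 pmp ppp ww wA.
  rewrite mul1r; move: hyp gam0 A1; rewrite -pE qE => hyp gam0 A1.
  apply: (le_trans (hyp w ww wA f g Ffg)).
  apply: lee_wpmul2r; first exact: Lnorm_ge0.
  set A := fine _ in A1 *.
  have gam1 : (1 <= gamma pm pp p p)%R by rewrite /gamma ppp le_max lexx.
  have Agam : (A <= A `^ gamma pm pp p p)%R.
    by rewrite -[leLHS](powRr1 (le_trans ler01 A1)); apply: ler_powR.
  rewrite -EFinM lee_fin; apply: (le_trans (ndPhi _ _ A1 Agam)).
  rewrite ler_peMl//; last by apply: powR_ge1; rewrite ?ler1n.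
  by apply: le_trans ler01 (Phi1 _ _); exact: powR_ge1.
have [C [e [C1 emx H]]] : exists C e : R, [/\ (1 <= C)%R, (e <= mx)%R &
    forall (f g : Rn R n -> \bar R) (Phi : R -> R) (q0 q A t N : R) (w : Rn R n -> R),
      measurable_fun setT f -> measurable_fun setT g ->
      (forall z, 0 <= f z) -> (forall z, 0 <= g z) ->
      (forall a, (1 <= a)%R -> (1 <= Phi a)%R) ->
      (forall a b, (1 <= a)%R -> (a <= b)%R -> (Phi a <= Phi b)%R) ->
      (0 < q0)%R -> (0 < q)%R -> (p^-1 - q^-1 = p0^-1 - q0^-1)%R ->
      measurable_fun setT w -> (forall z, 0 < w z)%R ->
      (1 <= A)%R -> (1 <= t)%R -> (pp = +oo -> (1 < t)%R) ->
      two_sided (x * t) y N w -> two_sided x y (A `^ x^-1) w ->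
      weighted_bound pm pp p0 q0 Phi f g ->
      'N[@leb R n]_q%:E[f \* (EFin \o w)] <=
      (2 `^ e)%:E * (Phi (C * A `^ gamma pm pp p p0))%:E *
        'N[@leb R n]_p%:E[g \* (EFin \o w)]].
  have [pp0|p0p|/eqP] := ltgtP p p0; last by rewrite (negbTE pn).
  - have [C C1 H] := @extrapolation_down R n pm pp p p0 pm0 pmp ppp pmp0 p0pp pp0.
    exists C, (tau pm pp p * (p^-1 - p0^-1))%R; split; [exact: C1| |exact: H].
    (* The exponent tau (1/p - 1/p0) is enlarged to tau/p. *)
    rewrite le_max; apply/orP; left.
    by apply: ler_wpM2l; [exact: ltW|rewrite gerBl invr_ge0 ltW].
  - have [C C1 H] := @extrapolation_up R n pm pp p p0 pm0 pmp ppp pmp0 p0p.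
    exists C, ((1 + y / x) * (p0^-1 - p^-1))%R; split; [exact: C1| |exact: H].
    rewrite le_max; apply/orP; right.
    by rewrite t'E; apply: ler_wpM2l; [exact: ltW|rewrite gerBl invr_ge0 ltW].
exists C; split; first exact: C1.
move=> F Phi q0 q mF Phi1 ndPhi q0p qp pqE hyp u uw uA f g Ffg.
have [mf mg f0 g0] := mF f g Ffg.
have [w [t [N [mw w0 uE [t1 ty] [hN [A1 hA]]]]]] :=
  ARH_class_two_sided pm0 pmp ppp uw uA.
have mEw := mfun_EFin mw.
rewrite (ae_eq_Lnorm q mf uw.1 mEw uE) (ae_eq_Lnorm p mg uw.1 mEw uE).
have wb : weighted_bound pm pp p0 q0 Phi f g.
  by move=> v mv v0 vA; exact: hyp (is_weight_EFin mv v0) vA f g Ffg.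
apply: (le_trans (H f g Phi q0 q _ t N w mf mg f0 g0 Phi1 ndPhi q0p qp pqE mw
  w0 A1 t1 ty hN hA wb)).
apply: wide; [exact: emx| |exact: Lnorm_ge0].
by apply: le_trans ler01 (Phi1 _ _); rewrite mulr_ege1// powR_ge1.
Qed.
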